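(* Let $\alpha\ge 1$, $a>1$ and $b\in\mathbb{R}$. Consider the minimization problem $$\min_{z\in\mathbb{H}}\big(\theta(\alpha;z)-b\,\theta(a\alpha;z)\big).$$ With the critical value $b_T=\sqrt a$ (independent of $\alpha$): (i) if $b\le b_T$, the minimum exists and is achieved at $z=e^{i\pi/3}$, which corresponds to the hexagonal lattice; (ii) if $b>b_T$, no minimizer exists, i.e. the minimum over $\mathbb{H}$ is not attained.
   Context: $\mathbb{H}=\{z=x+iy\in\mathbb{C}:y>0\}$. For $s>0$ and $z\in\mathbb{H}$ with $y=\Im(z)$, $$\theta(s;z)=\sum_{(m,n)\in\mathbb{Z}^2}e^{-\frac{\pi s}{y}|mz+n|^2},$$ the theta function of the unit-area lattice $\sqrt{\frac{1}{\Im(z)}}(\mathbb{Z}\oplus z\mathbb{Z})$. *)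

(* Defs.v *)
From HB Require Import structures.
From mathcomp Require Import all_boot all_order all_algebra.
From mathcomp Require Import all_classical all_reals all_analysis.
From mathcomp Require Import complex.

Set Implicit Arguments.
Unset Strict Implicit.
Unset Printing Implicit Defensive.

Import Order.TTheory GRing.Theory Num.Theory.
Local Open Scope ring_scope.
Local Open Scope classical_set_scope.
Local Open Scope complex_scope.

Definition upper_half_plane (R : realType) : set R[i] :=
  [set z | 0 < complex.Im z].

(* The terms are positive, so the unordered sum over Z^2 is [esum], the
   supremum of the finite partial sums. For 0 < s and 0 < Im z the terms are
   the exponential of a negative definite quadratic form in (m, n), the sum is
   finite and [fine] only casts it to R; the value elsewhere is irrelevant. *)
Definition theta (R : realType) (s : R) (z : R[i]) : R :=
  fine (\esum_(p in [set: int * int])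
    (expR (- (pi * s / complex.Im z
              * Normc.normc (p.1%:~R * z + p.2%:~R) ^+ 2)))%:E).

Definition expi (R : realType) (t : R) : R[i] := cos t +i* sin t.

Definition minimizer_on (R : realType) (T : Type) (D : set T) (f : T -> R)
    (x : T) : Prop :=
  D x /\ forall y, D y -> f x <= f y.

(* Main.v *)
Require Import Defs.
From mathcomp Require Import all_boot all_order all_algebra.
From mathcomp Require Import all_classical all_reals all_analysis.
From mathcomp Require Import complex finmap ring lra zify.

Import Order.TTheory GRing.Theory Num.Theory.
Import numFieldNormedType.Exports.
Local Open Scope ring_scope.
Local Open Scope classical_set_scope.
Local Open Scope complex_scope.

Set Implicit Arguments.
Unset Strict Implicit.
Unset Printing Implicit Defensive.

(** Let [rho = e^(i pi / 3)] and [N_s z = sqrt s * theta s z] ([ntheta]). Up to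
    the factor [sqrt alpha], the function to minimize is [N_alpha - beta *
    N_(a alpha)] with [beta = b / sqrt a], whence the critical value. The whole
    proof rests on one monotonicity property, [ntheta_incr_hex]:

      for every [z], [N_s z - N_s rho] is nonincreasing in [s] on [[1, oo)].

    As [s] grows, [N_s z] and [N_s rho] both approach [sqrt s], so the difference
    is also nonnegative ([ntheta_hex_min], Montgomery's theorem). If
    [beta <= 1], write the function as [(N_alpha - N_(a alpha)) + (1 - beta) *
    N_(a alpha)]: both summands are minimal at [rho], the first one by
    monotonicity. If [beta > 1], Poisson summation gives [N_s (i y)] equivalent
    to [sqrt y] for both scales as [y] grows, so the function is unbounded
    below.

    For the monotonicity, [N_s z] depends only on the lattice, and [z = x + i y]
    can be taken with [0 <= x <= 1/2] and [|z| >= 1] ([reduction]).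

    On [1 <= s <= 2] Poisson summation in one variable gives
    [N_s z = sqrt y * sum e^(- pi y (s m^2 + k^2 / s)) cos (2 pi m k x)]
    ([ntheta_poisson]). The terms at [(m, k)] and [(k, m)] together are
    stationary at [s = 1]; their increments are bounded by the one of the pair
    [m = k = 1] times geometric weights whose total is at most [0]. This shows
    that the increment of [N] is largest at [x = 1/2] ([ntheta_incr_half]) and,
    on that line, larger at a height close to that of [rho] than far away
    ([ntheta_incr_far]). Inversion maps [1/2 + i y] to a point of height
    [y / (y^2 + 1/4)], and moving back to [x = 1/2] can only increase the
    increment. Iterating this contraction ends at [rho] ([ntheta_incr_corner]).

    On [s >= 2] the derivative of [N_s z] is, up to a negative factor, the sum of
    [f (pi s Q(m, n))], where [Q] is the quadratic form of the lattice and
    [f t = (2 t - 1) e^(- t)] ([scalew]). With [t = pi s / y], the value at the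
    shortest vectors, there are three cases. If [t <= 1], the row of multiples
    of a shortest vector has a sum close to [0], by Poisson summation, against
    nearly [-1] for [rho] ([scalew_sum_far]). If [1 <= t <= 27/5], the shortest
    vectors outweigh the nonzero vectors of the hexagonal lattice
    ([scalew_sum_mid]). Otherwise write
    [Q = A m^2 + B n^2 + C (m + n)^2] with [A, B, C >= 0] and average over the
    rotation [(m, n) -> (n, - m - n)], which fixes the hexagonal form. The
    orbit average of [Q] exceeds its hexagonal value by a factor [1 + eta], so
    by convexity of [f] the distant shells lose at most a multiple of [eta],
    with a tiny constant; the first shell gains a multiple of [eta], because
    [f] is also convex in [t^-3] in this range and the sum of the inverse cubes of [A + B],
    [B + C], [C + A] is controlled by Schur's inequality ([scalew_sum_near]).

    Poisson's formula is obtained in Polya's way, as a limit of the binomial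
    expansion of [(z + 1 / z)^(2 M)] summed over roots of unity
    ([polya_identity]). Infinite sums are unconditional sums of
    absolutely summable families; limits and derivatives pass through them by
    dominated convergence ([tannery], [der_isum]). *)


(** * Absolutely convergent sums over an arbitrary index type *)

Section Sums.
Variable R : realType.

Section OneIndex.
Variable T : choiceType.
Implicit Types f g p q : T -> R.

Definition asum f : Prop := (\esum_(i in [set: T]) (`|f i|)%:E < +oo)%E.

Definition nsum p : R := fine (\esum_(i in [set: T]) (p i)%:E).

(** A signed sum is split as the sum of the nonnegative function
    [f + |f|] minus the sum of [|f|]; [isum_split] shows that any other
    splitting would do. *)
Definition isum f : R := nsum (fun i => f i + `|f i|) - nsum (fun i => `|f i|).

Lemma asum_le f g : (forall i, `|f i| <= g i) -> asum g -> asum f.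
Proof.
move=> fg; apply: le_lt_trans; apply: le_esum => i _.
by rewrite lee_fin (le_trans (fg i))// ler_norm.
Qed.

Lemma asumD f g : asum f -> asum g -> asum (fun i => f i + g i).
Proof.
move=> af ag.
suff : asum (fun i => `|f i| + `|g i|) by apply: asum_le => i /=; rewrite ler_normD.
rewrite /asum; under eq_esum do rewrite ger0_norm ?addr_ge0// EFinD.
by rewrite esumD; [exact: lte_add_pinfty| |]; move=> *; rewrite lee_fin.
Qed.

Lemma asum_norm f : asum f -> asum (fun i => `|f i|).
Proof. by rewrite /asum; under [in X in _ -> X]eq_esum do rewrite normr_id. Qed.

Lemma asumN f : asum f -> asum (fun i => - f i).
Proof. by move/asum_norm; apply: asum_le => i; rewrite normrN. Qed.

Lemma asumB f g : asum f -> asum g -> asum (fun i => f i - g i).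
Proof. by move=> af ag; apply: asumD => //; exact: asumN. Qed.

Lemma eq_asum f g : f =1 g -> asum f -> asum g.
Proof.
by move=> /funext ->.
Qed.

Lemma esum_fin p : (forall i, 0 <= p i) -> asum p ->
  (\esum_(i in [set: T]) (p i)%:E)%E = (nsum p)%:E.
Proof.
move=> p0; rewrite /asum; under eq_esum do rewrite ger0_norm//.
move=> ap; rewrite /nsum fineK// ge0_fin_numE//.
by apply: esum_ge0 => i _; rewrite lee_fin.
Qed.

Lemma nsumD p q : (forall i, 0 <= p i) -> (forall i, 0 <= q i) ->
  asum p -> asum q -> nsum (fun i => p i + q i) = nsum p + nsum q.
Proof.
move=> p0 q0 ap aq; apply: EFin_inj.
rewrite EFinD -(esum_fin p0 ap) -(esum_fin q0 aq) -esum_fin; last 2 first.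
- by move=> i; rewrite addr_ge0.
- exact: asumD.
under eq_esum do rewrite EFinD.
by rewrite esumD// => i _; rewrite lee_fin.
Qed.

Lemma isum_split p q f : (forall i, 0 <= p i) -> (forall i, 0 <= q i) ->
  asum p -> asum q -> (forall i, f i = p i - q i) -> isum f = nsum p - nsum q.
Proof.
move=> p0 q0 ap aq fE.
have af : asum f by apply: (@eq_asum (fun i => p i - q i)) => //; exact: asumB.
have an := asum_norm af.
have fn i : 0 <= f i + `|f i| by rewrite -lerBlDl sub0r ler_normr lexx orbT.
apply/eqP; rewrite /isum subr_eq addrAC eq_sym subr_eq; apply/eqP.
rewrite -!nsumD//; last exact: asumD.
by congr nsum; apply/funext => i; rewrite fE; ring.
Qed.

Lemma eq_isum f g : f =1 g -> isum f = isum g.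
Proof. by move=> /funext ->. Qed.

Lemma isum_ge0E p : (forall i, 0 <= p i) -> asum p -> isum p = nsum p.
Proof.
move=> p0 ap; have a0 : asum (fun=> 0).
  by apply: asum_le ap => i; rewrite normr0.
rewrite (@isum_split p (fun=> 0))//; last by move=> i; rewrite subr0.
by rewrite /nsum [X in _ - fine X]esum1 ?subr0.
Qed.

Lemma nsum_ge0 p : (forall i, 0 <= p i) -> 0 <= nsum p.
Proof. by move=> p0; apply: fine_ge0; apply: esum_ge0 => i _; rewrite lee_fin. Qed.

Lemma isum_ge0 p : (forall i, 0 <= p i) -> asum p -> 0 <= isum p.
Proof. by move=> p0 ap; rewrite isum_ge0E// nsum_ge0. Qed.

Lemma asum_parts f : asum f ->
  exists p q, [/\ forall i, 0 <= p i, forall i, 0 <= q i, asum p, asum q &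
    f = (fun i => p i - q i)].
Proof.
move=> af; exists (fun i => f i + `|f i|), (fun i => `|f i|); split => //.
- by move=> i; rewrite -lerBlDl sub0r ler_normr lexx orbT.
- by apply: asumD => //; exact: asum_norm.
- exact: asum_norm.
- by apply/funext => i; rewrite addrK.
Qed.

Lemma isumD f g : asum f -> asum g -> isum (fun i => f i + g i) = isum f + isum g.
Proof.
move=> /asum_parts[p [q [p0 q0 ap aq ->]]] /asum_parts[r [s [r0 s0 ar as_ ->]]].
rewrite (@isum_split (fun i => p i + r i) (fun i => q i + s i)).
- rewrite !nsumD// (@isum_split p q)// (@isum_split r s)//; ring.
- by move=> i; rewrite addr_ge0.
- by move=> i; rewrite addr_ge0.
- exact: asumD.
- exact: asumD.
- by move=> i; ring.
Qed.

Lemma isumN f : asum f -> isum (fun i => - f i) = - isum f.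
Proof.
move=> /asum_parts[p [q [p0 q0 ap aq ->]]].
rewrite (@isum_split q p)// ?(@isum_split p q)//; first by rewrite opprB.
by move=> i; rewrite opprB.
Qed.

Lemma isumB f g : asum f -> asum g -> isum (fun i => f i - g i) = isum f - isum g.
Proof. by move=> af ag; rewrite isumD ?isumN//; exact: asumN. Qed.

Lemma le_isum f g : asum f -> asum g -> (forall i, f i <= g i) -> isum f <= isum g.
Proof.
move=> af ag fg; rewrite -subr_ge0 -isumB// isum_ge0//; last exact: asumB.
by move=> i; rewrite subr_ge0.
Qed.

Lemma esumZl (c : R) p : 0 <= c -> (forall i, 0 <= p i) ->
  (\esum_(i in [set: T]) (c * p i)%:E = c%:E * \esum_(i in [set: T]) (p i)%:E)%E.
Proof.
move=> c0 p0.
have half (d : R) r : 0 <= d ->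
    (\esum_(i in [set: T]) (d * r i)%:E <= d%:E * \esum_(i in [set: T]) (r i)%:E)%E.
  move=> d0; apply: ge_ereal_sup => _ [X [finX _] <-].
  rewrite fsbig_finite//= sumEFin -mulr_sumr EFinM lee_wpmul2l ?lee_fin//.
  apply: esum_ge; exists X; first by split.
  by rewrite fsbig_finite//= sumEFin.
apply/eqP; rewrite eq_le half//=.
have [<-|cn0] := eqVneq 0 c.
  by rewrite mul0e esum_ge0// => i _; rewrite mul0r.
have {cn0}c0 : 0 < c by rewrite lt0r eq_sym cn0.
have := half c^-1 (fun i => c * p i); rewrite invr_ge0 ltW// => /(_ isT) h.
rewrite -lee_pdivlMl//; apply: le_trans h; apply: le_esum => i _.
by rewrite lee_fin mulKf// gt_eqF.
Qed.

Lemma asumZ (c : R) f : asum f -> asum (fun i => c * f i).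
Proof.
rewrite /asum; under [in X in _ -> X]eq_esum do rewrite normrM.
by move=> af; rewrite esumZl// lte_mul_pinfty// lee_fin.
Qed.

Lemma isumZ (c : R) f : asum f -> isum (fun i => c * f i) = c * isum f.
Proof.
have nsumZ (d : R) p : 0 <= d -> (forall i, 0 <= p i) -> asum p ->
    nsum (fun i => d * p i) = d * nsum p.
  by move=> d0 p0 ap; rewrite {1}/nsum esumZl// esum_fin.
have pos d p q : 0 <= d -> (forall i, 0 <= p i) -> (forall i, 0 <= q i) ->
   asum p -> asum q ->
   isum (fun i => d * (p i - q i)) = d * isum (fun i => p i - q i).
  move=> d0 p0 q0 ap aq; rewrite [X in d * X](@isum_split p q)//.
  rewrite (@isum_split (fun i => d * p i) (fun i => d * q i)) ?nsumZ ?mulrBr//.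
  - by move=> i; rewrite mulr_ge0.
  - by move=> i; rewrite mulr_ge0.
  - exact: asumZ.
  - exact: asumZ.
  - by move=> i; rewrite mulrBr.
move=> af; have [c0|/ltW c0] := leP 0 c.
  by have [p [q [p0 q0 ap aq ->]]] := asum_parts af; exact: pos.
have -> : (fun i => c * f i) = (fun i => - ((- c) * f i)).
  by apply/funext => i; rewrite mulNr opprK.
rewrite isumN; last exact: asumZ.
have [p [q [p0 q0 ap aq ->]]] := asum_parts af; rewrite pos ?oppr_ge0//.
by rewrite mulNr opprK.
Qed.

Lemma isum0 : isum (fun=> 0) = 0.
Proof. by rewrite /isum /nsum !esum1 ?subrr// => i _; rewrite ?normr0 ?addr0. Qed.

Lemma asum_fsupp (X : {fset T}) f : (forall i, i \notin X -> f i = 0) -> asum f.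
Proof.
move=> f0; rewrite /asum.
have -> : (\esum_(i in [set: T]) (`|f i|)%:E
    = \esum_(i in [set` X]) (`|f i|)%:E)%E.
  rewrite [RHS]esum_mkcond; apply: eq_esum => i _; case: ifPn => //.
  by rewrite notin_setE /= => /negP/f0 ->; rewrite normr0.
rewrite esum_fset//.
by rewrite fsbig_finite//= sumEFin ltry.
Qed.

Lemma isum_fsupp (X : {fset T}) f : (forall i, i \notin X -> f i = 0) ->
  isum f = \sum_(i <- X) f i.
Proof.
have pos p : (forall i, 0 <= p i) -> (forall i, i \notin X -> p i = 0) ->
    nsum p = \sum_(i <- X) p i.
  move=> p0 pX; rewrite /nsum.
  have -> : (\esum_(i in [set: T]) (p i)%:E = \esum_(i in [set` X]) (p i)%:E)%E.
    rewrite [RHS]esum_mkcond; apply: eq_esum => i _; case: ifPn => //.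
    by rewrite notin_setE /= => /negP/pX ->.
  rewrite esum_fset//; last by move=> *; rewrite lee_fin.
  by rewrite fsbig_finite//= sumEFin set_fsetK.
move=> f0; rewrite /isum !pos.
- by rewrite -sumrB; apply: eq_bigr => i _; rewrite addrK.
- by [].
- by move=> i /f0 ->; rewrite normr0.
- by move=> i; rewrite -lerBlDl sub0r ler_normr lexx orbT.
- by move=> i /f0 ->; rewrite normr0 addr0.
Qed.

Lemma ler_norm_isum f g : asum g -> (forall i, `|f i| <= g i) ->
  `|isum f| <= isum g.
Proof.
move=> ag fg; have af := asum_le fg ag.
rewrite ler_norml; apply/andP; split.
  rewrite lerNl -isumN//; apply: le_isum => //; first exact: asumN.
  by move=> i; rewrite (le_trans _ (fg i))// -normrN ler_norm.
by apply: le_isum => // i; exact: le_trans (ler_norm _) (fg i).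
Qed.

Lemma asum_tail g : (forall i, 0 <= g i) -> asum g -> forall e, 0 < e ->
  exists X : {fset T}, isum (fun i => if i \in X then 0 else g i) < e.
Proof.
move=> g0 ag e e0.
have gX (X : {fset T}) : asum (fun i => if i \in X then 0 else g i).
  by apply: asum_le ag => i; case: ifP => _; rewrite ?normr0 ?ger0_norm.
have : ((nsum g - e)%:E < \esum_(i in [set: T]) (g i)%:E)%E.
  by rewrite esum_fin// lte_fin ltrBlDr ltrDl.
move=> /ereal_sup_gt[_ [X [finX _] <-]]; rewrite fsbig_finite//= sumEFin lte_fin.
set Y := fset_set X => gY; exists Y.
have split_g : g = fun i => (if i \in Y then g i else 0) + (if i \in Y then 0 else g i).
  by apply/funext => i; case: ifP; rewrite ?addr0 ?add0r.
have gYs i : i \notin Y -> (if i \in Y then g i else 0) = 0.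
  by move=> /negbTE ->.
move: gY; rewrite -isum_ge0E// {1}split_g isumD//; last exact: asum_fsupp gYs.
rewrite (isum_fsupp gYs).
have -> : \sum_(i <- Y) (if i \in Y then g i else 0) = \sum_(i <- Y) g i.
  by rewrite big_seq [RHS]big_seq; apply: eq_bigr => i ->.
set a := \sum_(_ <- _) _; set b := isum _; lra.
Qed.

Lemma cvg_bigsum (S : Type) (F : set_system S) (FF : Filter F) (X : seq T)
    (h : T -> S -> R) (l : T -> R) :
  (forall i, h i @ F --> l i) ->
  (fun n => \sum_(i <- X) h i n) @ F --> \sum_(i <- X) l i.
Proof.
move=> hl; elim: X => [|i X IH].
  by under eq_fun do rewrite big_nil; rewrite big_nil; exact: cvg_cst.
by under eq_fun do rewrite big_cons; rewrite big_cons; apply: cvgD.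
Qed.

(** Outside a finite set on which [asum_tail] makes the dominating sum small,
    the terms do not matter; on it the convergence is that of a finite sum. *)
Lemma tannery (S : Type) (F : set_system S) (FF : Filter F)
    (h : S -> T -> R) f g : asum g ->
  (\forall n \near F, forall i, `|h n i| <= g i) -> (forall i, `|f i| <= g i) ->
  (forall i, h ^~ i @ F --> f i) -> (fun n => isum (h n)) @ F --> isum f.
Proof.
move=> ag hg fg hf; have g0 i : 0 <= g i by exact: le_trans (normr_ge0 _) (fg i).
apply/cvgrPdist_lt => e e0.
have e4 : 0 < e / 4 by rewrite divr_gt0.
have [X tX] := asum_tail g0 ag e4.
have gX : asum (fun i => if i \in X then 0 else g i).
  by apply: asum_le ag => i; case: ifP => _; rewrite ?normr0 ?ger0_norm.
have : (fun n => \sum_(i <- X) `|f i - h n i|) @ F --> \sum_(i <- X) (0 : R).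
  apply: cvg_bigsum => i.
  have /cvgrPdist_lt hfi := hf i; apply/cvgrPdist_lt => d d0.
  by near=> n; rewrite sub0r normrN normr_id; near: n; exact: hfi.
rewrite big1// => /cvgrPdist_lt /(_ _ e4) sumX.
near=> n.
have hn : forall i, `|h n i| <= g i by near: n.
have ah := asum_le hn ag; have af := asum_le fg ag.
rewrite -isumB//.
pose u i := if i \in X then `|f i - h n i| else 0.
have uX i : i \notin X -> u i = 0 by rewrite /u => /negbTE ->.
apply: (@le_lt_trans _ _ (isum (fun i => u i + 2 * (if i \in X then 0 else g i)))).
  apply: ler_norm_isum.
    by apply: asumD; [exact: asum_fsupp uX|exact: asumZ].
  move=> i; rewrite /u; case: ifP => _; first by rewrite mulr0 addr0.
  rewrite add0r mulr_natl mulr2n (le_trans (ler_normB _ _))// lerD//.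
rewrite isumD ?isumZ//; [|exact: asum_fsupp uX|exact: asumZ].
rewrite (isum_fsupp uX).
have -> : \sum_(i <- X) u i = \sum_(i <- X) `|f i - h n i|.
  by rewrite big_seq [RHS]big_seq; apply: eq_bigr => i iX; rewrite /u iX.
have : `|0 - \sum_(i <- X) `|f i - h n i| | < e / 4 by near: n.
rewrite sub0r normrN ger0_norm ?sumr_ge0// => s1.
move: tX s1; set a := isum _; set b := \sum_(_ <- _) _; lra.
Unshelve. all: by end_near. Qed.

Lemma delta_supp (k i : T) : i \notin [fset k]%fset -> ((i == k)%:R : R) = 0.
Proof. by rewrite inE => /negbTE ->. Qed.

Lemma asum_delta (k : T) : asum (fun i => (i == k)%:R).
Proof. exact: asum_fsupp (@delta_supp k). Qed.

Lemma isum_delta (k : T) : isum (fun i => (i == k)%:R) = 1.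
Proof. by rewrite (isum_fsupp (@delta_supp k)) big_seq_fset1 eqxx. Qed.

End OneIndex.

Lemma reindex_asum (T T' : choiceType) (e : T -> T') (f : T' -> R) :
  bijective e -> asum f -> asum (fun i => f (e i)).
Proof.
move=> be; have bij : set_bij [set: T] [set: T'] e by rewrite setTT_bijective.
by rewrite /asum (reindex_esum [set: T] _ e).
Qed.

Lemma reindex_isum (T T' : choiceType) (e : T -> T') (f : T' -> R) :
  bijective e -> isum (fun i => f (e i)) = isum f.
Proof.
move=> be; have bij : set_bij [set: T] [set: T'] e by rewrite setTT_bijective.
by rewrite /isum /nsum; congr (fine _ - fine _);
  rewrite [RHS](reindex_esum [set: T] _ e).
Qed.

Section TwoIndices.
Variables T1 T2 : choiceType.
Implicit Type f : T1 * T2 -> R.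

Lemma esum_pair f : (forall i, 0 <= f i) ->
  (\esum_(i in [set: T1]) \esum_(j in [set: T2]) (f (i, j))%:E
   = \esum_(k in [set: T1 * T2]) (f k)%:E)%E.
Proof.
move=> f0.
rewrite (@esum_esum R T1 T2 setT (fun=> setT) (fun i j => (f (i, j))%:E)); last first.
  by move=> i j _ _; rewrite lee_fin.
congr (esum _ _); first by apply/seteqP; split => -[].
by apply/funext => -[].
Qed.

Lemma asum_row f i : asum f -> asum (fun j => f (i, j)).
Proof.
rewrite /asum -(@esum_pair (fun k => `|f k|))//; apply: le_lt_trans.
rewrite [leRHS](esumID [set i])//; last first.
  by move=> k _; apply: esum_ge0 => j _; rewrite lee_fin.
rewrite setTI esum_set1; last by apply: esum_ge0 => j _; rewrite lee_fin.
rewrite leeDl// esum_ge0// => k _.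
by apply: esum_ge0 => j _; rewrite lee_fin.
Qed.

Lemma nsum_pair f : (forall k, 0 <= f k) -> asum f ->
  asum (fun i => nsum (fun j => f (i, j))) /\
  nsum (fun i => nsum (fun j => f (i, j))) = nsum f.
Proof.
move=> f0 af.
have E : (\esum_(i in [set: T1]) (nsum (fun j => f (i, j)))%:E = (nsum f)%:E)%E.
  rewrite -esum_fin// -esum_pair//; apply: eq_esum => i _; rewrite -esum_fin//.
  exact: asum_row.
split; last by rewrite {1}/nsum E.
rewrite /asum; under eq_esum do rewrite ger0_norm ?nsum_ge0//.
by rewrite E ltry.
Qed.

Lemma isum_pair f : asum f ->
  isum (fun i => isum (fun j => f (i, j))) = isum f.
Proof.
move=> af; have [p [q [p0 q0 ap aq fE]]] := asum_parts af.
have [ap' pE] := nsum_pair p0 ap; have [aq' qE] := nsum_pair q0 aq.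
rewrite (@isum_split _ (fun i => nsum (fun j => p (i, j)))
  (fun i => nsum (fun j => q (i, j)))) ?pE ?qE//.
- by rewrite fE (@isum_split _ p q).
- by move=> i; exact: nsum_ge0.
- by move=> i; exact: nsum_ge0.
- move=> i; rewrite fE (@isum_split _ (fun j => p (i, j)) (fun j => q (i, j)))//;
    exact: asum_row.
Qed.

Lemma asum_mul (a : T1 -> R) (b : T2 -> R) : asum a -> asum b ->
  asum (fun k => a k.1 * b k.2).
Proof.
move=> aa ab; rewrite /asum -(@esum_pair (fun k => `|a k.1 * b k.2|))//=.
have -> : (fun i => \esum_(j in [set: T2]) (`|a i * b j|)%:E)%E
    = (fun i => (`|a i| * nsum (fun j => `|b j|))%:E)%E.
  apply/funext => i; under eq_esum do rewrite normrM.
  by rewrite esumZl// esum_fin//; exact: asum_norm.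
apply: (le_lt_trans _ (asumZ (nsum (fun j => `|b j|)) aa)).
by apply: le_esum => i _; rewrite lee_fin normrM mulrC ler_wpM2r// ler_norm.
Qed.

Lemma isum_mul (a : T1 -> R) (b : T2 -> R) : asum a -> asum b ->
  isum (fun k => a k.1 * b k.2) = isum a * isum b.
Proof.
move=> aa ab; rewrite -isum_pair; last exact: asum_mul.
under eq_isum do rewrite /= isumZ//.
by rewrite mulrC -isumZ//; apply: eq_isum => i; rewrite mulrC.
Qed.

End TwoIndices.
End Sums.

(** * One-variable calculus and numerical bounds *)

Section Calculus.
Variable R : realType.
Implicit Types (f g : R -> R) (x a b c d : R).

(** A synonym that keeps instance resolution from choosing the derivative. *)
Definition der f x a : Prop := is_derive x 1 f a.

Lemma deriv_eq f x a b : der f x a -> a = b -> der f x b.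
Proof. by move=> ? <-. Qed.

Lemma deriv_cst x c : der (fun=> c) x 0.
Proof. exact: is_derive_cst. Qed.

Lemma deriv_id x : der (fun t => t) x 1.
Proof. exact: is_derive_id. Qed.

Lemma deriv_add f g x a b : der f x a -> der g x b ->
  der (fun t => f t + g t) x (a + b).
Proof. by move=> df dg; exact: is_deriveD. Qed.

Lemma deriv_opp f x a : der f x a -> der (fun t => - f t) x (- a).
Proof. by move=> df; exact: is_deriveN. Qed.

Lemma deriv_mul f g x a b : der f x a -> der g x b ->
  der (fun t => f t * g t) x (a * g x + f x * b).
Proof.
move=> df dg; have h := is_deriveM df dg.
by apply: (is_derive_eq h); rewrite /GRing.scale /= addrC mulrC.
Qed.

Lemma deriv_exp f x a : der f x a ->
  der (fun t => expR (f t)) x (expR (f x) * a).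
Proof.
move=> df; have h := is_derive1_comp (is_derive_expR (f x)) df.
by apply: (is_derive_eq h).
Qed.

Lemma deriv_cos f x a : der f x a ->
  der (fun t => cos (f t)) x (- sin (f x) * a).
Proof.
move=> df; have h := is_derive1_comp (is_derive_cos (f x)) df.
by apply: (is_derive_eq h).
Qed.

Lemma deriv_sin f x a : der f x a ->
  der (fun t => sin (f t)) x (cos (f x) * a).
Proof.
move=> df; have h := is_derive1_comp (is_derive_sin (f x)) df.
by apply: (is_derive_eq h).
Qed.

Lemma deriv_sqrt f x a : 0 < f x -> der f x a ->
  der (fun t => Num.sqrt (f t)) x ((2 * Num.sqrt (f x))^-1 * a).
Proof.
move=> f0 df; have h := is_derive1_comp (is_derive1_sqrt f0) df.
by apply: (is_derive_eq h).
Qed.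

Lemma deriv_inv f x a : f x != 0 -> der f x a ->
  der (fun t => (f t)^-1) x (- (f x) ^- 2 * a).
Proof. by move=> f0 df; exact: is_deriveV. Qed.

Lemma deriv_pow f n x a : der f x a ->
  der (fun t => f t ^+ n) x (n%:R * f x ^+ n.-1 * a).
Proof.
move=> df; elim: n => [|n IH].
  by apply: (deriv_eq (deriv_cst x 1)); rewrite !mul0r.
have -> : (fun t => f t ^+ n.+1) = (fun t => f t * f t ^+ n).
  by apply/funext => t; rewrite exprS.
apply: (deriv_eq (deriv_mul df IH)).
case: n {IH} => [|n]; first by rewrite /= expr0 !mul0r mulr0 addr0 !mulr1 mul1r.
by rewrite /= exprS (natrD _ 1 n.+1) /=; ring.
Qed.

Lemma derivable_within f a b (df : R -> R) :
  (forall x, a <= x <= b -> der f x (df x)) ->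
  {within `[a, b], continuous f}.
Proof.
move=> fd; apply: derivable_within_continuous => x; rewrite in_itv /= => xab.
by have [] := fd x xab.
Qed.

Lemma deriv_ge0_le f (df : R -> R) a b : a <= b ->
  (forall x, a <= x <= b -> der f x (df x)) ->
  (forall x, a <= x <= b -> 0 <= df x) -> f a <= f b.
Proof.
move=> ab fd df0.
have sub x : x \in `]a, b[%R -> a <= x <= b.
  by rewrite in_itv/= => /andP[/ltW -> /ltW ->].
apply: (@ger0_derive1_ndecr _ f a b) => //.
- by move=> x /sub /fd [].
- by move=> x /sub xab; rewrite derive1E; have [_ ->] := fd _ xab; exact: df0.
- exact: derivable_within fd.
Qed.

(** Monotonicity of [g - f]; it is applied to increments in the scale, term by
    term. *)
Lemma deriv_le_incr f g (df dg : R -> R) a b : a <= b ->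
  (forall x, a <= x <= b -> der f x (df x)) ->
  (forall x, a <= x <= b -> der g x (dg x)) ->
  (forall x, a <= x <= b -> df x <= dg x) -> f b - f a <= g b - g a.
Proof.
move=> ab fd gd le.
have : g a + - f a <= g b + - f b.
  apply: (@deriv_ge0_le (fun t => g t + - f t) (fun t => dg t + - df t)) => // x xab.
    by apply: deriv_add; [exact: gd|apply: deriv_opp; exact: fd].
  by rewrite subr_ge0 le.
by move: (f a) (f b) (g a) (g b) => *; lra.
Qed.

End Calculus.

Ltac derive_step := first
  [ exact: deriv_cst | exact: deriv_id | apply: deriv_add | apply: deriv_opp
  | apply: deriv_mul | apply: deriv_exp | apply: deriv_cos | apply: deriv_sin
  | apply: deriv_inv | apply: deriv_sqrt | apply: deriv_pow ].

(** Derives an explicit expression; leaves the side conditions of inverses and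
    roots, then the identification of the derivative. *)
Ltac derive_tac := eapply deriv_eq; [repeat derive_step | cbv beta ].

Section NumericalBounds.
Variable R : realType.
Implicit Types x y : R.

Lemma sin_le_id x : 0 <= x -> sin x <= x.
Proof.
move=> x0; have : 0 + - sin 0 <= x + - sin x :> R.
  apply: (@deriv_ge0_le _ (fun t => t + - sin t) (fun t => 1 - cos t)) => // t _.
  by derive_tac; ring.
by rewrite sin0 subr0 subr_ge0.
Qed.

Lemma cos_ge_quad x : 1 - x ^+ 2 / 2 <= cos x.
Proof.
wlog x0 : x / 0 <= x => [H|].
  have [/H //|/ltW x0] := leP 0 x.
  by rewrite -cosN -sqrrN; apply: H; rewrite oppr_ge0.
rewrite -subr_ge0.
have : cos 0 + - (1 + - (0 * 0 / 2)) <= cos x + - (1 + - (x * x / 2)) :> R.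
  apply: (@deriv_ge0_le _ (fun t => cos t + - (1 + - (t * t / 2)))
    (fun t => t - sin t)) => // t.
    by move=> _; derive_tac; field.
  by case/andP => t0 _; rewrite subr_ge0 sin_le_id.
by rewrite cos0 mul0r mul0r subr0 subrr expr2.
Qed.

Lemma pi_gt31 : 31 / 10 < pi :> R.
Proof.
have c2 (x : R) : cos (x + x) = 2 * cos x ^+ 2 - 1.
  by rewrite -mulr2n cos_mulr2n -mulr_natl.
have c1 : 61 / 66 <= cos (31 / 80 : R).
  by apply: le_trans (cos_ge_quad _); lra.
have c3 : 17 / 24 <= cos (31 / 40 : R).
  have -> : 31 / 40 = 31 / 80 + 31 / 80 :> R by lra.
  rewrite c2; move: c1; set c := cos _ => c1; nra.
have c4 : 0 < cos (31 / 20 : R).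
  have -> : 31 / 20 = 31 / 40 + 31 / 40 :> R by lra.
  rewrite c2; move: c3; set c := cos _ => c3; nra.
have p2 := pihalf_ge1 R; have p4 := pihalf_lt2 R.
have : cos (pi / 2 : R) < cos (31 / 20 : R) by rewrite cos_pihalf.
move: p2 p4; clear => p2 p4.
rewrite ltr_cos ?in_itv/=.
- by move=> h; lra.
- apply/andP; split; lra.
- apply/andP; split; lra.
Qed.

Lemma expR_ge_quad x : 0 <= x -> 1 + x + x ^+ 2 / 2 <= expR x.
Proof.
move=> x0; rewrite -subr_ge0.
have : expR 0 + - (1 + 0 + 0 * 0 / 2) <= expR x + - (1 + x + x * x / 2) :> R.
  apply: (@deriv_ge0_le _ (fun t => expR t + - (1 + t + t * t / 2))
    (fun t => expR t - (1 + t))) => // t.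
    by move=> _; derive_tac; field.
  by move=> _; rewrite subr_ge0 expR_ge1Dx.
by rewrite expR0 mul0r mul0r !addr0 subrr expr2.
Qed.

Lemma le_sqr_trans (a b x : R) : 0 <= a -> b <= a * a -> a <= x -> b <= x ^+ 2.
Proof. by move=> a0 ba ax; apply: le_trans ba _; rewrite expr2 ler_pM. Qed.

Lemma expR1_gt27 : 27 / 10 < expR 1 :> R.
Proof.
have -> : expR 1 = ((expR (1 / 8 : R) ^+ 2) ^+ 2) ^+ 2.
  by rewrite -!exprM -expRM_natl; congr expR; lra.
have h : 111 / 98 <= expR (1 / 8 : R).
  by apply: le_trans (@expR_ge_quad _ _); lra.
apply: (@lt_le_trans _ _ (73 / 27)); first by lra.
apply: (@le_sqr_trans (74 / 45)); [lra|lra|].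
apply: (@le_sqr_trans (59 / 46)); [lra|lra|].
apply: (@le_sqr_trans (111 / 98)); [lra|lra|].
exact: h.
Qed.

(** Numerical upper bounds for [expR (- x)] come from [27/10 < expR 1], after
    rounding the exponent down to an integer. *)
Lemma expRN_le (n : nat) x : n%:R <= x -> expR (- x) <= (10 / 27) ^+ n.
Proof.
move=> nx; apply: (@le_trans _ _ (expR (- n%:R))); first by rewrite ler_expR lerN2.
rewrite -mulrN1 expRM_natl; apply: lerXn2r; rewrite ?nnegrE ?expR_ge0//.
rewrite expRN invf_ple ?posrE ?expR_gt0// invf_div; exact: ltW expR1_gt27.
Qed.

End NumericalBounds.

(** * Poisson summation for the Gaussian *)

Section SumTools.
Variable R : realType.

Lemma esum_inj (T T' : choiceType) (e : T -> T') (a : T' -> \bar R) :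
  injective e -> (forall j, (forall i, e i <> j) -> a j = 0%E) ->
  (\esum_(j in [set: T']) a j = \esum_(i in [set: T]) a (e i))%E.
Proof.
move=> einj a0.
have bij : set_bij [set: T] (range e) e by apply: inj_bij => i j _ _; exact: einj.
rewrite -(@reindex_esum R T T' _ _ e a bij) [RHS]esum_mkcond.
apply: eq_esum => j _; case: ifPn => // /negP jr; rewrite a0// => i eij; apply: jr.
by apply: mem_set; exists i.
Qed.

Lemma asum_inj (T T' : choiceType) (e : T -> T') (f : T' -> R) :
  injective e -> (forall j, (forall i, e i <> j) -> f j = 0) ->
  asum (fun i => f (e i)) -> asum f.
Proof.
move=> einj f0; rewrite /asum (esum_inj (a := fun j => (`|f j|)%:E) einj)//.
by move=> j /f0 ->; rewrite normr0.
Qed.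

Lemma isum_inj (T T' : choiceType) (e : T -> T') (f : T' -> R) :
  injective e -> (forall j, (forall i, e i <> j) -> f j = 0) ->
  isum f = isum (fun i => f (e i)).
Proof.
move=> einj f0; rewrite /isum /nsum; congr (fine _ - fine _).
  rewrite (esum_inj (a := fun j => (f j + `|f j|)%:E) einj)//.
  by move=> j /f0 ->; rewrite normr0 addr0.
rewrite (esum_inj (a := fun j => (`|f j|)%:E) einj)//.
by move=> j /f0 ->; rewrite normr0.
Qed.

Lemma isum_finType (T : finType) (f : T -> R) : isum f = \sum_i f i.
Proof.
rewrite (@isum_fsupp R T [fset i | i in T]%fset); last first.
  by move=> i; rewrite !inE.
rewrite -[RHS]big_enum; apply: perm_big; apply: uniq_perm.
- exact: fset_uniq.
- exact: enum_uniq.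
- by move=> i; apply/idP/idP => _; [rewrite mem_enum|rewrite !inE].
Qed.

Lemma asum_finType (T : finType) (f : T -> R) : asum f.
Proof.
by apply: (@asum_fsupp R T [fset i | i in T]%fset) => i; rewrite !inE.
Qed.

Lemma asum_bigsum (T : choiceType) (I : Type) (r : seq I) (f : I -> T -> R) :
  (forall j, asum (f j)) -> asum (fun i => \sum_(j <- r) f j i).
Proof.
move=> af; elim: r => [|j r IH].
  apply: (@eq_asum R T (fun=> 0)) => [i|]; first by rewrite big_nil.
  by apply: (@asum_fsupp R T fset0).
apply: (@eq_asum R T (fun i => f j i + \sum_(j <- r) f j i)); last exact: asumD.
by move=> i; rewrite big_cons.
Qed.

Lemma isum_bigsum (T : choiceType) (I : Type) (r : seq I) (f : I -> T -> R) :
  (forall j, asum (f j)) ->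
  isum (fun i => \sum_(j <- r) f j i) = \sum_(j <- r) isum (f j).
Proof.
move=> af; elim: r => [|j r IH].
  by rewrite big_nil -[RHS](@isum0 R T); apply: eq_isum => i; rewrite big_nil.
rewrite big_cons -IH -isumD//; last exact: asum_bigsum.
by apply: eq_isum => i; rewrite big_cons.
Qed.

Lemma asum_geometric (r : R) : 0 <= r < 1 -> asum (fun n : nat => r ^+ n).
Proof.
case/andP => r0 r1; rewrite /asum -nneseries_esumT//.
apply: (@le_lt_trans _ _ (((1 - r)^-1)%:E)); last by rewrite ltry.
apply: lime_le; first exact: is_cvg_nneseries.
apply: nearW => n; rewrite sumEFin lee_fin.
under eq_bigr do rewrite normrX (ger0_norm r0).
rewrite big_mkord.
have r1' : 0 < 1 - r by rewrite subr_gt0.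
rewrite -(ler_pM2l r1') divff ?gt_eqF//.
have -> : (1 - r) * \sum_(i < n) r ^+ i = 1 - r ^+ n.
  by rewrite -(opprB r 1) mulNr -subrX1 opprB.
by rewrite gerBl exprn_ge0.
Qed.

Lemma asum_geometric_int (r : R) : 0 <= r < 1 -> asum (fun j : int => r ^+ absz j).
Proof.
move=> r01; have /andP[r0 r1] := r01.
pose e (j : int) : bool * nat := if j is Negz n then (false, n) else (true, absz j).
pose e' (k : bool * nat) : int := if k.1 then Posz k.2 else Negz k.2.
have be : bijective e by exists e' => [[]|[[] n]].
have ag : asum (fun k : bool * nat => 1 * r ^+ k.2).
  by apply: (@asum_mul R bool nat (fun=> 1)) => //;
    [exact: asum_finType|exact: asum_geometric].
apply: asum_le (reindex_asum be ag) => -[] n /=; rewrite ger0_norm ?exprn_ge0//.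
  by rewrite mul1r.
by rewrite mul1r exprS ler_piMl ?exprn_ge0// ltW.
Qed.

(** [(x + j) ^ 2] is at least [|j|] up to a constant, so a geometric sequence
    dominates the terms. *)
Lemma asum_gauss (c x : R) : 0 < c ->
  asum (fun j : int => expR (- (c * (x + j%:~R) ^+ 2))).
Proof.
move=> c0.
have r01 : 0 <= expR (- c) < 1 by rewrite expR_ge0 expR_lt1 oppr_lt0.
apply: asum_le (asumZ (expR (c * (x ^+ 2 + 1 + 2 * `|x|) + c)) (asum_geometric_int r01)) => j.
rewrite ger0_norm ?expR_ge0// -expRM_natl -expRD ler_expR.
have -> : (absz j)%:R = `|j%:~R| :> R by rewrite natr_absz intr_norm.
rewrite -mulrN mulrN; set a : R := _%:~R.
have h : `|a| - 1 - (x ^+ 2 + 1 + 2 * `|x|) <= (x + a) ^+ 2.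
  have : - `|x| <= x <= `|x| by rewrite -ler_norml.
  have : - `|a| <= a <= `|a| by rewrite -ler_norml.
  have := normr_ge0 x; have := normr_ge0 a.
  have : `|a| ^+ 2 = a ^+ 2 by rewrite real_normK ?num_real.
  move: `|a| `|x| => u w Eu u0 w0 /andP[h1 h2] /andP[h3 h4].
  have : 0 <= (u - w) ^+ 2 by exact: sqr_ge0.
  have E (p q : R) : (p + q) ^+ 2 = p ^+ 2 + q ^+ 2 + 2 * (p * q) by ring.
  have : - (u * w) <= x * a by nra.
  rewrite E; nra.
have : c * (`|a| - 1 - (x ^+ 2 + 1 + 2 * `|x|)) <= c * (x + a) ^+ 2.
  by rewrite ler_pM2l.
by move: (x + a) `|a| `|x| => *; lra.
Qed.

End SumTools.

Section Polya.
Variable R : realType.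
Implicit Types (x y t : R) (M L : nat) (d v j : int).

Lemma cos_2pi_int x (n : int) : cos (x + 2 * pi * n%:~R) = cos x.
Proof.
have nat_case (y : R) (m : nat) : cos (y + 2 * pi * m%:R) = cos y.
  elim: m => [|m IH]; first by rewrite mulr0 addr0.
  by rewrite -[m.+1%:R]natr1 mulrDr mulr1 addrA mulr_natl cosD2pi -mulr_natl.
case: n => n; first exact: nat_case.
by rewrite -(nat_case _ n.+1) NegzE mulrNz mulrN subrK.
Qed.

Lemma sin_pi_int_sqr x (n : int) : sin (x + pi * n%:~R) ^+ 2 = sin x ^+ 2.
Proof.
have nat_case (y : R) (m : nat) : sin (y + pi * m%:R) ^+ 2 = sin y ^+ 2.
  elim: m => [|m IH]; first by rewrite mulr0 addr0.
  by rewrite -[m.+1%:R]natr1 mulrDr mulr1 addrA sinDpi sqrrN.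
case: n => n; first exact: nat_case.
by rewrite -(nat_case _ n.+1) NegzE mulrNz mulrN subrK.
Qed.

Lemma cos_prod x y : 2 * cos x * cos y = cos (x + y) + cos (x - y).
Proof. by rewrite cosB cosD; ring. Qed.

Lemma cos_exp (n : nat) y :
  (2 * cos y) ^+ n = \sum_(k < n.+1) 'C(n, k)%:R * cos ((n%:R - 2 * k%:R) * y).
Proof.
elim: n => [|n IH].
  by rewrite big_ord1 bin0 !mulr0 subr0 mul0r cos0 mul1r expr0.
rewrite exprS IH mulr_sumr.
under eq_bigr => k _.
  rewrite mulrCA cos_prod mulrDr.
  over.
rewrite big_split /= [in RHS]big_ord_recl /=.
pose c (k : nat) : R := cos ((n.+1%:R - 2 * k%:R) * y).
have -> : \sum_(k < n.+1) 'C(n.+1, bump 0 k)%:R * cos ((n.+1%:R - 2 * (bump 0 k)%:R) * y)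
    = \sum_(k < n.+1) 'C(n, k.+1)%:R * c k.+1 + \sum_(k < n.+1) 'C(n, k)%:R * c k.+1.
  rewrite -big_split /=; apply: eq_bigr => k _.
  by rewrite /bump /= add1n binS natrD mulrDl.
rewrite [X in _ = _ + (X + _)]big_ord_recr /= (bin_small (ltnSn n)) mul0r addr0 addrA.
congr (_ + _).
  rewrite [LHS]big_ord_recl /= !bin0; congr (_ + _).
    by congr (_ * cos _); rewrite -[n.+1%:R]natr1; ring.
  apply: eq_bigr => k _; rewrite /bump /= add1n; congr (_ * cos _).
  by rewrite -[n.+1%:R]natr1; ring.
apply: eq_bigr => k _; congr (_ * _); rewrite /c -cosN; congr cos.
by rewrite -[n.+1%:R]natr1 -[k.+1%:R]natr1; ring.
Qed.

(** Orthogonality of the characters of the cyclic group of order [l]. *)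
Lemma cos_roots_sum (l : nat) d x : (0 < l)%N ->
  \sum_(j < l) cos (x + 2 * pi * d%:~R * j%:R / l%:R) =
  if (l %| d)%Z then l%:R * cos x else 0.
Proof.
move=> l0; have ln0 : l%:R != 0 :> R by rewrite pnatr_eq0 -lt0n.
case: ifPn => [/dvdzP[q ->]|ndvd].
  under eq_bigr => j _.
    have -> : 2 * pi * (q * l)%:~R * j%:R / l%:R = 2 * pi * (q * Posz j)%:~R :> R.
      by rewrite !intrM; field.
    rewrite cos_2pi_int.
    over.
  by rewrite sumr_const card_ord mulr_natl.
set h : R := pi * d%:~R / l%:R.
have sh : sin h != 0.
  rewrite -sqrf_eq0 /h {1}(divz_eq d l) intrD intrM mulrDr mulrDl.
  have -> : pi * ((d %/ l)%Z%:~R * (Posz l)%:~R) / l%:R = pi * (d %/ l)%Z%:~R :> R by field.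
  rewrite addrC sin_pi_int_sqr sqrf_eq0 gt_eqF// sin_gt0_pi//.
  have r0 : (0 < (d %% l)%Z)%R.
    rewrite lt0r modz_ge0 ?andbT//; last by case: l l0 {ln0 ndvd h}.
    by apply: contra ndvd => /eqP; move/dvdz_mod0P.
  have rl : ((d %% l)%Z < l)%R by apply: ltz_pmod.
  apply/andP; split; first by rewrite !mulr_gt0 ?pi_gt0 ?invr_gt0 ?ltr0n// ltr0z.
  rewrite ltr_pdivrMr ?ltr0n// ltr_pM2l ?pi_gt0//.
  by rewrite -[X in _ < X]/((Posz l)%:~R) ltr_int.
have tele (n : nat) : 2 * sin h * (\sum_(j < n) cos (x + 2 * pi * d%:~R * j%:R / l%:R))
    = sin (x + 2 * n%:R * h - h) - sin (x - h).
  elim: n => [|n IH]; first by rewrite big_ord0 !mulr0 mul0r addr0 subrr.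
  rewrite big_ord_recr /= mulrDr IH.
  have -> : x + 2 * pi * d%:~R * n%:R / l%:R = x + 2 * n%:R * h by rewrite /h; field.
  have -> : x + 2 * n.+1%:R * h - h = (x + 2 * n%:R * h) + h by rewrite -natr1; ring.
  by rewrite !sinB !sinD; ring.
apply/eqP; move: (tele l).
have -> : x + 2 * l%:R * h - h = (x - h) + 2 * pi * d%:~R by rewrite /h; field.
have -> : sin (x - h + 2 * pi * d%:~R) = sin (x - h).
  by rewrite -!cosBpihalf addrAC cos_2pi_int.
by rewrite subrr => /eqP; rewrite !mulf_eq0 (negbTE sh) pnatr_eq0.
Qed.

(** The binomial coefficient vanishes for [|d| > M]: expansions of powers of
    the cosine are written as sums over all integers, as in the limit. *)
Lemma asum_bin M (u : int -> R) : asum (fun d => 'C(M.*2, M + absz d)%:R * u d).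
Proof.
pose e (k : 'I_M.*2.+1) : int := Posz M - Posz k.
apply: (@asum_inj R _ _ e); last exact: asum_finType.
  by move=> i j /eqP; rewrite /e (inj_eq (addrI _)) eqr_opp => /eqP[] /val_inj.
move=> d de; rewrite bin_small ?mul0r// ltnNge; apply/negP => dM.
have dM' : (absz d <= M)%N by lia.
have kM : (absz (Posz M - d)%R < M.*2.+1)%N by lia.
by apply: (de (Ordinal kM)); rewrite /e /=; lia.
Qed.

Lemma cos_even_exp M y : (2 * cos y) ^+ M.*2 =
  isum (fun d : int => 'C(M.*2, M + absz d)%:R * cos (2 * d%:~R * y)).
Proof.
pose e (k : 'I_M.*2.+1) : int := Posz M - Posz k.
rewrite (@isum_inj R _ _ e); last 2 first.
- by move=> i j /eqP; rewrite /e (inj_eq (addrI _)) eqr_opp => /eqP[] /val_inj.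
- move=> d de; rewrite bin_small ?mul0r// ltnNge; apply/negP => dM.
  have kM : (absz (Posz M - d)%R < M.*2.+1)%N by lia.
  by apply: (de (Ordinal kM)); rewrite /e /=; lia.
rewrite isum_finType cos_exp; apply: eq_bigr => k _; congr (_%:R * cos (_ * _)).
  have [kM|Mk] := leqP k M.
    rewrite (_ : (M + absz (e k) = M.*2 - k)%N) ?bin_sub//; last by rewrite /e; lia.
    by have := ltn_ord k; lia.
  by congr 'C(_, _); rewrite /e; lia.
have -> : M.*2%:R = 2 * M%:R :> R by rewrite -mul2n natrM.
by rewrite /e intrB mulrBr.
Qed.

(** With [l = 2 L + 1] and [M] close to [t l^2 / pi], the functions [cospow]
    and [binrat] of [j] and [v] are discrete versions of the two Gaussians of
    Poisson's formula. *)
Definition cospow M L x j : R :=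
  if (absz j <= L)%N then cos (pi * (x + j%:~R) / L.*2.+1%:R) ^+ M.*2 else 0.

Definition binrat M (l : nat) v : R :=
  'C(M.*2, M + l * absz v)%:R / 'C(M.*2, M)%:R.

Lemma asum_binrat M (l : nat) (u : int -> R) : (0 < l)%N ->
  asum (fun v => binrat M l v * u v).
Proof.
move=> l0; pose e (k : 'I_M.*2.+1) : int := Posz M - Posz k.
apply: (@asum_inj R _ _ e); last exact: asum_finType.
  by move=> i j /eqP; rewrite /e (inj_eq (addrI _)) eqr_opp => /eqP[] /val_inj.
move=> v ve; rewrite /binrat bin_small ?mul0r// ltnNge; apply/negP => vM.
have vM' : (absz v <= M)%N.
  by apply: leq_trans (leq_pmull _ l0) _; rewrite -(leq_add2l M) addnn.
have kM : (absz (Posz M - v)%R < M.*2.+1)%N by lia.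
by apply: (ve (Ordinal kM)); rewrite /e /=; lia.
Qed.

(** Evaluate [(z + 1/z) ^ (2 M)] at the points [z w] with [w] running over the
    [l]-th roots of unity: only exponents divisible by [l] survive. *)
Lemma polya_identity M L x (l := L.*2.+1) :
  isum (cospow M L x) = l%:R * 'C(M.*2, M)%:R / 4 ^+ M *
    isum (fun v => binrat M l v * cos (2 * pi * v%:~R * x)).
Proof.
have l0 : (0 < l)%N by [].
have ln0 : l%:R != 0 :> R by rewrite pnatr_eq0.
have C0 : 'C(M.*2, M)%:R != 0 :> R by rewrite pnatr_eq0 -lt0n bin_gt0 -addnn leq_addr.
pose e (k : 'I_l) : int := Posz k - Posz L.
rewrite (@isum_inj R _ _ e); last 2 first.
- by move=> i j /eqP; rewrite /e (inj_eq (addIr _)) => /eqP[] /val_inj.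
- move=> j je; rewrite /cospow; case: ifPn => // jL.
  have kl : (absz (j + Posz L)%R < l)%N by rewrite /l; lia.
  by case: (je (Ordinal kl)); rewrite /e /=; lia.
rewrite isum_finType.
transitivity (4 ^- M * \sum_(j < l) isum (fun d : int => 'C(M.*2, M + absz d)%:R *
    cos (2 * d%:~R * (pi * (x + (e j)%:~R) / l%:R)))).
  rewrite mulr_sumr; apply: eq_bigr => j _; rewrite -cos_even_exp.
  rewrite /cospow ifT; last by rewrite /e; have := ltn_ord j; rewrite /l; lia.
  rewrite exprMn -[M.*2]mul2n (exprM 2) (_ : 2 ^+ 2 = 4 :> R); last by ring.
  by rewrite mulKf// expf_neq0.
rewrite -isum_bigsum; last by move=> j; exact: asum_bin.
have -> : (fun d : int => \sum_(j < l) 'C(M.*2, M + absz d)%:R *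
      cos (2 * d%:~R * (pi * (x + (e j)%:~R) / l%:R))) =
    (fun d : int => 'C(M.*2, M + absz d)%:R *
      if (l %| d)%Z then l%:R * cos (2 * pi * d%:~R * (x - L%:R) / l%:R) else 0).
  apply/funext => d; rewrite -mulr_sumr -cos_roots_sum//; congr (_ * _).
  apply: eq_bigr => j _; congr cos; rewrite /e intrB.
  by rewrite -[(Posz j)%:~R]/(j%:R) -[(Posz L)%:~R]/(L%:R); field.
rewrite (@isum_inj R _ _ (fun v : int => Posz l * v)); last 2 first.
- by move=> i j; apply: mulfI; rewrite -lt0n.
- move=> d dl; rewrite ifF ?mulr0//; apply/negbTE/negP => /dvdzP[q dq].
  by apply: (dl q); rewrite dq mulrC.
rewrite -[RHS]isumZ; last by apply: asum_binrat.
rewrite -[LHS]isumZ; last first.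
  pose u (v : int) := if (l %| (Posz l * v))%Z then
    l%:R * cos (2 * pi * (Posz l * v)%:~R * (x - L%:R) / l%:R) else 0 : R.
  apply: (@eq_asum _ _ (fun v : int => 'C(M.*2, M)%:R * (binrat M l v * u v))).
    by move=> v; rewrite /binrat mulrA mulrCA divff// mulr1 abszM.
  by apply: asumZ; exact: asum_binrat.
apply: eq_isum => v; rewrite dvdz_mulr// abszM /binrat.
have -> : cos (2 * pi * (Posz l * v)%:~R * (x - L%:R) / l%:R) = cos (2 * pi * v%:~R * x).
  rewrite -(cos_2pi_int (2 * pi * v%:~R * x) (- (v * Posz L))); congr cos.
  by rewrite mulrNz !intrM -[(Posz L)%:~R]/(L%:R) -[(Posz l)%:~R]/(l%:R); field.
by rewrite /=; field; rewrite C0 expf_neq0.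
Qed.

End Polya.

(** ** Convergence to the Gaussians *)

Section PolyaBounds.
Variable R : realType.
Implicit Types (x y z t : R) (M L r : nat).

(** The derivative of [sin y - y cos y] is [y sin y]. *)
Lemma sin_ge_mulcos y : 0 <= y <= pi -> y * cos y <= sin y.
Proof.
case/andP => y0 ypi.
have : sin 0 + - (0 * cos 0) <= sin y + - (y * cos y) :> R.
  apply: (@deriv_ge0_le R (fun t => sin t + - (t * cos t)) (fun t => t * sin t)) => // t.
    by move=> _; derive_tac; ring.
  case/andP => t0 ty; rewrite mulr_ge0// sin_ge0_pi// t0/=.
  exact: le_trans ty ypi.
by rewrite sin0 mul0r subr0 subr_ge0.
Qed.

(** [cos y * expR (y^2 / 2)] has derivative
    [(y cos y - sin y) * expR (y^2 / 2)]. *)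
Lemma cos_le_gauss y : `|y| <= pi / 2 -> cos y <= expR (- (y ^+ 2 / 2)).
Proof.
wlog y0 : y / 0 <= y => [H|].
  have [/H //|/ltW y0] := leP 0 y.
  by rewrite -cosN -sqrrN -normrN; apply: H; rewrite oppr_ge0.
rewrite ger0_norm// => yp.
have h : - (cos 0 * expR (0 * 0 / 2)) <= - (cos y * expR (y * y / 2)) :> R.
  apply: (@deriv_ge0_le R (fun t => - (cos t * expR (t * t / 2)))
    (fun t => (sin t - t * cos t) * expR (t * t / 2))) => // t.
    by move=> _; derive_tac; field.
  case/andP => t0 ty; rewrite mulr_ge0 ?expR_ge0// subr_ge0 sin_ge_mulcos// t0/=.
  by have := pi_gt0 R; lra.
move: h; rewrite cos0 !mul0r expR0 mul1r lerN2 -expr2 => h.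
by rewrite expRN -[leRHS]mul1r ler_pdivlMr ?expR_gt0.
Qed.

Lemma one_minus_ge z : 0 <= z < 1 -> expR (- (z / (1 - z))) <= 1 - z.
Proof.
case/andP => z0 z1; have z1' : 0 < 1 - z by rewrite subr_gt0.
rewrite expRN invf_ple ?posrE ?expR_gt0//.
apply: le_trans (expR_ge1Dx _).
suff -> : 1 + z / (1 - z) = (1 - z)^-1 by [].
by field; rewrite gt_eqF.
Qed.

Lemma binrat_step M r : 'C(M.*2, M + r.+1)%:R * (M + r.+1)%:R
  = 'C(M.*2, M + r)%:R * (M - r)%:R :> R.
Proof.
rewrite -!natrM; congr (_%:R); rewrite addnS mulnC.
have := mul_bin_left M.*2 (M + r); rewrite mulnC => ->.
by rewrite mulnC; congr (_ * _)%N; lia.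
Qed.

(** Multiply the bounds [1 - u <= expR (- u)] for the ratios [binrat_step] of
    consecutive binomial coefficients; [binrat_ge] multiplies the reverse bounds
    [1 + u <= expR u]. *)
Lemma binrat_le M l v (r := (l * absz v)%N) :
  binrat R M l v <= expR (- (r%:R ^+ 2 / (M + r)%:R)).
Proof.
have C0 : 0 < 'C(M.*2, M)%:R :> R by rewrite ltr0n bin_gt0 -addnn leq_addr.
rewrite /binrat -/r ler_pdivrMr//.
have [Mr|rM] := ltnP M r.
  by rewrite bin_small ?mulr_ge0 ?expR_ge0//; lia.
have : (r <= r)%N by [].
move: {1 3 4}r => k; elim: k => [|k IH] kr.
  by rewrite addn0 expr0n mul0r oppr0 expR0 mul1r.
have Mk : 0 < (M + k.+1)%:R :> R by rewrite ltr0n addnS.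
have [N0 MkN] : 0 < (M + r)%:R :> R /\ (M + k.+1)%:R <= (M + r)%:R :> R.
  by split; rewrite ?ltr0n ?ler_nat; lia.
have MkE : (M - k)%:R = (M + k.+1)%:R - (2 * k%:R + 1) :> R.
  rewrite natrB; last by lia.
  by rewrite natrD -[k.+1%:R]natr1; ring.
rewrite -(ler_pM2r Mk) binrat_step MkE.
move: (IH (ltnW kr)) => {IH}.
move: N0 Mk MkN C0 MkE.
move: (M + r)%:R (M + k.+1)%:R 'C(M.*2, M)%:R 'C(M.*2, M + k)%:R => N K C D.
move=> N0 K0 KN C0 MkE h.
have -> : expR (- (k.+1%:R ^+ 2 / N)) = expR (- (k%:R ^+ 2 / N)) * expR (- ((2 * k%:R + 1) / N)).
  by rewrite -expRD; congr expR; rewrite -[k.+1%:R]natr1; field; rewrite gt_eqF.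
have K1 : 0 <= K - (2 * k%:R + 1) by rewrite -MkE ler0n.
set E := expR (- (k%:R ^+ 2 / N)) in h *; have E0 : 0 < E := expR_gt0 _.
apply: (le_trans (ler_wpM2r K1 h)).
suff key : K - (2 * k%:R + 1) <= expR (- ((2 * k%:R + 1) / N)) * K.
  have -> : E * expR (- ((2 * k%:R + 1) / N)) * C * K =
    E * C * (expR (- ((2 * k%:R + 1) / N)) * K) by ring.
  by apply: ler_wpM2l => //; rewrite mulr_ge0// ltW.
apply: (@le_trans _ _ ((1 - (2 * k%:R + 1) / N) * K)); last first.
  by apply: ler_wpM2r; [exact: ltW|exact: expR_ge1Dx].
rewrite mulrBl mul1r lerD2l lerN2 -mulrA ler_piMr ?addr_ge0 ?mulr_ge0//.
by rewrite mulrC ler_pdivrMr// mul1r.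
Qed.

Lemma binrat_ge M l v (r := (l * absz v)%N) : (r < M)%N ->
  expR (- (r%:R ^+ 2 / (M%:R - r%:R))) <= binrat R M l v.
Proof.
move=> rM; have C0 : 0 < 'C(M.*2, M)%:R :> R by rewrite ltr0n bin_gt0 -addnn leq_addr.
rewrite /binrat -/r ler_pdivlMr//.
have N0 : 0 < M%:R - r%:R :> R by rewrite subr_gt0 ltr_nat.
have : (r <= r)%N by [].
move: {1 3 5}r => k; elim: k => [|k IH] kr.
  by rewrite addn0 expr0n mul0r oppr0 expR0 mul1r.
have K0 : 0 < (M + k.+1)%:R :> R by rewrite ltr0n addnS.
rewrite -(ler_pM2r K0) binrat_step natrB; last by lia.
have h := IH (ltnW kr).
have Mk : M%:R - r%:R <= M%:R - k%:R :> R by rewrite lerD2l lerN2 ler_nat ltnW.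
have Mk0 : 0 <= M%:R - k%:R :> R by apply: le_trans Mk; exact: ltW.
apply: le_trans (ler_wpM2r Mk0 h).
set N := M%:R - r%:R in N0 Mk h *.
have -> : expR (- (k.+1%:R ^+ 2 / N)) = expR (- (k%:R ^+ 2 / N)) / expR ((2 * k%:R + 1) / N).
  by rewrite -expRB; congr expR; rewrite -[k.+1%:R]natr1; field; rewrite gt_eqF.
set E := expR (- (k%:R ^+ 2 / N)); set F := expR _.
have F0 : 0 < F := expR_gt0 _.
suff key : (M + k.+1)%:R <= F * (M%:R - k%:R).
  have -> : E / F * 'C(M.*2, M)%:R * (M + k.+1)%:R =
     E * 'C(M.*2, M)%:R * (F^-1 * (M + k.+1)%:R) by ring.
  by rewrite ler_wpM2l ?mulr_ge0 ?expR_ge0// ler_pdivrMl.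
apply: (@le_trans _ _ ((1 + (2 * k%:R + 1) / N) * (M%:R - k%:R))); last first.
  by rewrite ler_wpM2r//; exact: expR_ge1Dx.
rewrite mulrDl mul1r natrD -[k.+1%:R]natr1 -lerBlDl.
rewrite (_ : _ - _ = 2 * k%:R + 1); last by ring.
by rewrite -mulrA ler_peMr ?addr_ge0 ?mulr_ge0// mulrC ler_pdivlMr// mul1r.
Qed.

End PolyaBounds.

Section PoissonGauss.
Variable R : realType.
Variable t : R.
Hypothesis t0 : 0 < t.

(* The power is chosen so that pi M / l^2 tends to t. *)
Let l (i : nat) : R := i.*2.+1%:R.
Let M (i : nat) : nat := Num.truncn (t * l i ^+ 2 / pi).
Let q (i : nat) : R := pi * (M i)%:R / l i ^+ 2.

Let l_gt0 i : 0 < l i. Proof. by rewrite ltr0n. Qed.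

Let cvg_linv : (l i)^-1 @[i --> \oo] --> (0 : R).
Proof.
apply: (@squeeze_cvgr _ _ _ _ (fun=> 0) (@harmonic R)).
- near=> i; rewrite invr_ge0 ltW//= lef_pV2 ?posrE ?ltr0n// ler_nat ltnS.
  by rewrite -addnn leq_addr.
- exact: cvg_cst.
- exact: cvg_harmonic.
Unshelve. all: by end_near. Qed.

Let q_bounds i : t - pi * (l i)^-1 ^+ 2 <= q i <= t.
Proof.
have l2 : 0 < l i ^+ 2 by rewrite exprn_gt0.
have p0 := pi_gt0 R.
have /truncn_itv/andP[h1 h2] : 0 <= t * l i ^+ 2 / pi.
  by rewrite !mulr_ge0 ?invr_ge0 ?(ltW t0) ?(ltW l2) ?(ltW p0).
apply/andP; split; last first.
  by rewrite /q ler_pdivrMr// [pi * _]mulrC -ler_pdivlMr.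
move: h2; rewrite -/(M i) -natr1 ltr_pdivrMr// => h2.
rewrite /q exprVn lerBlDr -mulrDl ler_pdivlMr//.
by apply/ltW/(lt_le_trans h2); rewrite mulrDl mul1r [_ * pi]mulrC.
Qed.

Let cvg_q : q i @[i --> \oo] --> t.
Proof.
apply: (@squeeze_cvgr _ _ _ _ (fun i => t - pi * (l i)^-1 ^+ 2) (fun=> t)).
- by apply: nearW => i; exact: q_bounds.
- rewrite [X in _ --> X](_ : t = t - pi * (0 * 0)); last by rewrite !mulr0 subr0.
  apply: cvgB; first exact: cvg_cst.
  apply: cvgM; [exact: cvg_cst|].
  under eq_fun do rewrite expr2; exact: cvgM.
- exact: cvg_cst.
Qed.

Let M_q i : (M i)%:R = l i ^+ 2 * (q i / pi).
Proof.
have ln0 : l i != 0 by rewrite gt_eqF.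
have pn0 : pi != 0 :> R by rewrite gt_eqF ?pi_gt0.
rewrite /q; move: (l i) (M i)%:R (pi : R) ln0 pn0 => a m p a0 p0.
by field; rewrite a0 p0.
Qed.

Section Cosine.
Variable x : R.
Hypothesis x12 : `|x| <= 1 / 2.

Let th i (j : int) : R := pi * (x + j%:~R) / l i.

Let cos_pow_le i j : `|th i j| <= pi / 2 ->
  cos (th i j) ^+ (M i).*2 <= expR (- (pi * (x + j%:~R) ^+ 2 * q i)).
Proof.
move=> h; apply: (@le_trans _ _ (expR (- (th i j ^+ 2 / 2)) ^+ (M i).*2)).
  apply: lerXn2r; rewrite ?nnegrE ?expR_ge0 ?cos_le_gauss// cos_ge0_pihalf//.
  by rewrite -ler_norml.
rewrite -expRM_natl ler_expR -mul2n natrM M_q /th.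
have ln0 : l i != 0 by rewrite gt_eqF.
have pn0 : pi != 0 :> R by rewrite gt_eqF ?pi_gt0.
rewrite le_eqVlt; apply/orP; left; apply/eqP.
move: (l i) (q i) (pi : R) (x + _) ln0 pn0 => a b p y a0 p0.
by field; rewrite a0 p0.
Qed.

Let cospow_dom i j : t / 2 <= q i ->
  `|cospow (M i) i x j| <= expR (- (pi * t / 2 * (x + j%:~R) ^+ 2)).
Proof.
move=> qi; rewrite /cospow; case: ifPn => [ji|_]; last by rewrite normr0 expR_ge0.
rewrite ger0_norm; last by rewrite exprn_even_ge0// odd_double.
apply: (le_trans (cos_pow_le _)).
  rewrite /th normrM normrM (ger0_norm (pi_ge0 R)) (@gtr0_norm _ (l i)^-1) ?invr_gt0//.
  rewrite -mulrA ler_pM2l ?pi_gt0// ler_pdivrMr//.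
  apply: (le_trans (ler_normD _ _)); rewrite -intr_norm -natr_absz.
  have : (absz j)%:R <= i%:R :> R by rewrite ler_nat.
  have -> : l i = 2 * i%:R + 1 by rewrite /l -natr1 -mul2n natrM.
  by move: x12 => *; lra.
rewrite ler_expR lerN2 (_ : _ / 2 * _ = pi * (x + j%:~R) ^+ 2 * (t / 2)); last by ring.
by rewrite ler_wpM2l// mulr_ge0 ?pi_ge0 ?sqr_ge0.
Qed.

Let cvg_th j : th i j @[i --> \oo] --> (0 : R).
Proof.
rewrite /th -(mulr0 (pi * (x + j%:~R))); apply: cvgM; [exact: cvg_cst|exact: cvg_linv].
Qed.

Let cvg_cospow j : cospow (M i) i x j @[i --> \oo] -->
  expR (- (pi * t * (x + j%:~R) ^+ 2)).
Proof.
set c := pi * (x + j%:~R) ^+ 2.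
have -> : pi * t * (x + j%:~R) ^+ 2 = c * t by rewrite /c mulrAC.
apply: (@squeeze_cvgr _ _ _ _
  (fun i => expR (- (c * q i / (1 - th i j * th i j / 2)))) (fun i => expR (- (c * q i)))).
- near=> i.
  have th1 : `|th i j| <= 1.
    near: i; have /cvgrPdist_le /(_ 1 ltr01) := cvg_th j.
    by apply: filterS => i; rewrite sub0r normrN.
  have -> : cospow (M i) i x j = cos (th i j) ^+ (M i).*2.
    by rewrite /cospow ifT//; near: i; exact: nbhs_infty_ge.
  apply/andP; split; last first.
    by apply: cos_pow_le; apply: (le_trans th1); exact: pihalf_ge1.
  set z := th i j * th i j / 2.
  have z01 : 0 <= z < 1.
    have : th i j * th i j <= 1.
      by rewrite -expr2 -[leLHS]ger0_norm ?sqr_ge0// normrX expr_le1.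
    have : 0 <= th i j * th i j by rewrite -expr2 sqr_ge0.
    by rewrite /z; move: (th i j * _) => *; apply/andP; split; lra.
  have z1 : 1 - z != 0 by case/andP: z01 => _; rewrite -subr_gt0 => /gt_eqF ->.
  apply: (@le_trans _ _ (expR (- (z / (1 - z))) ^+ (M i).*2)).
    rewrite -expRM_natl ler_expR -mul2n natrM M_q.
    have ln0 : l i != 0 by rewrite gt_eqF.
    have pn0 : pi != 0 :> R by rewrite gt_eqF ?pi_gt0.
    have zE : z = pi ^+ 2 * (x + j%:~R) ^+ 2 / (2 * l i ^+ 2).
      rewrite /z /th; move: (l i) (pi : R) (x + _) ln0 => a p y a0.
      by field; rewrite a0.
    rewrite le_eqVlt; apply/orP; left; apply/eqP.
    rewrite {2}zE /c; move: z1 ln0 pn0 {zE z01}; move: (1 - z) => w.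
    move: (l i) (q i) (pi : R) (x + _) => a b p y w0 a0 p0.
    by field; rewrite w0 a0 p0.
  apply: lerXn2r; rewrite ?nnegrE ?expR_ge0//.
    rewrite cos_ge0_pihalf// -ler_norml (le_trans th1)//; exact: pihalf_ge1.
  apply: (le_trans (one_minus_ge z01)).
  by rewrite /z -expr2; exact: cos_ge_quad.
- apply: continuous_cvg; first exact: continuous_expR.
  apply: cvgN; rewrite (_ : c * t = c * t / (1 - 0 * 0 / 2)); last first.
    by rewrite !mul0r subr0 divr1.
  apply: cvgM; first by apply: cvgM; [exact: cvg_cst|exact: cvg_q].
  apply: cvgV; first by rewrite !mul0r subr0 oner_neq0.
  apply: cvgB; first exact: cvg_cst.
  by apply: cvgM; [|exact: cvg_cst];  apply: cvgM; exact: cvg_th.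
- apply: continuous_cvg; first exact: continuous_expR.
  by apply: cvgN; apply: cvgM; [exact: cvg_cst|exact: cvg_q].
Unshelve. all: by end_near. Qed.

Lemma cvg_sum_cospow : isum (cospow (M i) i x) @[i --> \oo] -->
  isum (fun j : int => expR (- (pi * t * (x + j%:~R) ^+ 2))).
Proof.
have pt2 : 0 < pi * t / 2 by rewrite divr_gt0// mulr_gt0// pi_gt0.
have tt : t / 2 < t by rewrite ltr_pdivrMr// ltr_pMr// ltr1n.
apply: (@tannery _ _ _ _ _ (fun i => cospow (M i) i x) _
  (fun j => expR (- (pi * t / 2 * (x + j%:~R) ^+ 2)))).
- exact: asum_gauss.
- near=> i => j; apply: cospow_dom.
  by near: i; exact: (cvgr_ge t cvg_q).
- move=> j; rewrite ger0_norm ?expR_ge0// ler_expR lerN2 ler_wpM2r ?sqr_ge0//.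
  by rewrite ler_pdivrMr// ler_peMr ?ler1n// mulr_ge0 ?pi_ge0 ?ltW.
- exact: cvg_cospow.
Unshelve. all: by end_near. Qed.

End Cosine.
Let binrat_dom i v : binrat R (M i) i.*2.+1 v <= expR (- (pi / (2 * t) * (0 + v%:~R) ^+ 2)).
Proof.
rewrite add0r; set r := (i.*2.+1 * absz v)%N.
have [Mr|rM] := ltnP (M i) r.
  by rewrite /binrat -/r bin_small ?mul0r ?expR_ge0//; lia.
apply: (le_trans (binrat_le _ _ _ _)); rewrite ler_expR lerN2 -/r.
have [->|v0] := eqVneq v 0; first by rewrite expr0n mulr0 divr_ge0.
have r0 : (0 < r)%N by rewrite /r; lia.
have M0 : 0 < (M i)%:R :> R by rewrite ltr0n; lia.
have rE : r%:R ^+ 2 = l i ^+ 2 * v%:~R ^+ 2 :> R.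
  rewrite /r natrM exprMn; congr (_ * _).
  by rewrite -[RHS]real_normK ?num_real// -intr_norm -natr_absz.
apply: (@le_trans _ _ (r%:R ^+ 2 / (2 * (M i)%:R))); last first.
  rewrite ler_wpM2l ?sqr_ge0// lef_pV2 ?posrE ?mulr_gt0// ?ltr0n; last by lia.
  by rewrite -natrM ler_nat mul2n -addnn leq_add2l.
have /andP[_ qt] := q_bounds i.
have Mt : pi * (M i)%:R <= l i ^+ 2 * t.
  by move: qt; rewrite /q ler_pdivrMr ?exprn_gt0// [t * _]mulrC.
rewrite rE (_ : pi / _ * _ = (v%:~R ^+ 2 / 2) * (pi / t)); last by rewrite invfM; ring.
rewrite (_ : _ / (2 * _) = (v%:~R ^+ 2 / 2) * (l i ^+ 2 / (M i)%:R)); last by rewrite invfM; ring.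
by rewrite ler_wpM2l ?divr_ge0 ?sqr_ge0// ler_pdivlMr// mulrAC ler_pdivrMr.
Qed.

Let cvg_binrat v : binrat R (M i) i.*2.+1 v @[i --> \oo] --> expR (- (pi / t * (0 + v%:~R) ^+ 2)).
Proof.
rewrite add0r; set a : R := (absz v)%:R.
have va : v%:~R ^+ 2 = a ^+ 2 :> R.
  by rewrite -[LHS]real_normK ?num_real// -intr_norm -natr_absz.
have p0 := pi_gt0 R.
have D (e : R) : (fun i => q i / pi + e * (a * (l i)^-1)) @ \oo --> t / pi.
  rewrite [X in _ --> X](_ : _ = t / pi + e * (a * 0)); last by rewrite !mulr0 addr0.
  apply: cvgD; first by apply: cvgM; [exact: cvg_q|exact: cvg_cst].
  apply: cvgM; first exact: cvg_cst.
  by apply: cvgM; [exact: cvg_cst|exact: cvg_linv].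
have L (e : R) : (fun i => expR (- (a ^+ 2 / (q i / pi + e * (a * (l i)^-1))))) @ \oo
    --> expR (- (pi / t * v%:~R ^+ 2)).
  apply: continuous_cvg; first exact: continuous_expR.
  apply: cvgN; rewrite va [_ * a ^+ 2]mulrC -[pi / t]invf_div.
  apply: cvgM; first exact: cvg_cst.
  by apply: cvgV; [rewrite gt_eqF ?divr_gt0|exact: D].
have E (e : R) i : ((i.*2.+1 * absz v)%N%:R ^+ 2 / ((M i)%:R + e * (i.*2.+1 * absz v)%N%:R))
    = a ^+ 2 / (q i / pi + e * (a * (l i)^-1)).
  have ln0 : l i != 0 by rewrite gt_eqF.
  rewrite natrM -/a -/(l i) M_q.
  have -> : l i ^+ 2 * (q i / pi) + e * (l i * a) =
      l i ^+ 2 * (q i / pi + e * (a * (l i)^-1)).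
    by move: (q i / pi) (l i) ln0 => b c c0; field.
  by rewrite exprMn -mulf_div divff ?mul1r// expf_neq0.
apply: (@squeeze_cvgr _ _ _ _
  (fun i => expR (- (a ^+ 2 / (q i / pi + (-1) * (a * (l i)^-1)))))
  (fun i => expR (- (a ^+ 2 / (q i / pi + 1 * (a * (l i)^-1)))))) => //.
near=> i; rewrite -!E; apply/andP; split; last first.
  by rewrite mul1r -natrD; exact: binrat_le.
rewrite mulN1r; apply: binrat_ge.
have : 0 < q i / pi + (-1) * (a * (l i)^-1).
  by near: i; apply: (cvgr_gt _ (D (-1))); rewrite divr_gt0.
rewrite -(@ltr_nat R) natrM -/a -/(l i) M_q mulN1r subr_gt0 => h.
rewrite -(ltr_pM2l (l_gt0 i)) in h.
rewrite expr2 -mulrA ltr_pM2l//; move: h; rewrite mulrCA divff ?mulr1// gt_eqF//.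
Unshelve. all: by end_near. Qed.

Let cvg_sum_binrat x :
  isum (fun v => binrat R (M i) i.*2.+1 v * cos (2 * pi * v%:~R * x)) @[i --> \oo] -->
  isum (fun v : int => expR (- (pi / t * (0 + v%:~R) ^+ 2)) * cos (2 * pi * v%:~R * x)).
Proof.
have cos1 (u w c : R) : 0 <= u -> u <= w -> `|u * cos c| <= w.
  move=> u0 uw; rewrite normrM ger0_norm// (le_trans _ uw)// ler_piMr//.
  exact: cos_max.
have pt2 : 0 < pi / (2 * t) by rewrite divr_gt0 ?pi_gt0// mulr_gt0.
apply: (@tannery _ _ _ _ _
  (fun i v => binrat R (M i) i.*2.+1 v * cos (2 * pi * v%:~R * x)) _
  (fun v => expR (- (pi / (2 * t) * (0 + v%:~R) ^+ 2)))).
- exact: asum_gauss.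
- by apply: nearW => i v; apply: cos1; [rewrite divr_ge0|exact: binrat_dom].
- move=> v; apply: cos1; first exact: expR_ge0.
  rewrite ler_expR lerN2 ler_wpM2r ?sqr_ge0// ler_wpM2l ?pi_ge0//.
  by rewrite lef_pV2 ?posrE ?mulr_gt0// ler_peMl ?ler1n// ltW.
- by move=> v; apply: cvgM; [exact: cvg_binrat|exact: cvg_cst].
Qed.

Definition theta1 (s : R) : R := isum (fun j : int => expR (- (pi * s * (0 + j%:~R) ^+ 2))).

Lemma theta1_ge1 s : 0 < s -> 1 <= theta1 s.
Proof.
move=> s0; have ps : 0 < pi * s by rewrite mulr_gt0 ?pi_gt0.
rewrite -[leLHS](isum_delta R (0 : int)).
apply: le_isum; [exact: asum_delta|exact: asum_gauss|] => j.
case: eqP => [->|_]; last exact: expR_ge0.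
by rewrite addr0 expr0n mulr0 oppr0 expR0.
Qed.

Let c i : R := i.*2.+1%:R * 'C((M i).*2, M i)%:R / 4 ^+ M i.

(* The case x = 0 of the identity, solved for its constant. *)
Let kappa : R := theta1 t / theta1 t^-1.

Let cvg_c : c i @[i --> \oo] --> kappa.
Proof.
have h0 : `|0 : R| <= 1 / 2 by rewrite normr0 divr_ge0.
have A := cvg_sum_cospow h0; have B := @cvg_sum_binrat 0.
have th0 : 0 < theta1 t^-1.
  by apply: lt_le_trans (theta1_ge1 _); rewrite ?invr_gt0.
have BE : isum (fun v : int => expR (- (pi / t * (0 + v%:~R) ^+ 2)) * cos (2 * pi * v%:~R * 0))
    = theta1 t^-1.
  by apply: eq_isum => v; rewrite mulr0 cos0 mulr1.
rewrite BE in B.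
apply: (@cvg_trans _ ((fun i => isum (cospow (M i) i 0) /
   isum (fun v => binrat R (M i) i.*2.+1 v * cos (2 * pi * v%:~R * 0))) @ \oo)).
  apply: near_eq_cvg; near=> i; rewrite polya_identity mulfK//.
  rewrite gt_eqF//; near: i; exact: (cvgr_gt _ B).
by apply: cvgM => //; apply: cvgV; rewrite // gt_eqF.
Unshelve. all: by end_near. Qed.

(** The limit of [polya_identity], with a constant not depending on [x]. *)
Lemma poisson_kappa x : `|x| <= 1 / 2 ->
  isum (fun j : int => expR (- (pi * t * (x + j%:~R) ^+ 2))) = theta1 t / theta1 t^-1 *
  isum (fun v : int => expR (- (pi / t * (0 + v%:~R) ^+ 2)) * cos (2 * pi * v%:~R * x)).
Proof.
move=> h; have A := cvg_sum_cospow h.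
have B : isum (cospow (M i) i x) @[i --> \oo] --> kappa *
    isum (fun v : int => expR (- (pi / t * (0 + v%:~R) ^+ 2)) * cos (2 * pi * v%:~R * x)).
  rewrite (_ : (fun i => isum (cospow (M i) i x)) = (fun i => c i *
    isum (fun v => binrat R (M i) i.*2.+1 v * cos (2 * pi * v%:~R * x)))).
    by apply: cvgM; [exact: cvg_c|exact: cvg_sum_binrat].
  by apply/funext => i; rewrite polya_identity.
exact: (cvg_unique (@Rhausdorff R) A B).
Qed.

(** The limit of [wallis] gives the square of the constant, up to the explicit
    factor [t / pi]. *)
Definition wallis (n : nat) : R := n%:R * ('C(n.*2, n)%:R / 4 ^+ n) ^+ 2.

Lemma kappa_sqr_cvg : wallis (M i) @[i --> \oo] --> (theta1 t / theta1 t^-1) ^+ 2 * t / pi.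
Proof.
have -> : (fun i => wallis (M i)) = (fun i => c i * c i * q i / pi).
  apply/funext => i; rewrite /wallis M_q /c -/(l i).
  have ln0 : l i != 0 by rewrite gt_eqF.
  move: (q i) (pi : R) (l i) 'C(_, _)%:R (4 ^+ _) ln0 => a b d e f d0.
  ring.
apply: cvgM; last exact: cvg_cst.
by apply: cvgM; last exact: cvg_q; rewrite expr2; apply: cvgM; exact: cvg_c.
Qed.

Lemma cvg_M_infty : M i @[i --> \oo] --> \oo.
Proof.
apply/cvgnyPge => A; near=> i.
have x0 : 0 <= t * l i ^+ 2 / pi.
  by rewrite divr_ge0 ?pi_ge0// mulr_ge0 ?sqr_ge0// ltW.
rewrite /M truncn_ge_nat// ler_pdivlMr ?pi_gt0//.
rewrite -ler_pdivrMl//; apply: (@le_trans _ _ i%:R).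
  by near: i; exact: nbhs_infty_ger.
apply: (@le_trans _ _ (l i)); first by rewrite ler_nat; lia.
by rewrite expr2 ler_peMr ?ler1n// ltW.
Unshelve. all: by end_near. Qed.

End PoissonGauss.

(** ** The constant, by duality *)

Section Poisson.
Variable R : realType.

Lemma central_bin n :
  ('C(n.+1.*2, n.+1) * n.+1 = 2 * n.*2.+1 * 'C(n.*2, n))%N.
Proof.
have e1 : (n.+1 * 'C(n.+1.*2, n.+1) = n.+1.*2 * 'C(n.*2.+1, n))%N.
  by rewrite -mul_bin_diag doubleS.
have e2 : (n.*2.+1 * 'C(n.*2, n) = n.+1 * 'C(n.*2.+1, n.+1))%N.
  by rewrite -mul_bin_diag.
have e3 : 'C(n.*2.+1, n.+1) = 'C(n.*2.+1, n).
  by rewrite -bin_sub; [congr 'C(_, _); lia|lia].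
apply/eqP; rewrite -(eqn_pmul2l (ltn0Sn n)); apply/eqP.
by rewrite mulnA e1 -mulnA -mulnA [(n.*2.+1 * _)%N]e2 e3 -mul2n; lia.
Qed.

(** Monotone and bounded: the limit is the constant of Wallis' product. *)
Lemma wallis_cvg : exists W : R, 0 <= W /\ wallis R n @[n --> \oo] --> W.
Proof.
pose p n : R := 'C(n.*2, n)%:R / 4 ^+ n.
have p0 n : 0 <= p n by rewrite divr_ge0// exprn_ge0.
have pS n : p n.+1 = p n * ((2 * n%:R + 1) / (2 * n%:R + 2)).
  have h : 'C(n.+1.*2, n.+1)%:R * (n%:R + 1) = 2 * (2 * n%:R + 1) * 'C(n.*2, n)%:R :> R.
    rewrite natr1 -natrM central_bin !natrM; congr (_ * _ * _).
    by rewrite -[n.*2.+1%:R]natr1 -mul2n natrM.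
  have n1 : n%:R + 1 != 0 :> R by rewrite natr1 pnatr_eq0.
  have -> : p n.+1 = 'C(n.+1.*2, n.+1)%:R * (n%:R + 1) / (n%:R + 1) / 4 ^+ n.+1.
    by rewrite mulfK.
  rewrite h exprS /p; have f0 : 4 ^+ n != 0 :> R by rewrite expf_neq0.
  move: (4 ^+ n) (n%:R : R) 'C(_, _)%:R f0 n1 => f m C f0 m1.
  field; rewrite f0 m1 /=.
  by rewrite -[X in _ + X]mulr1 -mulrDr mulf_neq0.
have wE n : wallis R n = n%:R * p n ^+ 2 by [].
have inc : {homo wallis R : n m / (n <= m)%N >-> n <= m}.
  apply/nondecreasing_seqP => n; rewrite !wE pS -[n.+1%:R]natr1 [(p n * _) ^+ 2]exprMn.
  set a : R := n%:R; have a0 : 0 <= a by rewrite ler0n.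
  rewrite [leRHS]mulrCA [leRHS]mulrC ler_wpM2r ?sqr_ge0//.
  have d0 : 0 < (2 * a + 2) ^+ 2 by rewrite exprn_gt0//; lra.
  rewrite expr_div_n mulrA ler_pdivlMr//; nra.
have bnd n : (2 * n%:R + 1) * p n ^+ 2 <= 1.
  elim: n => [|n IH]; first by rewrite /p mulr0 add0r mul1r bin0 expr0 divr1 expr1n.
  rewrite pS -[n.+1%:R]natr1 [(p n * _) ^+ 2]exprMn; apply: le_trans IH.
  set a : R := n%:R; have a0 : 0 <= a by rewrite ler0n.
  rewrite [leLHS]mulrCA [leLHS]mulrC ler_wpM2r ?sqr_ge0//.
  have d0 : 0 < (2 * a + 2) ^+ 2 by rewrite exprn_gt0//; lra.
  rewrite expr_div_n mulrA ler_pdivrMr//; nra.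
exists (sup (range (wallis R))); split; last first.
  apply: nondecreasing_cvgn => //; exists 1 => _ [n _ <-]; rewrite wE.
  apply: le_trans (bnd n); rewrite ler_wpM2r ?sqr_ge0//.
  by have : 0 <= n%:R :> R by []; lra.
apply: le_trans (_ : wallis R 0 <= _); first by rewrite wE mul0r.
apply: ub_le_sup; last by exists 0%N.
exists 1 => _ [n _ <-]; rewrite wE; apply: le_trans (bnd n).
rewrite ler_wpM2r ?sqr_ge0//; have : 0 <= n%:R :> R by []; lra.
Qed.

(** Let [k t] be the left-hand side. Then [k t * k t^-1 = 1], and
    [k t ^+ 2 * t] is the same constant for all [t] by [kappa_sqr_cvg]; the
    two relations determine both the constant and [k]. *)
Lemma theta1_inv (t : R) : 0 < t -> theta1 t / theta1 t^-1 = (Num.sqrt t)^-1.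
Proof.
have [W [W0 cW]] := wallis_cvg; have p0 := pi_gt0 R.
have kW (s : R) : 0 < s -> (theta1 s / theta1 s^-1) ^+ 2 * s / pi = W.
  move=> s0; have A := kappa_sqr_cvg s0.
  have B := cvg_comp _ _ (cvg_M_infty s0) cW.
  exact: (cvg_unique (@Rhausdorff R) A B).
move=> t0; have it0 : 0 < t^-1 by rewrite invr_gt0.
have := kW _ t0; have := kW _ it0; rewrite invrK.
have T1 : 0 < theta1 t := lt_le_trans ltr01 (theta1_ge1 t0).
have T2 : 0 < theta1 t^-1 := lt_le_trans ltr01 (theta1_ge1 it0).
move: (theta1 t) (theta1 t^-1) T1 T2 => a b a0 b0 h2 h1.
have W2 : (pi * W) ^+ 2 = 1.
  rewrite expr2 -{1}h1 -h2.
  move: (pi : R) p0 => q q0; field; rewrite !gt_eqF//.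
have pW : pi * W = 1.
  apply/eqP; rewrite -(@eqrXn2 _ 2) ?expr1n ?W2//.
  by rewrite mulr_ge0 ?pi_ge0.
have k2 : (a / b) ^+ 2 = t^-1.
  apply: (mulIf (lt0r_neq0 t0)); rewrite mulVf ?gt_eqF// -pW -h1.
  by rewrite [RHS]mulrC mulfVK// gt_eqF.
rewrite -sqrtrV ?ltW// -k2 sqrtr_sqr ger0_norm//.
by rewrite divr_ge0 ?ltW.
Qed.

(** Both sides are [1]-periodic in [x], which reduces to [|x| <= 1/2]. *)
Theorem poisson_gauss (t x : R) : 0 < t ->
  isum (fun j : int => expR (- (pi * t * (x + j%:~R) ^+ 2))) = (Num.sqrt t)^-1 *
  isum (fun k : int => expR (- (pi / t * k%:~R ^+ 2)) * cos (2 * pi * k%:~R * x)).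
Proof.
move=> t0; pose n : int := Num.floor (x + 1 / 2).
have /andP[n1 n2] : n%:~R <= x + 1 / 2 < (n + 1)%:~R.
  exact: floor_itv.
have h : `|x - n%:~R| <= 1 / 2.
  move: n2; rewrite intrD ler_norml => n2; apply/andP; split; lra.
have bn : bijective (fun j : int => j + n).
  by exists (fun j => j - n) => j; rewrite ?addrK ?subrK.
have P := poisson_kappa t0 h.
rewrite -(reindex_isum _ bn) in P.
transitivity (isum (fun i : int => expR (- (pi * t * (x - n%:~R + (i + n)%:~R) ^+ 2)))).
  apply: eq_isum => j; congr (expR (- (_ * _ ^+ 2))).
  by rewrite intrD; ring.
rewrite P theta1_inv//; congr (_ * _); apply: eq_isum => v; rewrite add0r; congr (_ * _).
rewrite -(cos_2pi_int (2 * pi * v%:~R * x) (- (v * n))); congr cos.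
by rewrite mulrNz intrM; ring.
Qed.

End Poisson.

(** * The theta function of a lattice and its symmetries *)

Section Lattice.
Variable R : realType.
Implicit Types (s x y : R) (p : int * int).

(** The squared norms [|m z + n|^2 / y] of the unit-area lattice of
    [z = x + i y], at [p = (m, n)]. *)
Definition latq x y p : R := ((p.1%:~R * x + p.2%:~R) ^+ 2 + (p.1%:~R * y) ^+ 2) / y.

(** Multiplying theta by [sqrt s] makes the functional equation the symmetry
    [s <-> 1 / s]. *)
Definition ntheta s x y : R :=
  Num.sqrt s * isum (fun p : int * int => expR (- (pi * s * latq x y p))).

Lemma latq_ge0 x y p : 0 < y -> 0 <= latq x y p.
Proof. by move=> y0; rewrite divr_ge0 ?addr_ge0 ?sqr_ge0 ?ltW. Qed.

(** A binary form of determinant [1] and trace [T] is at least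
    [(m^2 + n^2) / T] (Cayley-Hamilton). *)
Lemma latq_lower x y p : 0 < y ->
  y / (x ^+ 2 + y ^+ 2 + 1) * (p.1%:~R ^+ 2 + p.2%:~R ^+ 2) <= latq x y p.
Proof.
move=> y0; rewrite /latq; move: (p.1%:~R : R) (p.2%:~R : R) => m n.
have T0 : 0 < x ^+ 2 + y ^+ 2 + 1 by have := sqr_ge0 x; have := sqr_ge0 y; lra.
rewrite ler_pdivlMr// -subr_ge0.
rewrite -(pmulr_lge0 _ T0) mulrBl.
have -> : ((m * x + n) ^+ 2 + (m * y) ^+ 2) * (x ^+ 2 + y ^+ 2 + 1) -
    y / (x ^+ 2 + y ^+ 2 + 1) * (m ^+ 2 + n ^+ 2) * y * (x ^+ 2 + y ^+ 2 + 1) =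
    ((x ^+ 2 + y ^+ 2) * m + x * n) ^+ 2 + (x * m + n) ^+ 2.
  by field; rewrite gt_eqF.
by rewrite addr_ge0 ?sqr_ge0.
Qed.

Lemma asum_gauss2 (c d : R) : 0 < c -> 0 < d ->
  asum (fun p : int * int => expR (- (c * p.1%:~R ^+ 2)) * expR (- (d * p.2%:~R ^+ 2))).
Proof.
move=> c0 d0; apply: (eq_asum _ (asum_mul (asum_gauss 0 c0) (asum_gauss 0 d0))) => p /=.
by rewrite !add0r.
Qed.

Lemma asum_lat s x y : 0 < s -> 0 < y ->
  asum (fun p : int * int => expR (- (pi * s * latq x y p))).
Proof.
move=> s0 y0; have T0 : 0 < x ^+ 2 + y ^+ 2 + 1.
  by have := sqr_ge0 x; have := sqr_ge0 y; lra.
have c0 : 0 < pi * s * (y / (x ^+ 2 + y ^+ 2 + 1)).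
  by rewrite !mulr_gt0 ?pi_gt0 ?invr_gt0.
apply: asum_le (asum_gauss2 c0 c0) => p; rewrite ger0_norm ?expR_ge0//.
rewrite -expRD ler_expR -opprD lerN2 -mulrDr -[leLHS]mulrA ler_pM2l ?mulr_gt0 ?pi_gt0//.
exact: latq_lower.
Qed.

(** ** Poisson summation in the second coordinate *)

Definition pgauss s y (p : int * int) : R :=
  expR (- (pi * y * (s * p.1%:~R ^+ 2 + p.2%:~R ^+ 2 / s))).

Lemma asum_pgauss s y : 0 < s -> 0 < y -> asum (pgauss s y).
Proof.
move=> s0 y0.
have c0 : 0 < pi * y * s by rewrite !mulr_gt0 ?pi_gt0.
have d0 : 0 < pi * y / s by rewrite !mulr_gt0 ?pi_gt0 ?invr_gt0.
apply: eq_asum (asum_gauss2 c0 d0) => p; rewrite -expRD; congr expR; ring.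
Qed.

Lemma asum_pgauss_mul s y (u : int * int -> R) (b : R) : 0 < s -> 0 < y ->
  (forall p, `|u p| <= b) -> asum (fun p => pgauss s y p * u p).
Proof.
move=> s0 y0 ub; apply: asum_le (asumZ b (asum_pgauss s0 y0)) => p.
by rewrite normrM ger0_norm ?expR_ge0// mulrC ler_wpM2r ?expR_ge0.
Qed.

(** [poisson_gauss] in the second coordinate, at scale [s / y]. *)
Lemma ntheta_poisson s x y : 0 < s -> 0 < y ->
  ntheta s x y = Num.sqrt y *
    isum (fun p => pgauss s y p * cos (2 * pi * (p.1 * p.2)%:~R * x)).
Proof.
move=> s0 y0; have sy0 : 0 < s / y by rewrite divr_gt0.
rewrite /ntheta -isum_pair; last exact: asum_lat.
rewrite -[in RHS]isum_pair; last first.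
  by apply: (@asum_pgauss_mul _ _ _ 1) => // p; exact: cos_max.
have row m : isum (fun n : int => expR (- (pi * s * latq x y (m, n)))) =
    (Num.sqrt (s / y))^-1 *
    isum (fun k : int => pgauss s y (m, k) * cos (2 * pi * (m * k)%:~R * x)).
  transitivity (expR (- (pi * s * y * m%:~R ^+ 2)) *
      isum (fun n : int => expR (- (pi * (s / y) * (m%:~R * x + n%:~R) ^+ 2)))).
    rewrite -isumZ; last by apply: asum_gauss; rewrite mulr_gt0 ?pi_gt0.
    apply: eq_isum => n; rewrite -expRD; congr expR; rewrite /latq /=.
    by move: (pi : R) => q; field; rewrite gt_eqF.
  have as1 : asum (fun k : int => expR (- (pi / (s / y) * k%:~R ^+ 2)) *
      cos (2 * pi * k%:~R * (m%:~R * x))).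
    have c0 : 0 < pi / (s / y) by rewrite divr_gt0 ?pi_gt0.
    apply: asum_le (asum_gauss 0 c0) => k; rewrite add0r normrM ger0_norm ?expR_ge0//.
    by rewrite ler_piMr ?expR_ge0// cos_max.
  rewrite poisson_gauss// mulrCA -isumZ//; congr (_ * _); apply: eq_isum => k.
  rewrite mulrA -expRD; congr (expR _ * cos _); last by rewrite intrM; ring.
  by move: (pi : R) => q /=; field; rewrite !gt_eqF.
have as2 : asum (fun m : int =>
    isum (fun k : int => pgauss s y (m, k) * cos (2 * pi * (m * k)%:~R * x))).
  have c0 : 0 < pi * y * s by rewrite !mulr_gt0 ?pi_gt0.
  have d0 : 0 < pi * y / s by rewrite !mulr_gt0 ?pi_gt0 ?invr_gt0.
  pose G := isum (fun k : int => expR (- (pi * y / s * (0 + k%:~R) ^+ 2))).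
  apply: asum_le (asumZ G (asum_gauss 0 c0)) => m.
  rewrite /G [leRHS]mulrC -isumZ; last exact: asum_gauss.
  apply: ler_norm_isum; first by apply: asumZ; exact: asum_gauss.
  move=> k; rewrite normrM ger0_norm ?expR_ge0// -expRD !add0r.
  apply: (le_trans (ler_piMr (expR_ge0 _) (cos_max _))).
  by rewrite ler_expR /= -mulrN le_eqVlt; apply/orP; left; apply/eqP; ring.
under [in LHS]eq_isum do rewrite row.
rewrite isumZ// mulrA; congr (_ * _).
by rewrite sqrtrM ?ltW// sqrtrV ?ltW// invfM invrK mulrA divff ?mul1r// gt_eqF ?sqrtr_gt0.
Qed.

(** ** Modular invariance *)

(** The action of [(a, b; c, d)] on the upper half plane. *)
Definition mobius_re (a b c d : int) x y : R :=
  ((a%:~R * x + b%:~R) * (c%:~R * x + d%:~R) + a%:~R * c%:~R * y ^+ 2) / (y * latq x y (c, d)).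

Definition mobius_im (c d : int) x y : R := (latq x y (c, d))^-1.

(** The lattice of [g z] is, up to rotation, the one of [z] in another basis. *)
Lemma latq_mobius (a b c d : int) x y p : 0 < y -> a * d - b * c = 1 ->
  0 < latq x y (c, d) ->
  latq (mobius_re a b c d x y) (mobius_im c d x y) p =
  latq x y (a * p.1 + c * p.2, b * p.1 + d * p.2).
Proof.
move=> y0 det q0; have detR : a%:~R * d%:~R - b%:~R * c%:~R = 1 :> R.
  by rewrite -!intrM -intrB det.
have q0' : (c%:~R * x + d%:~R) ^+ 2 + (c%:~R * y) ^+ 2 != 0 :> R.
  by apply: contraTneq q0; rewrite /latq /= => ->; rewrite mul0r ltxx.
have qE : y * latq x y (c, d) = (c%:~R * x + d%:~R) ^+ 2 + (c%:~R * y) ^+ 2.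
  by rewrite /latq /= mulrC divfK// gt_eqF.
have yE : mobius_im c d x y = y / ((c%:~R * x + d%:~R) ^+ 2 + (c%:~R * y) ^+ 2).
  by rewrite /mobius_im /latq invf_div.
rewrite /latq yE /mobius_re qE /= !intrD !intrM.
move: q0' detR; move: (a%:~R : R) (b%:~R : R) (c%:~R : R) (d%:~R : R) (p.1%:~R : R) (p.2%:~R : R).
move=> A B C D m n q0' detR.
set D0 := (_ + _ : R) in q0' *; set N := (A * x + B) * _ + _.
have my : m * y = m * ((A * D - B * C) * y) by rewrite detR mul1r.
have E : (m * N + n * D0) ^+ 2 + (m * y) ^+ 2 =
  D0 * (((A * m + C * n) * x + (B * m + D * n)) ^+ 2 + ((A * m + C * n) * y) ^+ 2).
  by rewrite my /N /D0; ring.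
transitivity (((m * N + n * D0) ^+ 2 + (m * y) ^+ 2) / (D0 * y)).
  by move: N D0 q0' {E} => N D0 q0'; field; rewrite q0' gt_eqF.
by rewrite E; move: D0 q0' {E} => D0 q0'; field; rewrite q0' gt_eqF.
Qed.
End Lattice.

(** ** Reduction *)

Section Modular.
Variable R : realType.
Implicit Types (s x y : R) (p : int * int).

Lemma latq_gt0 x y p : 0 < y -> p != (0, 0) -> 0 < latq x y p.
Proof.
move=> y0 pn0; apply: lt_le_trans (latq_lower x p y0).
have T0 : 0 < x ^+ 2 + y ^+ 2 + 1 by have := sqr_ge0 x; have := sqr_ge0 y; lra.
rewrite mulr_gt0 ?divr_gt0//; case: p pn0 => m n; rewrite -pair_eqE /= negb_and.
case/orP => h; [rewrite ltr_pwDl ?sqr_ge0//|rewrite ltr_wpDl ?sqr_ge0//];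
  by rewrite exprn_even_gt0//= intr_eq0.
Qed.

Lemma ntheta_mobius s x y (a b c d : int) : 0 < y -> a * d - b * c = 1 ->
  ntheta s (mobius_re a b c d x y) (mobius_im c d x y) = ntheta s x y.
Proof.
move=> y0 det; rewrite /ntheta; congr (_ * _).
pose e (p : int * int) := (a * p.1 + c * p.2, b * p.1 + d * p.2).
have be : bijective e.
  exists (fun p => (d * p.1 - c * p.2, a * p.2 - b * p.1)) => -[m n];
    rewrite /e /=; congr (_, _).
  - transitivity ((a * d - b * c) * m); [ring|by rewrite det mul1r].
  - transitivity ((a * d - b * c) * n); [ring|by rewrite det mul1r].
  - transitivity ((a * d - b * c) * m); [ring|by rewrite det mul1r].
  - transitivity ((a * d - b * c) * n); [ring|by rewrite det mul1r].
rewrite -[RHS](reindex_isum _ be); apply: eq_isum => p.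
rewrite latq_mobius//; apply: latq_gt0 => //; apply/eqP => -[c0 d0].
by move: det; rewrite c0 d0 !mulr0 subrr.
Qed.

Lemma ntheta_opp s x y : ntheta s (- x) y = ntheta s x y.
Proof.
rewrite /ntheta; congr (_ * _).
have be : bijective (fun p : int * int => (- p.1, p.2)).
  by exists (fun p : int * int => (- p.1, p.2)) => -[m n] /=; rewrite opprK.
rewrite -[RHS](reindex_isum _ be); apply: eq_isum => p.
by rewrite /latq /= mulrNz mulrN !mulNr sqrrN.
Qed.

Lemma ntheta_swap s x y : 0 < y ->
  ntheta s (x / (x ^+ 2 + y ^+ 2)) (y / (x ^+ 2 + y ^+ 2)) = ntheta s x y.
Proof.
move=> y0; have r0 : x ^+ 2 + y ^+ 2 != 0 by rewrite gt_eqF// ltr_wpDl ?sqr_ge0 ?exprn_gt0.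
have be : bijective (fun p : int * int => (p.2, p.1)).
  by exists (fun p : int * int => (p.2, p.1)) => -[m n].
rewrite /ntheta; congr (_ * _).
rewrite -[RHS](reindex_isum _ be); apply: eq_isum => p; congr (expR (- (_ * _))).
rewrite /latq /=; move: (p.1%:~R : R) (p.2%:~R : R) => m n.
by field; rewrite r0 gt_eqF.
Qed.

(** By [latq_lower] only finitely many vectors compete with [(0, 1)]. *)
Lemma exists_min_vector x y : 0 < y ->
  exists2 p0, p0 != (0, 0) & forall p, p != (0, 0) -> latq x y p0 <= latq x y p.
Proof.
move=> y0; set T := x ^+ 2 + y ^+ 2 + 1.
have T0 : 0 < T by have := sqr_ge0 x; have := sqr_ge0 y; rewrite /T; lra.
pose N := (Num.truncn (T / y ^+ 2)).+1.
have big p : latq x y p <= y^-1 -> (absz p.1 <= N)%N /\ (absz p.2 <= N)%N.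
  move=> /(le_trans (latq_lower x p y0)); rewrite -/T => h.
  have h2 : p.1%:~R ^+ 2 + p.2%:~R ^+ 2 < N%:R :> R.
    apply: le_lt_trans (truncnS_gt _).
    rewrite ler_pdivlMr ?exprn_gt0//.
    have := ler_wpM2l (ltW (mulr_gt0 T0 y0)) h.
    rewrite (_ : T * y * (y / T * _) = (p.1%:~R ^+ 2 + p.2%:~R ^+ 2) * y ^+ 2); last first.
      by field; rewrite gt_eqF.
    by rewrite mulfK ?gt_eqF.
  have sq (k : int) : k%:~R ^+ 2 < N%:R :> R -> (absz k <= N)%N.
    rewrite -[k%:~R ^+ 2]real_normK ?num_real// -intr_norm -natr_absz -natrX ltr_nat => kN.
    apply/ltnW; apply: leq_ltn_trans kN.
    by case: (absz k) => // j; rewrite -mulnn leq_pmulr.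
  by split; apply: sq; apply: le_lt_trans h2; rewrite ?lerDl ?lerDr sqr_ge0.
pose e (k : 'I_N.*2.+1) : int := Posz k - Posz N.
have ex (k : int) : (absz k <= N)%N -> exists i, e i = k.
  move=> kN; have kl : (absz (k + Posz N)%R < N.*2.+1)%N by lia.
  by exists (Ordinal kl); rewrite /e /=; lia.
have [i0 e0] := ex 0 isT; have [i1 e1] := ex 1 isT.
pose F (ij : 'I_N.*2.+1 * 'I_N.*2.+1) := latq x y (e ij.1, e ij.2).
pose P (ij : 'I_N.*2.+1 * 'I_N.*2.+1) := (e ij.1, e ij.2) != (0, 0).
have P0 : P (i0, i1) by rewrite /P /= e0 e1.
have [ij Pij ijmin] := @arg_minP _ _ _ (i0, i1) P F P0.
exists (e ij.1, e ij.2) => // p pn0.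
have [/big[p1 p2]|] := leP (latq x y p) y^-1; last first.
  move=> h; apply: le_trans (ltW h); apply: le_trans (ijmin _ P0) _.
  by rewrite /F /= e0 e1 /latq /= !mulr0z mulr1z !mul0r add0r expr1n expr0n addr0 mul1r.
have [i ei] := ex _ p1; have [j ej] := ex _ p2.
have := ijmin (i, j); rewrite /P /F /= ei ej -surjective_pairing; exact.
Qed.

(** A minimal vector is primitive; moved to [(0, 1)] by Bezout, it makes
    [|z| >= 1] for all translates of [z]. A translation and the reflection
    [x -> - x] then bring [x] to [[0, 1/2]]. *)
Lemma reduction x y : 0 < y -> exists x' y',
  [/\ 0 < y', 0 <= x' <= 1 / 2, 1 <= x' ^+ 2 + y' ^+ 2 &
      forall s, ntheta s x' y' = ntheta s x y].
Proof.
move=> y0; have [[c d] cd0 cdmin] := exists_min_vector x y0.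
have q0 := latq_gt0 x y0 cd0.
have cop : coprimez c d.
  rewrite /coprimez; set g := gcdz c d.
  have [[c' cE] [d' dE]] : (exists c', c = c' * g) /\ (exists d', d = d' * g).
    by split; apply/dvdzP; [exact: dvdz_gcdl|exact: dvdz_gcdr].
  have cd'0 : (c', d') != (0, 0).
    by apply: contraNneq cd0 => -[c'0 d'0]; rewrite cE dE c'0 d'0 !mul0r.
  have g0 : (0 <= g)%R by [].
  have gn0 : g != 0.
    by apply: contraNneq cd0 => g_0; rewrite cE dE g_0 !mulr0.
  have := cdmin _ cd'0.
  have -> : latq x y (c, d) = g%:~R ^+ 2 * latq x y (c', d').
    by rewrite /latq /= cE dE !intrM; ring.
  rewrite ger_pMl ?latq_gt0// => g1.
  have : g%:~R <= 1 :> R by rewrite -(@expr_le1 _ 2)// ler0z.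
  by rewrite -[1]/(1%:~R) ler_int => g1'; lia.
have [u [v uv]] := Bezoutz c d.
have det : v * d - (- u) * c = 1.
  by rewrite mulNr opprK addrC uv; exact/eqP.
pose x1 := mobius_re v (- u) c d x y; pose y1 := mobius_im c d x y.
have y10 : 0 < y1 by rewrite invr_gt0.
pose n : int := Num.floor (x1 + 1 / 2).
have /andP[n1 n2] : n%:~R <= x1 + 1 / 2 < (n + 1)%:~R by exact: floor_itv.
have x2 : `|x1 - n%:~R| <= 1 / 2.
  move: n2; rewrite intrD ler_norml => n2; apply/andP; split; lra.
exists `|x1 - n%:~R|, y1; split => //; first by rewrite normr_ge0.
  have : y1^-1 <= latq x1 y1 (1, - n).
    rewrite invrK latq_mobius//; apply: cdmin => /=; rewrite !mulr1.
    apply/eqP => -[h1 h2].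
    have : (v * d - (- u) * c) * 1 = d * (v + c * - n) - c * (- u + d * - n) by ring.
    by rewrite det h1 h2 !mulr0 subrr.
  rewrite -[y1^-1]mul1r /latq /= ler_pM2r ?invr_gt0// mulr1z !mul1r mulrNz.
  by rewrite real_normK ?num_real.
move=> s; transitivity (ntheta s (x1 - n%:~R) y1).
  by case: ger0P => // _; exact: ntheta_opp.
rewrite -(@ntheta_mobius s x y v (- u) c d)// -/x1 -/y1.
rewrite /ntheta; congr (_ * _).
have be : bijective (fun p : int * int => (p.1, p.2 - n * p.1)).
  by exists (fun p : int * int => (p.1, p.2 + n * p.1)) => -[k j] /=; rewrite ?subrK ?addrK.
rewrite -[RHS](reindex_isum _ be); apply: eq_isum => p.
congr (expR (- (_ * _))); rewrite /latq /=; congr ((_ ^+ 2 + _) / _).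
by rewrite intrB intrM; ring.
Qed.

End Modular.

(** * Small parameters: the Fourier side *)

Section PairBounds.
Variable R : realType.
Implicit Types (v s a b : R).

(** Up to the factor [v], the first summand is [s d/ds] of the Fourier term
    [exp (- v (s a + b / s))] with [m^2 = a] and [k^2 = b]; the second one comes
    from exchanging [m] and [k]. The sum vanishes at [s = 1], and the
    bounds below compare it with the term [a = b = 1]. *)
Definition kpair v s a b : R :=
  (b / s - s * a) * expR (- (v * (s * a + b / s))) +
  (a / s - s * b) * expR (- (v * (s * b + a / s))).

Definition klead v s : R := (s - s^-1) * expR (- (v * (s + s^-1))).

Section OnePair.
Variables v s a b : R.
Hypotheses (v0 : 0 < v) (s1 : 1 <= s) (a1 : 1 <= a) (ab : a <= b).

Let s0 : 0 < s. Proof. exact: lt_le_trans ltr01 s1. Qed.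
Let ds : 0 <= s - s^-1. Proof. by rewrite subr_ge0 (le_trans _ s1)// invf_le1. Qed.
Let al := v * (s * (a - 1) + (b - 1) / s).
Let be := v * (s * (b - 1) + (a - 1) / s).

Let e1 : expR (- (v * (s * a + b / s))) = expR (- (v * (s + s^-1))) * expR (- al).
Proof. by rewrite -expRD; congr expR; rewrite /al; ring. Qed.

Let e2 : expR (- (v * (s * b + a / s))) = expR (- (v * (s + s^-1))) * expR (- be).
Proof. by rewrite -expRD; congr expR; rewrite /be; ring. Qed.

Let albe : be - al = v * (b - a) * (s - s^-1).
Proof. by rewrite /be /al; ring. Qed.

Let gap0 : 0 <= expR (- al) - expR (- be).
Proof.
rewrite subr_ge0 ler_expR lerN2 -subr_ge0 albe mulr_ge0// mulr_ge0 ?subr_ge0//.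
exact: ltW.
Qed.

Let gap : expR (- al) - expR (- be) <= v * (b - a) * (s - s^-1) * expR (- al).
Proof.
rewrite -albe; have -> : expR (- be) = expR (- (be - al)) * expR (- al).
  by rewrite -expRD; congr expR; ring.
rewrite -[X in X - _]mul1r -mulrBl ler_wpM2r ?expR_ge0//.
by have := expR_ge1Dx (- (be - al)); lra.
Qed.

Let kpairE : kpair v s a b = expR (- (v * (s + s^-1))) *
  ((b / s - s * a) * (expR (- al) - expR (- be)) - (s - s^-1) * (a + b) * expR (- be)).
Proof. by rewrite /kpair e1 e2; ring. Qed.

(** With [al] and [be] the exponents of the two terms relative to the leading
    one, the coefficient of the difference of exponentials is nonnegative
    here and only the damped term is left. *)
Lemma kpair_ge : s ^+ 2 * a <= b ->
  - kpair v s a b <= klead v s * ((a + b) * expR (- be)).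
Proof.
move=> sab; rewrite kpairE /klead -mulrN opprB mulrC [leRHS]mulrAC ler_wpM2r ?expR_ge0//.
rewrite mulrA lerBlDr lerDl mulr_ge0// subr_ge0.
by rewrite ler_pdivlMr// mulrAC -expr2.
Qed.

(** In general that difference is at most [be - al] times the larger one,
    which produces a factor [s - s^-1] as in [klead]. *)
Lemma norm_kpair_le : `|kpair v s a b| <= klead v s *
  ((a + b) * expR (- be) + `|b - s ^+ 2 * a| * (b - a) * (v / s) * expR (- al)).
Proof.
rewrite kpairE normrM ger0_norm ?expR_ge0// /klead mulrC [leRHS]mulrAC.
rewrite ler_wpM2r ?expR_ge0// (le_trans (ler_normB _ _))//.
rewrite [in X in _ + X]ger0_norm; last first.
  have a0 : 0 <= a := le_trans ler01 a1.
  have ab0 : 0 <= a + b by rewrite addr_ge0// (le_trans a0).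
  by rewrite (mulr_ge0 (mulr_ge0 ds ab0) (expR_ge0 _)).
rewrite [leRHS]mulrDr [leRHS]addrC [(s - _) * (_ * expR (- be))]mulrA lerD2r.
rewrite normrM [X in _ * X]ger0_norm//.
have -> : b / s - s * a = (b - s ^+ 2 * a) / s by field; rewrite gt_eqF.
rewrite normrM [X in _ * X * _]ger0_norm ?invr_ge0 ?(ltW s0)//.
have is0 : 0 <= s^-1 by rewrite invr_ge0 ltW.
have h := ler_wpM2l (mulr_ge0 (normr_ge0 (b - s ^+ 2 * a)) is0) gap.
apply: (le_trans h).
by rewrite le_eqVlt; apply/orP; left; apply/eqP; move: (`|_|) => n; ring.
Qed.

End OnePair.

(** ** Numerical sizes of the pair bounds *)

Lemma pow2_sqr_le_exp (m : nat) : (0 < m)%N ->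
  m%:R ^+ 2 * 2 ^+ m <= 2 * expR (m%:R ^+ 2 - 1) :> R.
Proof.
case: m => // m _; rewrite (exprS 2 m) mulrCA ler_pM2l//.
have m0 : 0 <= m%:R :> R by [].
have h1 : m.+1%:R <= expR m%:R :> R by rewrite -natr1 addrC; exact: expR_ge1Dx.
have h2 : 2 ^+ m <= expR m%:R :> R.
  rewrite -[m%:R]mulr1 expRM_natl; apply: lerXn2r; rewrite ?nnegrE ?expR_ge0//.
  by have := expR1_gt27 R; lra.
have -> : m.+1%:R ^+ 2 - 1 = m%:R * (m%:R + 2) :> R by rewrite -natr1; ring.
have [->|mn0] := eqVneq m 0%N; first by rewrite mul0r expR0 expr0 expr1n mulr1.
have m1 : 1 <= m%:R :> R by rewrite ler1n lt0n.
apply: (@le_trans _ _ (expR m%:R * expR m%:R * expR m%:R)).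
  by rewrite expr2 !ler_pM ?mulr_ge0 ?exprn_ge0.
rewrite -!expRD ler_expR; nra.
Qed.

Lemma sqr_le_exp (k : nat) : (4 <= k)%N -> k%:R ^+ 2 <= expR (k%:R - 1) :> R.
Proof.
elim: k => // k IH; rewrite leq_eqVlt => /predU1P[<-|k4].
  have -> : 4 - 1 = 3%:R * 1 :> R by ring.
  rewrite expRM_natl; have h := expR1_gt27 R.
  apply: (@le_trans _ _ ((27 / 10) ^+ 3)); first by lra.
  by apply: lerXn2r; rewrite ?nnegrE ?expR_ge0//; lra.
have -> : k.+1%:R - 1 = (k%:R - 1) + 1 :> R by rewrite -natr1; ring.
rewrite expRD -natr1; have k4' : 4 <= k%:R :> R by rewrite ler_nat.
have h := expR1_gt27 R.
apply: (@le_trans _ _ (k%:R ^+ 2 * expR 1)); last by rewrite ler_wpM2r ?expR_ge0 ?IH.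
nra.
Qed.

(** [u <= expR (u - 1)] absorbs a linear factor. *)
Lemma le_expR_mul (u c : R) : u * expR (- (u * c)) <= expR (- (u * (c - 1) + 1)).
Proof.
have -> : - (u * (c - 1) + 1) = (u - 1) + - (u * c) by ring.
rewrite expRD ler_wpM2r ?expR_ge0//.
by apply: le_trans (expR_ge1Dx _); lra.
Qed.

End PairBounds.

(** The weights [2 ^- (m + k)] are summable with a small sum, and the factor
    [m^2 k^2] is the one of [cos_half_diff]. The bounds hold
    for [v = pi y] as soon as [y >= 7/10]. *)
Section PairWeights.
Variable R : realType.

Variables (m k : nat) (v s : R).
Hypotheses (m0 : (0 < m)%N) (mk : (m <= k)%N) (k2 : (2 <= k)%N).
Hypotheses (v2 : 217 / 100 <= v) (s1 : 1 <= s) (s2 : s <= 2).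
Let a : R := m%:R ^+ 2.
Let b : R := k%:R ^+ 2.
Let w : R := (2 ^+ (m + k))^-1.

Let s0 : 0 < s. Proof. exact: lt_le_trans ltr01 s1. Qed.
Let v0 : 0 < v. Proof. by apply: lt_le_trans v2; lra. Qed.
Let m1 : 1 <= m%:R :> R. Proof. by rewrite ler1n. Qed.
Let mkR : m%:R <= k%:R :> R. Proof. by rewrite ler_nat. Qed.
Let k2R : 2 <= k%:R :> R. Proof. by rewrite ler_nat. Qed.
Let a1 : 1 <= a. Proof. by rewrite exprn_ege1. Qed.
Let ab : a <= b. Proof. by rewrite lerXn2r ?nnegrE ?ler0n. Qed.
Let b4 : 4 <= b. Proof. by rewrite /b; move: k2R; nra. Qed.
Let w0 : 0 < w. Proof. by rewrite invr_gt0 exprn_gt0. Qed.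

Let vs2 : 2 <= v * s. Proof. by move: v2 s1; nra. Qed.
Let vs1 : 1085 / 1000 <= v / s.
Proof.
by rewrite ler_pdivlMr//; move: v2 s2 s1; nra.
Qed.

Let weight1 (j : nat) (c : R) : (0 < j)%N -> c = j%:R ^+ 2 ->
  c * expR (- (c - 1)) <= 2 / 2 ^+ j.
Proof.
move=> j0 ->; rewrite expRN ler_pdivrMr ?expR_gt0// mulrAC ler_pdivlMr ?exprn_gt0//.
exact: pow2_sqr_le_exp.
Qed.

Let wE : w = (2 ^+ m)^-1 * (2 ^+ k)^-1. Proof. by rewrite /w exprD invfM. Qed.

Let be := v * (s * (b - 1) + (a - 1) / s).
Let al := v * (s * (a - 1) + (b - 1) / s).

Let T1_le (d : R) : b * expR (- (b - 1)) <= d ->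
  a * b * ((a + b) * expR (- be)) <= 8 * d * w.
Proof.
move=> bd; have Ea := weight1 m0 (erefl a).
have Eb := weight1 (leq_trans m0 mk) (erefl b).
have h : expR (- be) <= expR (- (a - 1)) * (expR (- (b - 1)) * expR (- (b - 1))).
  rewrite -!expRD ler_expR /be.
  have -> : v * (s * (b - 1) + (a - 1) / s) = (v * s) * (b - 1) + (v / s) * (a - 1) by ring.
  move: vs2 vs1 a1 b4; move: (v * s) (v / s) => p q *; nra.
have b0 : 0 <= b by apply: le_trans b4.
have a0 : 0 <= a by apply: le_trans a1.
have d0 : 0 <= d by apply: le_trans bd; rewrite mulr_ge0 ?expR_ge0.
apply: (@le_trans _ _ (2 * (a * expR (- (a - 1))) * ((b * expR (- (b - 1))) * (b * expR (- (b - 1)))))).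
  have -> : 2 * (a * expR (- (a - 1))) * ((b * expR (- (b - 1))) * (b * expR (- (b - 1))))
    = (a * b * (2 * b)) * (expR (- (a - 1)) * (expR (- (b - 1)) * expR (- (b - 1)))) by ring.
  rewrite mulrA; apply: ler_pM => //; rewrite ?expR_ge0 ?mulr_ge0 ?addr_ge0//.
  by rewrite ler_wpM2l ?mulr_ge0//; move: ab; lra.
rewrite wE (_ : 8 * d * _ = 2 * (2 / 2 ^+ m) * (2 / 2 ^+ k * d)); last by ring.
by apply: ler_pM; rewrite ?ler_pM2l// ?mulr_ge0 ?expR_ge0// ler_pM ?mulr_ge0 ?expR_ge0.
Qed.

Let b_exp_small : (3 <= k)%N -> b * expR (- (b - 1)) <= 1 / 30.
Proof.
move=> k3; have b9 : 9 <= b.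
  have : 3 <= k%:R :> R by rewrite ler_nat.
  by rewrite /b; nra.
rewrite expRN ler_pdivrMr ?expR_gt0//.
have -> : expR (b - 1) = expR ((b - 1) / 2) * expR ((b - 1) / 2).
  by rewrite -expRD; congr expR; lra.
set x := (b - 1) / 2; have x4 : 4 <= x by rewrite /x; move: b9; lra.
have h1 : 53 <= expR x.
  apply: (@le_trans _ _ (expR (4%:R * 1))); last by rewrite mulr1 ler_expR.
  rewrite expRM_natl; have h := expR1_gt27 R.
  apply: (@le_trans _ _ ((27 / 10) ^+ 4)); first by lra.
  by apply: lerXn2r; rewrite ?nnegrE ?expR_ge0//; lra.
have h2 : 1 + x + x ^+ 2 / 2 <= expR x by apply: expR_ge_quad; lra.
have -> : b = 2 * x + 1 by rewrite /x; lra.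
have : 53 * (1 + x + x ^+ 2 / 2) <= expR x * expR x.
  by apply: ler_pM => //; nra.
by nra.
Qed.

Let T2_le : (3 <= k)%N ->
  a * b * (`|b - s ^+ 2 * a| * (b - a) * (v / s) * expR (- al)) <= 12 / 5 * w.
Proof.
move=> k3; set u := v / s.
have b9 : 9 <= b.
  have : 3 <= k%:R :> R by rewrite ler_nat.
  by rewrite /b; nra.
have b0 : 0 <= b by apply: le_trans b4.
have a0 : 0 <= a by apply: le_trans a1.
have u0 : 0 <= u by rewrite divr_ge0 ?(ltW v0) ?(ltW s0).
have N : `|b - s ^+ 2 * a| * (b - a) <= a * (b - 1) ^+ 2.
  have [E|mnk] := eqVneq m k.
    have -> : b - a = 0 by rewrite /a E subrr.
    by rewrite mulr0 mulr_ge0 ?sqr_ge0.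
  have ab3 : a + 3 <= b.
    have : m%:R + 1 <= k%:R :> R by rewrite natr1 ler_nat ltn_neqAle mnk.
    rewrite /a /b; move: m1; nra.
  have ss4 : 1 <= s ^+ 2 <= 4 by move: s1 s2 => *; apply/andP; split; nra.
  case/andP: ss4 => ss1 ss4.
  apply: (@le_trans _ _ ((b + 2 * a - 3) * (b - a))).
    rewrite ler_wpM2r ?subr_ge0// ler_norml; apply/andP; split.
      move: ss4 ab3 a1; move: (s ^+ 2) => t *; nra.
    move: ss1 ab3 a1; move: (s ^+ 2) => t *; nra.
  move: a1 b9 ab3; move: a b => x y *.
  have : 0 <= (x - 1) * (y - 3) by rewrite mulr_ge0 ?subr_ge0//; lra.
  nra.
have X : expR (- al) <= expR (- (u * (b - 1))) * (expR (- (a - 1)) * expR (- (a - 1))).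
  rewrite -!expRD ler_expR /al.
  have -> : v * (s * (a - 1) + (b - 1) / s) = (v * s) * (a - 1) + u * (b - 1) by rewrite /u; ring.
  move: vs2 a1; move: (v * s) => p *; nra.
have Ea := weight1 m0 (erefl a).
have Ea1 : a * expR (- (a - 1)) <= 1.
  rewrite expRN ler_pdivrMr ?expR_gt0// mul1r.
  by apply: le_trans (expR_ge1Dx _); lra.
suff Y : b * (b - 1) ^+ 2 * (u * expR (- (u * (b - 1)))) <= 6 / 5 / 2 ^+ k.
  apply: (@le_trans _ _ ((b * (b - 1) ^+ 2 * (u * expR (- (u * (b - 1))))) *
     ((a * expR (- (a - 1))) * (a * expR (- (a - 1)))))).
    have -> : (b * (b - 1) ^+ 2 * (u * expR (- (u * (b - 1))))) *
     ((a * expR (- (a - 1))) * (a * expR (- (a - 1)))) =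
     a * b * ((a * (b - 1) ^+ 2) * u *
       (expR (- (u * (b - 1))) * (expR (- (a - 1)) * expR (- (a - 1))))) by ring.
    rewrite ler_wpM2l ?mulr_ge0//; apply: ler_pM => //; rewrite ?expR_ge0//.
      by apply: mulr_ge0 => //; apply: mulr_ge0; rewrite ?subr_ge0.
    by rewrite ler_wpM2r.
  rewrite wE (_ : 12 / 5 * _ = (6 / 5 / 2 ^+ k) * (2 / 2 ^+ m * 1)); last by ring.
  have ae0 : 0 <= a * expR (- (a - 1)) by rewrite mulr_ge0 ?expR_ge0.
  apply: ler_pM => //; last by apply: ler_pM.
    apply: mulr_ge0; first by apply: mulr_ge0 => //; exact: sqr_ge0.
    by apply: mulr_ge0 => //; exact: expR_ge0.
  exact: mulr_ge0.
have Z := le_expR_mul u (b - 1).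
have bb : 0 <= b * (b - 1) ^+ 2 by rewrite mulr_ge0 ?sqr_ge0.
apply: (le_trans (ler_wpM2l bb Z)).
rewrite ler_pdivlMr ?exprn_gt0//.
move: k3; rewrite leq_eqVlt => /predU1P[k3|k4].
  have bE : b = 9 by rewrite /b -k3; ring.
  rewrite -k3 bE.
  have E : expR (- (u * (9 - 1 - 1) + 1)) <= (10 / 27) ^+ 8 * (8 / 13).
    apply: (@le_trans _ _ (expR (- (8%:R)) * expR (- (1 / 2)))).
      by rewrite -expRD ler_expR; move: vs1; rewrite -/u; lra.
    apply: ler_pM; rewrite ?expR_ge0//; first exact: expRN_le.
    rewrite expRN invf_ple ?posrE ?expR_gt0// invf_div.
    apply: (@le_trans _ _ (1 + 1 / 2 + (1 / 2) ^+ 2 / 2)); first by lra.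
    by apply: expR_ge_quad; lra.
  by move: E; set e := expR _ => E; lra.
have kb := @sqr_le_exp R k k4.
have k4R : 4 <= k%:R :> R by rewrite ler_nat.
have bk : b - 1 = (k%:R - 1) * (k%:R + 1) by rewrite /b; ring.
have p2 : 2 ^+ k <= 2 * expR (k%:R - 1) :> R.
  have kp : k = k.-1.+1 by rewrite prednK// (leq_trans m0).
  have -> : k%:R - 1 = k.-1%:R * 1 :> R by rewrite {1}kp -natr1; ring.
  rewrite {1}kp exprS ler_pM2l// expRM_natl.
  by apply: lerXn2r; rewrite ?nnegrE ?expR_ge0//; have := expR1_gt27 R; lra.
set e := expR (k%:R - 1) in kb p2 *; have e0 : 0 < e := expR_gt0 _.
have Eb : expR (- (u * (b - 1 - 1) + 1)) <= (e ^+ 5)^-1.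
  rewrite -expRM_natl -expRN ler_expR lerN2.
  apply: (@le_trans _ _ (b - 1)); first by rewrite bk; nra.
  by move: vs1; rewrite -/u => *; nra.
have e3 : 19 <= e.
  apply: (@le_trans _ _ (expR (3%:R * 1))); last by rewrite mulr1 ler_expR; lra.
  rewrite expRM_natl; have h := expR1_gt27 R.
  apply: (@le_trans _ _ ((27 / 10) ^+ 3)); first by lra.
  by apply: lerXn2r; rewrite ?nnegrE ?expR_ge0//; lra.
have b3 : b * (b - 1) ^+ 2 <= e ^+ 3.
  have be1 : b <= e by [].
  rewrite (exprS e 2); apply: ler_pM => //; first exact: sqr_ge0.
  by apply: lerXn2r; rewrite ?nnegrE ?subr_ge0 ?(ltW e0)//; move: be1 b4; lra.
apply: (@le_trans _ _ (e ^+ 3 * (e ^+ 5)^-1 * (2 * e))).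
  apply: ler_pM => //; first by rewrite mulr_ge0 ?expR_ge0.
  by apply: ler_pM => //; exact: expR_ge0.
have -> : e ^+ 3 * (e ^+ 5)^-1 * (2 * e) = 2 / e by field; rewrite gt_eqF.
by rewrite ler_pdivrMr//; lra.
Qed.

Let lead0 : 0 <= klead v s.
Proof. by rewrite mulr_ge0 ?expR_ge0// subr_ge0 (le_trans _ s1)// invf_le1. Qed.

Lemma norm_kpair_weight : (3 <= k)%N ->
  a * b * `|kpair v s a b| <= klead v s * (8 / 3 * w).
Proof.
move=> k3; have h := norm_kpair_le v0 s1 a1 ab.
have ab0 : 0 <= a * b by rewrite mulr_ge0 ?exprn_ge0.
apply: (le_trans (ler_wpM2l ab0 h)); rewrite mulrCA ler_wpM2l// mulrDr.
have := T1_le (b_exp_small k3); have := T2_le k3; rewrite -/al -/be.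
by move: w0; set x := _ * _; set y := a * b * _; lra.
Qed.

Lemma kpair_ge_weight : a * b * - kpair v s a b <= klead v s * (8 / 3 * w).
Proof.
have ab0 : 0 <= a * b by rewrite mulr_ge0 ?exprn_ge0.
have [k3|] := ltnP 2 k.
  apply: le_trans (norm_kpair_weight k3); rewrite ler_wpM2l//.
  by rewrite -normrN ler_norm.
move=> k2'; have kE : k = 2%N by apply/eqP; rewrite eqn_leq k2'.
have bE : b = 4 by rewrite /b kE; ring.
have bd : b * expR (- (b - 1)) <= 1 / 3.
  have : expR (- (3%:R)) <= (10 / 27) ^+ 3 :> R by exact: expRN_le.
  by rewrite bE (_ : 4 - 1 = 3%:R); [lra|ring].
have T := T1_le bd.
suff h : - kpair v s a b <= klead v s * ((a + b) * expR (- be)).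
  apply: (le_trans (ler_wpM2l ab0 h)); rewrite mulrCA ler_wpM2l//.
  by rewrite (_ : 8 / 3 * w = 8 * (1 / 3) * w)//; ring.
have [mE|mE] := eqVneq m k.
  have h := norm_kpair_le v0 s1 a1 ab.
  have ba : b - a = 0 by rewrite /a mE subrr.
  rewrite ba mulr0 !mul0r addr0 in h.
  by apply: le_trans h; rewrite -normrN ler_norm.
apply: kpair_ge => //.
have -> : a = 1.
  have m2 : (m < 2)%N by rewrite -kE ltn_neqAle mE.
  have mE1 : m = 1%N by apply/eqP; rewrite eqn_leq m0 andbT -ltnS.
  by rewrite /a mE1 expr1n.
rewrite bE mulr1; move: s1 s2; nra.
Qed.

End PairWeights.

(** ** Weights and increments of pairs *)

Section Weights.
Variable R : realType.

Lemma isum_geometric_le (r : R) : 0 <= r < 1 -> isum (fun n : nat => r ^+ n) <= (1 - r)^-1.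
Proof.
move=> r01; have /andP[r0 r1] := r01; have ag := asum_geometric r01.
rewrite isum_ge0E//; last by move=> n; exact: exprn_ge0.
rewrite -lee_fin -esum_fin//; last by move=> n; exact: exprn_ge0.
rewrite -nneseries_esumT; last by move=> n; rewrite lee_fin exprn_ge0.
apply: lime_le; first by apply: is_cvg_nneseries => n _ _; rewrite lee_fin exprn_ge0.
apply: nearW => n; rewrite sumEFin lee_fin big_mkord.
have r1' : 0 < 1 - r by rewrite subr_gt0.
rewrite -(ler_pM2l r1') divff ?gt_eqF//.
have -> : (1 - r) * \sum_(i < n) r ^+ i = 1 - r ^+ n.
  by rewrite -(opprB r 1) mulNr -subrX1 opprB.
by rewrite gerBl exprn_ge0.
Qed.

Lemma isum_int (f : int -> R) : asum f ->
  isum f = isum (fun n : nat => f (Posz n)) + isum (fun n : nat => f (Negz n)).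
Proof.
pose e (j : int) : bool * nat := if j is Negz n then (false, n) else (true, absz j).
pose e' (k : bool * nat) : int := if k.1 then Posz k.2 else Negz k.2.
have be : bijective e' by exists e => [[[] n]|[]].
move=> af; rewrite -(reindex_isum _ be) -isum_pair; last exact: reindex_asum.
by rewrite isum_finType big_bool.
Qed.

(** Weights on pairs of nonzero integers, geometric except for a negative mass
    on [|m| = |k| = 1] that makes the total at most [0]. *)
Definition geow (j : int) : R := if j == 0 then 0 else (1 / 2) ^+ absz j.
Definition unitw (j : int) : R := if absz j == 1%N then 1 else 0.
Definition pairw (p : int * int) : R := geow p.1 * geow p.2 - unitw p.1 * unitw p.2.

Let half01 : 0 <= (1 / 2 : R) < 1. Proof. by apply/andP; split; lra. Qed.

Lemma geow_ge0 j : 0 <= geow j.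
Proof. by rewrite /geow; case: ifP => // _; rewrite exprn_ge0. Qed.

Lemma asum_geow : asum geow.
Proof.
apply: asum_le (asum_geometric_int half01) => j; rewrite ger0_norm ?geow_ge0//.
by rewrite /geow; case: ifP => // _; rewrite exprn_ge0.
Qed.

Lemma isum_geow : isum geow <= 2.
Proof.
have ag := asum_geometric half01.
have S : isum (fun n : nat => (1 / 2) ^+ n.+1) <= 1 :> R.
  under eq_isum do rewrite exprS.
  rewrite isumZ//; have := isum_geometric_le half01.
  by rewrite (_ : (1 - 1 / 2)^-1 = 2 :> R); [lra|field].
rewrite isum_int; last exact: asum_geow.
have -> : isum (fun n : nat => geow (Posz n)) = isum (fun n : nat => (1 / 2) ^+ n.+1).
  rewrite (@isum_inj R nat nat succn)//; first exact: succn_inj.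
  by move=> [//|n] /(_ n).
have -> : isum (fun n : nat => geow (Negz n)) = isum (fun n : nat => (1 / 2) ^+ n.+1) by [].
by move: S; lra.
Qed.

Let unit_supp j : j \notin [fset 1; -1]%fset -> unitw j = 0.
Proof.
rewrite !inE negb_or /unitw => /andP[/eqP j1 /eqP j2].
by case: eqP => // jj; exfalso; lia.
Qed.

Lemma asum_unitw : asum unitw.
Proof. exact: asum_fsupp unit_supp. Qed.

Lemma isum_unitw : isum unitw = 2.
Proof.
rewrite (isum_fsupp unit_supp) big_fsetU1 ?inE//= big_seq_fset1 /unitw /=; lra.
Qed.

Lemma asum_pairw : asum pairw.
Proof.
by apply: asumB; apply: asum_mul; [exact: asum_geow..|exact: asum_unitw|exact: asum_unitw].
Qed.

Lemma isum_pairw : isum pairw <= 0.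
Proof.
have ag := asum_geow; have au := asum_unitw.
rewrite isumB; try exact: asum_mul.
rewrite (isum_mul ag ag) (isum_mul au au) isum_unitw subr_le0.
by apply: ler_pM; rewrite ?isum_geow// isum_ge0// => j; exact: geow_ge0.
Qed.

End Weights.

Section CosineDifference.
Variable R : realType.
Implicit Types (x : R) (n : nat).

Lemma norm_sin_mulrn n x : `|sin (n%:R * x)| <= n%:R * `|sin x|.
Proof.
elim: n => [|n IH]; first by rewrite !mul0r sin0 normr0.
rewrite -natr1 !mulrDl !mul1r sinD; apply: (le_trans (ler_normD _ _)).
rewrite !normrM lerD//.
  by apply: le_trans IH; rewrite ler_piMr// cos_max.
by rewrite ler_piMl// cos_max.
Qed.

Lemma cos_pi_mulrn n : cos (pi * n%:R : R) = (-1) ^+ n.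
Proof.
elim: n => [|n IH]; first by rewrite mulr0 cos0.
by rewrite -natr1 mulrDr mulr1 cosDpi IH exprS mulN1r.
Qed.

Lemma sin_pi_mulrn n : sin (pi * n%:R : R) = 0.
Proof.
elim: n => [|n IH]; first by rewrite mulr0 sin0.
by rewrite -natr1 mulrDr mulr1 sinDpi IH oppr0.
Qed.

(** With [th = pi (x - 1/2)] the difference is [- (-1) ^ n] times
    [2 sin^2 (n th)], and [|sin (n th)| <= n |sin th|]. *)
Lemma cos_half_diff n x : exists2 d : R,
  0 <= d <= n%:R ^+ 2 * (1 + cos (2 * pi * x)) &
  cos (2 * pi * n%:R * x) - cos (2 * pi * n%:R * (1 / 2)) = - (-1) ^+ n * d.
Proof.
set th := pi * x - pi / 2.
have c2 (t : R) : cos (2 * t) = 1 - 2 * sin t ^+ 2.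
  by rewrite mulr_natl cos_mulr2n cos2sin2 -mulr_natl; ring.
exists (2 * sin (n%:R * th) ^+ 2).
  rewrite mulr_ge0 ?sqr_ge0//=.
  have -> : 1 + cos (2 * pi * x) = 2 * sin th ^+ 2.
    have -> : 2 * pi * x = 2 * th + pi by rewrite /th; field.
    by rewrite cosDpi c2; ring.
  rewrite [leRHS]mulrCA ler_pM2l// -exprMn -[leLHS]real_normK ?num_real//.
  rewrite -[leRHS]real_normK ?num_real//; apply: lerXn2r; rewrite ?nnegrE//.
  by rewrite normrM normr_nat norm_sin_mulrn.
have -> : 2 * pi * n%:R * x = 2 * (n%:R * th) + pi * n%:R by rewrite /th; field.
have -> : 2 * pi * n%:R * (1 / 2) = pi * n%:R :> R by field.
by rewrite cosD sin_pi_mulrn cos_pi_mulrn c2; ring.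
Qed.

Lemma cos_intr (m k : int) x :
  cos (2 * pi * (m * k)%:~R * x) = cos (2 * pi * (absz m * absz k)%:R * x).
Proof.
rewrite -abszM natr_absz intr_norm; case: (ger0P ((m * k)%:~R : R)) => // _.
by rewrite mulrN mulNr cosN.
Qed.

End CosineDifference.

Section PairIncrements.
Variable R : realType.
Implicit Types (y s : R).

(** The Fourier terms at [(m, k)] and [(k, m)] together, and a term with
    [|m| = |k| = 1]. *)
Definition epair y s (a b : R) : R :=
  expR (- (pi * y * (s * a + b / s))) + expR (- (pi * y * (s * b + a / s))).

Definition elead y s : R := expR (- (pi * y * (s + s^-1))).

Lemma epairC y s a b : epair y s a b = epair y s b a.
Proof. exact: addrC. Qed.

Lemma der_epair y s a b : 0 < s ->
  der (fun t => epair y t a b) s (pi * y / s * kpair (pi * y) s a b).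
Proof.
move=> s0; rewrite /epair; derive_tac; first by rewrite gt_eqF.
  by rewrite gt_eqF.
rewrite /kpair; move: (pi : R) (expR _) (expR _) => q e1 e2.
by field; rewrite gt_eqF.
Qed.

Lemma der_elead y s : 0 < s ->
  der (elead y) s (- (pi * y / s * klead (pi * y) s)).
Proof.
move=> s0; rewrite /elead; derive_tac; first by rewrite gt_eqF.
rewrite /klead; move: (pi : R) (expR _) => q e1.
by field; rewrite gt_eqF.
Qed.

Lemma epair_incr y s s' a b c d : 0 < y -> 0 < s -> s <= s' ->
  (forall t, s <= t <= s' -> d * kpair (pi * y) t a b <= klead (pi * y) t * c) ->
  d * (epair y s' a b - epair y s a b) <= c * (elead y s - elead y s').
Proof.
move=> y0 s0 ss h.
have pos t : s <= t <= s' -> 0 < t by case/andP => st _; exact: lt_le_trans st.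
pose f t := d * epair y t a b; pose g t := - c * elead y t.
have : f s' - f s <= g s' - g s.
  apply: (@deriv_le_incr R f g
    (fun t => d * (pi * y / t * kpair (pi * y) t a b))
    (fun t => - c * - (pi * y / t * klead (pi * y) t)) s s' ss) => t tI;
    have t0 := pos t tI.
  - apply: (deriv_eq (deriv_mul (deriv_cst _ _) (der_epair y a b t0))).
    by rewrite mul0r add0r.
  - apply: (deriv_eq (deriv_mul (deriv_cst _ _) (der_elead y t0))).
    by rewrite mul0r add0r.
  - have p0 : 0 <= pi * y / t.
      by rewrite divr_ge0 ?(ltW t0)// mulr_ge0 ?pi_ge0// ltW.
    rewrite mulrCA mulrNN [leRHS]mulrCA [c * _]mulrC; apply: ler_wpM2l => //; exact: h.
by rewrite /f /g mulrBr; lra.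
Qed.

End PairIncrements.

(** ** The real part: [x = 1/2] is optimal *)

Section RealPart.
Variable R : realType.
Implicit Types (x y s : R) (p : int * int).

Definition swap_pair p : int * int := (p.2, p.1).

Lemma swap_pair_bij : bijective swap_pair.
Proof. by exists swap_pair => -[m n]. Qed.

Lemma sqr_absz (m : int) : m%:~R ^+ 2 = (absz m)%:R ^+ 2 :> R.
Proof. by rewrite -[LHS]real_normK ?num_real// -intr_norm -natr_absz. Qed.

Lemma pgauss_pair s y p :
  pgauss s y p + pgauss s y (swap_pair p) =
  epair y s ((absz p.1)%:R ^+ 2) ((absz p.2)%:R ^+ 2).
Proof. by rewrite /pgauss /epair /= -!sqr_absz. Qed.

Lemma elead_incr_ge0 y s s' : 0 < y -> 1 <= s -> s <= s' -> 0 <= elead y s - elead y s'.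
Proof.
move=> y0 s1 ss; rewrite subr_ge0 ler_expR lerN2 ler_pM2l ?mulr_gt0 ?pi_gt0//.
have s0 : 0 < s by exact: lt_le_trans s1.
have s'0 : 0 < s' by exact: lt_le_trans ss.
rewrite -subr_ge0.
have -> : s' + s'^-1 - (s + s^-1) = (s' - s) * (s * s' - 1) / (s * s').
  by field; rewrite !gt_eqF.
rewrite divr_ge0 ?mulr_ge0 ?subr_ge0 ?(ltW s0) ?(ltW s'0)//.
by rewrite -[1]mulr1 ler_pM// (le_trans s1).
Qed.

Section PairTerm.
Variables (y s s' : R).
Hypotheses (y7 : 7 / 10 <= y) (s1 : 1 <= s) (ss : s <= s') (s2 : s' <= 2).

Let v2 : 217 / 100 <= pi * y.
Proof.
have h := pi_gt31 R; apply: (@le_trans _ _ (31 / 10 * (7 / 10))); first by lra.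
by apply: ler_pM => //; exact: ltW.
Qed.

Let y0 : 0 < y. Proof. by apply: lt_le_trans y7; rewrite divr_gt0. Qed.
Let s0 : 0 < s. Proof. by exact: lt_le_trans s1. Qed.

Let inI t : s <= t <= s' -> 1 <= t /\ t <= 2.
Proof. by case/andP => h1 h2; split; [exact: le_trans h1|exact: le_trans s2]. Qed.

Let D (m k : nat) : R :=
  epair y s' (m%:R ^+ 2) (k%:R ^+ 2) - epair y s (m%:R ^+ 2) (k%:R ^+ 2).
Let del : R := elead y s - elead y s'.

Let half_pow (n : nat) : (2 ^+ n)^-1 = (1 / 2) ^+ n :> R.
Proof. by rewrite div1r exprVn. Qed.

Lemma epair_incr_ge (m k : nat) : (0 < m)%N -> (0 < k)%N -> (2 <= m * k)%N ->
  m%:R ^+ 2 * k%:R ^+ 2 * - D m k <= 8 / 3 * (1 / 2) ^+ (m + k) * del.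
Proof.
wlog mk : m k / (m <= k)%N => [H m0 k0 mk2|m0 k0 mk2].
  have [mk|/ltnW km] := leqP m k; first exact: H.
  have := H k m km k0 m0; rewrite mulnC => /(_ mk2).
  by rewrite /D epairC [epair y s _ _]epairC [k%:R ^+ 2 * _]mulrC addnC.
have k2 : (2 <= k)%N.
  by rewrite ltnNge; apply/negP => k1; have := leq_mul (leq_trans mk k1) k1; rewrite leqNgt mk2.
have := @epair_incr R y s s' (m%:R ^+ 2) (k%:R ^+ 2) (8 / 3 * (2 ^+ (m + k))^-1)
  (- (m%:R ^+ 2 * k%:R ^+ 2)) y0 s0 ss.
rewrite half_pow mulNr -mulrN => h; apply: h => t /inI[t1 t2].
by rewrite mulNr -mulrN -half_pow; exact: kpair_ge_weight.
Qed.

Lemma epair_incr_le (m k : nat) : odd (m * k) -> (2 <= m * k)%N ->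
  m%:R ^+ 2 * k%:R ^+ 2 * D m k <= 8 / 3 * (1 / 2) ^+ (m + k) * del.
Proof.
wlog mk : m k / (m <= k)%N => [H mko mk2|mko mk2].
  have [mk|/ltnW km] := leqP m k; first exact: H.
  have := H k m km; rewrite mulnC => /(_ mko mk2).
  by rewrite /D epairC [epair y s _ _]epairC [k%:R ^+ 2 * _]mulrC addnC.
move: (mko); rewrite oddM => /andP[om ok].
have m0 : (0 < m)%N by case: m om {mk mko mk2}.
have k2 : (2 <= k)%N.
  by rewrite ltnNge; apply/negP => k1; have := leq_mul (leq_trans mk k1) k1; rewrite leqNgt mk2.
have k3 : (3 <= k)%N by case: k ok k2 {mk mko mk2} => [|[|[|]]].
have := @epair_incr R y s s' (m%:R ^+ 2) (k%:R ^+ 2) (8 / 3 * (2 ^+ (m + k))^-1)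
  (m%:R ^+ 2 * k%:R ^+ 2) y0 s0 ss.
rewrite half_pow => h; apply: h => t /inI[t1 t2].
rewrite -half_pow; apply: le_trans (norm_kpair_weight m0 mk k2 v2 t1 t2 k3).
by rewrite ler_wpM2l ?mulr_ge0 ?exprn_ge0// ler_norm.
Qed.

Let dpg p := pgauss s' y p - pgauss s y p.

Let dpg_pair p : dpg p + dpg (swap_pair p) = D (absz p.1) (absz p.2).
Proof. by rewrite /dpg /D -!pgauss_pair; ring. Qed.

(** An equality for [|m| = |k| = 1]. The other pairs are bounded on the side
    given by the parity of [m k], which is the sign in [cos_half_diff]. *)
Lemma pair_term_le x p :
  (dpg p + dpg (swap_pair p)) * (cos (2 * pi * (p.1 * p.2)%:~R * x) -
     cos (2 * pi * (p.1 * p.2)%:~R * (1 / 2))) <=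
  8 / 3 * (1 + cos (2 * pi * x)) * del * pairw R p.
Proof.
have del0 : 0 <= del by exact: elead_incr_ge0.
have C0 : 0 <= 1 + cos (2 * pi * x) by rewrite -lerBlDl sub0r cos_geN1.
rewrite (cos_intr p.1 p.2 x) (cos_intr p.1 p.2 (1 / 2)) dpg_pair.
have gE (j : int) : (0 < absz j)%N -> geow R j = (1 / 2) ^+ absz j.
  by rewrite /geow absz_gt0 => /negbTE ->.
have [pu|pn1] := eqVneq (absz p.1 * absz p.2)%N 1%N.
  have [m1 k1] : absz p.1 = 1%N /\ absz p.2 = 1%N.
    by move/eqP: pu; rewrite muln_eq1 => /andP[/eqP -> /eqP ->].
  have e1 z : 2 * pi * 1%:R * z = 2 * pi * z :> R by rewrite mulr1.
  rewrite pu !e1 /pairw /unitw !gE ?m1 ?k1// eqxx.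
  have -> : D 1 1 = - 2 * del.
    by rewrite /D /del /epair /elead !expr1n !mulr1 !div1r; ring.
  have -> : cos (2 * pi * (1 / 2)) = -1 :> R.
    by rewrite -[RHS](@cospi R); congr cos; field.
  by rewrite le_eqVlt; apply/orP; left; apply/eqP; field.
have [d /andP[d0 dle] ->] := cos_half_diff (absz p.1 * absz p.2) x.
set C := 1 + cos _ in C0 dle *.
have [pz|] := eqVneq (absz p.1 * absz p.2)%N 0%N.
  have -> : d = 0 by apply/eqP; rewrite eq_le d0 andbT (le_trans dle)// pz expr0n mul0r.
  have -> : pairw R p = 0.
    move/eqP: pz; rewrite muln_eq0 !absz_eq0 /pairw /geow /unitw.
    by case/orP => /eqP ->; rewrite ?mul0r ?mulr0 subr0.
  by rewrite !mulr0.
rewrite -lt0n => mk0; have mk2 : (2 <= absz p.1 * absz p.2)%N by rewrite ltn_neqAle eq_sym pn1.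
have /andP[m0 k0] : (0 < absz p.1)%N && (0 < absz p.2)%N by rewrite -muln_gt0.
have pw : pairw R p = (1 / 2) ^+ (absz p.1 + absz p.2).
  rewrite /pairw !gE// exprD /unitw; case: eqP => [m1|_]; last by rewrite mul0r subr0.
  case: eqP => [k1|_]; last by rewrite mulr0 subr0.
  by move: pn1; rewrite m1 k1.
have W0 : 0 <= 8 / 3 * pairw R p * del.
  by rewrite pw !mulr_ge0 ?exprn_ge0.
rewrite (_ : 8 / 3 * C * del * _ = (8 / 3 * pairw R p * del) * C); last by ring.
set n2 : R := (absz p.1)%:R ^+ 2 * (absz p.2)%:R ^+ 2.
have n20 : 0 < n2 by rewrite mulr_gt0// exprn_gt0// ltr0n.
have dn : d <= n2 * C by move: dle; rewrite natrM exprMn.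
suff key (e : R) : n2 * e <= 8 / 3 * pairw R p * del -> e * d <= 8 / 3 * pairw R p * del * C.
  case: (boolP (odd (absz p.1 * absz p.2))) => [oddp|evenp].
    rewrite -signr_odd oddp expr1 opprK mul1r; apply: key.
    by rewrite pw; exact: epair_incr_le.
  rewrite -signr_odd (negbTE evenp) expr0 mulN1r mulrN -mulNr; apply: key.
  by rewrite pw; exact: epair_incr_ge.
move=> h; have [e0|/ltW e0] := leP 0 e; last first.
  by apply: (@le_trans _ _ 0); [rewrite mulr_le0_ge0|rewrite mulr_ge0].
apply: (@le_trans _ _ (e * (n2 * C))); first by rewrite ler_wpM2l.
by rewrite mulrA [e * _]mulrC ler_wpM2r.
Qed.

(** Symmetrize the Fourier expansion in [m] and [k], bound the pairs by
    [pair_term_le] and use that the weights have a nonpositive sum. *)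
Lemma ntheta_incr_half x :
  ntheta s' x y - ntheta s x y <= ntheta s' (1 / 2) y - ntheta s (1 / 2) y.
Proof.
have s'0 : 0 < s' by exact: lt_le_trans ss.
pose c z p : R := cos (2 * pi * (p.1 * p.2)%:~R * z).
have ac t z : 0 < t -> asum (fun p => pgauss t y p * c z p).
  by move=> t0; apply: (@asum_pgauss_mul _ _ _ _ 1) => // p; exact: cos_max.
have bc (z : R) p : `|c z p| <= 1 by exact: cos_max.
have ad z : asum (fun p => dpg p * c z p).
  apply: (@eq_asum _ _ (fun p => pgauss s' y p * c z p - pgauss s y p * c z p)).
    by move=> p; rewrite /dpg; ring.
  by apply: asumB; exact: ac.
have E z : ntheta s' z y - ntheta s z y = Num.sqrt y * isum (fun p => dpg p * c z p).
  rewrite !ntheta_poisson// -mulrBr; congr (_ * _); rewrite -isumB; try exact: ac.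
  by apply: eq_isum => p; rewrite /dpg -/(c z p); ring.
rewrite !E ler_wpM2l ?sqrtr_ge0// -subr_le0 -isumB//.
set f := fun p => _; have af : asum f by exact: asumB.
have afs := reindex_asum swap_pair_bij af.
suff : isum (fun p => f p + f (swap_pair p)) <= 0.
  by rewrite isumD// (reindex_isum _ swap_pair_bij); lra.
have del0 : 0 <= del by exact: elead_incr_ge0.
have C0 : 0 <= 1 + cos (2 * pi * x) by rewrite -lerBlDl sub0r cos_geN1.
have aw := asumZ (8 / 3 * (1 + cos (2 * pi * x)) * del) (asum_pairw R).
apply: (@le_trans _ _ (isum (fun p => 8 / 3 * (1 + cos (2 * pi * x)) * del * pairw R p))).
  apply: le_isum => //; first exact: asumD.
  move=> p; apply: le_trans (pair_term_le x p).
  rewrite /f /c /= [p.2 * p.1]mulrC.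
  by rewrite le_eqVlt; apply/orP; left; apply/eqP; ring.
rewrite isumZ; last exact: asum_pairw.
by rewrite mulr_ge0_le0 ?isum_pairw// !mulr_ge0.
Qed.

End PairTerm.
End RealPart.

(** ** The imaginary part far from the corner *)

Section AxisTerms.
Variable R : realType.
Implicit Types (w s y : R).

(** Up to a positive factor, [nu (w / s) - nu (w s)] is minus the derivative
    in [w] of the pair of axis terms [axisw]. *)
Definition nu w : R := w * (w - 3 / 2) * expR (- w).

Lemma der_nu w : der nu w (- ((w - 1 / 2) * (w - 3)) * expR (- w)).
Proof. by rewrite /nu; derive_tac; move: (expR _) => e; field. Qed.

Lemma nu_ge3_dec w w' : 3 <= w -> w <= w' -> nu w' <= nu w.
Proof.
move=> w3 ww; rewrite -lerN2.
apply: (@deriv_ge0_le R (fun t => - nu t) (fun t => (t - 1 / 2) * (t - 3) * expR (- t)) w w' ww) => t.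
  move=> _; apply: (deriv_eq (deriv_opp (der_nu t))).
  by rewrite mulNr opprK.
by case/andP => wt _; rewrite mulr_ge0 ?expR_ge0// mulr_ge0//; lra.
Qed.

Lemma nu_le3_inc w w' : 1 / 2 <= w -> w <= w' -> w' <= 3 -> nu w <= nu w'.
Proof.
move=> w1 ww w3.
apply: (@deriv_ge0_le R nu (fun t => - ((t - 1 / 2) * (t - 3)) * expR (- t)) w w' ww) => t.
  by move=> _; exact: der_nu.
case/andP => wt tw; rewrite mulr_ge0 ?expR_ge0// -mulrN mulr_ge0//; lra.
Qed.

Lemma expRN_split_le (n : nat) (f x : R) : 0 <= f -> n%:R + f <= x ->
  expR (- x) * (1 + f + f ^+ 2 / 2) <= (10 / 27) ^+ n.
Proof.
move=> f0 nx; have h := expRN_le (_ : n%:R <= x - f).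
apply: le_trans (h _); last by lra.
have -> : expR (- (x - f)) = expR (- x) * expR f by rewrite -expRD; congr expR; lra.
by rewrite ler_wpM2l ?expR_ge0//; exact: expR_ge_quad.
Qed.

(** [nu] increases up to [3] and decreases afterwards, so the comparison of
    [nu (w / s)] and [nu (w s)] only needs the product of the arguments. *)
Lemma nu_compare w1 w2 : 17 / 10 <= w1 -> 116 / 10 <= w1 * w2 -> w1 <= w2 ->
  nu w2 <= nu w1.
Proof.
move=> w17 ww w12; have w10 : 0 < w1 by lra.
have [w3|/ltW w3] := leP 3 w1; first exact: nu_ge3_dec.
(* On l <= w1 <= r one has w2 >= B, and both values are compared with those
   at l and B, where expRN_split_le is numerical. *)
have step (l r B f : R) (n : nat) : 1 / 2 <= l -> l <= w1 -> w1 <= r -> 3 <= B -> r * B <= 116 / 10 ->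
    0 <= f -> n%:R + f <= B - l ->
    B * (B - 3 / 2) * (10 / 27) ^+ n <= l * (l - 3 / 2) * (1 + f + f ^+ 2 / 2) ->
    nu w2 <= nu w1.
  move=> l2 lw wr B3 rB f0 nf num.
  apply: le_trans (nu_le3_inc l2 lw w3).
  have Bw : B <= w2 by move: ww; nra.
  apply: (le_trans (nu_ge3_dec B3 Bw)); rewrite /nu.
  have -> : expR (- B) = expR (- l) * expR (- (B - l)) by rewrite -expRD; congr expR; ring.
  rewrite mulrCA [leRHS]mulrC ler_pM2l ?expR_gt0//.
  have h := expRN_split_le f0 nf.
  have q0 : 0 < 1 + f + f ^+ 2 / 2 by have := sqr_ge0 f; lra.
  rewrite -(ler_pM2r q0); apply: le_trans num.
  have K0 : 0 <= B * (B - 3 / 2) by rewrite mulr_ge0//; lra.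
  move: (B * (B - 3 / 2)) K0 h => K K0 h.
  rewrite (_ : _ * _ * _ = K * (expR (- (B - l)) * (1 + f + f ^+ 2 / 2))); last by ring.
  exact: ler_wpM2l.
have [h|/ltW h] := leP w1 (18 / 10).
  by apply: (step (17 / 10) (18 / 10) (64 / 10) (7 / 10) 4%N); lra.
have [h2|/ltW h2] := leP w1 2.
  by apply: (step (18 / 10) 2 (58 / 10) 0 4%N); lra.
have [h3|/ltW h3] := leP w1 (23 / 10).
  by apply: (step 2 (23 / 10) 5 0 3%N); lra.
have [h4|/ltW h4] := leP w1 (26 / 10).
  by apply: (step (23 / 10) (26 / 10) (44 / 10) (1 / 10) 2%N); lra.
by apply: (step (26 / 10) 3 (38 / 10) (2 / 10) 1%N); lra.
Qed.

(** The pair [(0, k)], [(k, 0)] multiplied by a constant and [y^(3/2)], with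
    [w = pi k^2 y]. *)
Definition axisw s w : R :=
  w * Num.sqrt w * (s^-1 * expR (- (w / s)) - s * expR (- (w * s))).

Lemma axisw_dec s w w' : 1 <= s -> s <= 2 -> 341 / 100 <= w -> w <= w' ->
  axisw s w' <= axisw s w.
Proof.
move=> s1 s2 w3 ww; rewrite -lerN2; have s0 : 0 < s by exact: lt_le_trans s1.
apply: (@deriv_ge0_le R (fun t => - axisw s t)
  (fun t => Num.sqrt t / t * (nu (t / s) - nu (t * s))) w w' ww) => t /andP[wt _].
  have t0 : 0 < t by apply: lt_le_trans wt; lra.
  have q0 : 0 < Num.sqrt t by rewrite sqrtr_gt0.
  rewrite /axisw; derive_tac; first exact: t0.
  rewrite /nu; have := sqr_sqrtr (ltW t0).
  move: (Num.sqrt t) q0 (expR (- (t / s))) (expR (- (t * s))) => q q0 e1 e2 qt.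
  by rewrite -qt; field; rewrite !gt_eqF.
have t0 : 0 < t by apply: lt_le_trans wt; lra.
rewrite mulr_ge0 ?divr_ge0 ?sqrtr_ge0 ?(ltW t0)// subr_ge0.
apply: nu_compare.
- by rewrite ler_pdivlMr//; lra.
- rewrite (_ : t / s * (t * s) = t * t); last by field; rewrite gt_eqF.
  by nra.
- by rewrite ler_pdivrMr// -mulrA ler_peMr ?(ltW t0)//; nra.
Qed.

Lemma kpair_axis y s (b : R) : 0 < s -> 0 < b -> 0 < y ->
  pi * b * Num.sqrt (pi * b) * (y * Num.sqrt y * kpair (pi * y) s 0 b) =
  b * axisw s (pi * b * y).
Proof.
move=> s0 b0 y0; have pb : 0 < pi * b by rewrite mulr_gt0 ?pi_gt0.
have -> : kpair (pi * y) s 0 b =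
    b / s * expR (- (pi * b * y / s)) - s * b * expR (- (pi * b * y * s)).
  rewrite /kpair mulr0 mul0r subr0 sub0r addr0 add0r mulNr.
  by congr (_ * expR _ - _ * expR _); ring.
rewrite /axisw (sqrtrM y (ltW pb)).
by field; rewrite gt_eqF.
Qed.

Lemma kpair_axis_dec y y' s (b : R) : 1 <= s -> s <= 2 -> 1 <= b ->
  11 / 10 <= y -> y <= y' ->
  y' * Num.sqrt y' * kpair (pi * y') s 0 b <= y * Num.sqrt y * kpair (pi * y) s 0 b.
Proof.
move=> s1 s2 b1 y1 yy; have s0 : 0 < s by exact: lt_le_trans s1.
have b0 : 0 < b by exact: lt_le_trans b1.
have y0 : 0 < y by lra.
have y'0 : 0 < y' by lra.
have pb : 0 < pi * b by rewrite mulr_gt0 ?pi_gt0.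
have c0 : 0 < pi * b * Num.sqrt (pi * b) by rewrite mulr_gt0 ?sqrtr_gt0.
rewrite -(ler_pM2l c0) !kpair_axis// ler_pM2l//; apply: axisw_dec => //; last first.
  by rewrite ler_pM2l.
have h := pi_gt31 R; rewrite (_ : 341 / 100 = 31 / 10 * 1 * (11 / 10)); last by field.
have pb31 : 31 / 10 * 1 <= pi * b by apply: ler_pM => //; exact: ltW.
by apply: ler_pM.
Qed.

End AxisTerms.

Section Far.
Variable R : realType.
Implicit Types (y s v : R).

Lemma expR_ge_cubic (x : R) : 0 <= x -> 1 + x + x ^+ 2 / 2 + x ^+ 3 / 6 <= expR x.
Proof.
move=> x0; rewrite -subr_ge0.
pose f (t : R) := expR t - (1 + t + t * t / 2 + t * t * t / 6).
have : f 0 <= f x.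
  apply: (@deriv_ge0_le R f (fun t => expR t - (1 + t + t * t / 2)) 0 x x0) => t.
    by move=> _; rewrite /f; derive_tac; field.
  by case/andP => t0 _; rewrite subr_ge0 -expr2; exact: expR_ge_quad.
rewrite /f expR0 !mul0r !addr0 subrr.
by rewrite (_ : x ^+ 3 = x * x * x) ?expr2//; ring.
Qed.

(** The pair [{|m|, |k|} = {1, 2}] changes sign at [s = 2], so only its size is
    used. *)
Lemma kpair14_le v s : 378 / 100 <= v -> 1 <= s -> s <= 2 ->
  kpair v s 1 4 <= klead v s * (1 / 12).
Proof.
move=> v3 s1 s2; have v0 : 0 < v by lra.
have s0 : 0 < s by exact: lt_le_trans s1.
have L0 : 0 <= klead v s.
  by rewrite mulr_ge0 ?expR_ge0// subr_ge0 (le_trans _ s1)// invf_le1.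
have h := @norm_kpair_le R v s 1 4 v0 s1 (lexx 1) (ler1n R 4).
apply: (le_trans (ler_norm _)); apply: (le_trans h); rewrite ler_wpM2l//.
rewrite subrr mulr0 mul0r !add0r addr0.
have E1 : expR (- (v * (s * (4 - 1)))) <= (10 / 27) ^+ 9.
  by apply: expRN_le; nra.
have u1 : 189 / 100 <= v / s by rewrite ler_pdivlMr//; nra.
have N : `|4 - s ^+ 2 * 1| <= 3.
  by rewrite mulr1 ler_norml; apply/andP; split; nra.
set u := v / s in u1 *.
have E2 : u * expR (- (v * ((4 - 1) / s))) <= expR (- (u * 2 + 1)).
  rewrite (_ : v * ((4 - 1) / s) = u * 3); last by rewrite /u; field; rewrite gt_eqF.
  by apply: le_trans (le_expR_mul _ _) _; rewrite ler_expR; lra.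
have E3 := @expRN_split_le R 4%N (78 / 100) (u * 2 + 1) ltac:(lra) ltac:(lra).
have E4 : `|4 - s ^+ 2 * 1| * (4 - 1) * u * expR (- (v * ((4 - 1) / s))) <=
   9 * expR (- (u * 2 + 1)).
  rewrite -mulrA (_ : 9 = 3 * 3); last by ring.
  rewrite (_ : 4 - 1 = 3) in E2 *; last by ring.
  have u0 : 0 <= u * expR (- (v * (3 / s))) by rewrite mulr_ge0 ?expR_ge0//; lra.
  by apply: ler_pM => //; rewrite ?mulr_ge0// ler_wpM2r.
move: E1 E3 E4; clear.
move: (expR (- (u * 2 + 1))) (expR (- (v * (s * (4 - 1))))) => e e'.
set c := `|_| * _ * _ * _.
by lra.
Qed.

Lemma ratio_poly (d : R) : 12 / 100 <= d -> (1 + d * (10 / 11)) ^+ 2 <=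
  3 / 5 * (1 + 62 / 10 * d + (62 / 10 * d) ^+ 2 / 2 + (62 / 10 * d) ^+ 3 / 6).
Proof.
move=> d1; have dd : 12 / 100 * d <= d * d by rewrite ler_wpM2r//; lra.
have d3 : 12 / 100 * (d * d) <= d * d * d.
  by rewrite [leRHS]mulrC mulrC mulrC ler_wpM2r// mulr_ge0//; lra.
by lra.
Qed.

Section FarIncr.
Variables (y s s' : R).
Hypotheses (yf : 61 / 50 <= y) (s1 : 1 <= s) (ss : s <= s') (s2 : s' <= 2).
Let z : R := 11 / 10.

Let y0 : 0 < y. Proof. by apply: lt_le_trans yf; rewrite divr_gt0. Qed.
Let z0 : 0 < z. Proof. by rewrite divr_gt0. Qed.
Let s0 : 0 < s. Proof. exact: lt_le_trans s1. Qed.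
Let y7 : 7 / 10 <= y. Proof. by apply: le_trans yf; lra. Qed.
Let z7 : 7 / 10 <= z. Proof. by rewrite /z; lra. Qed.
Let zy : z <= y. Proof. by apply: le_trans yf; rewrite /z; lra. Qed.

Let inI t : s <= t <= s' -> 1 <= t /\ t <= 2.
Proof. by case/andP => h1 h2; split; [exact: le_trans h1|exact: le_trans s2]. Qed.

Let D w (m k : nat) : R :=
  epair w s' (m%:R ^+ 2) (k%:R ^+ 2) - epair w s (m%:R ^+ 2) (k%:R ^+ 2).
Let del w : R := elead w s - elead w s'.

Let delz0 : 0 <= Num.sqrt z * del z.
Proof. by rewrite mulr_ge0 ?sqrtr_ge0//; exact: elead_incr_ge0. Qed.

Let half_pow (n : nat) : (2 ^+ n)^-1 = (1 / 2) ^+ n :> R.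
Proof. by rewrite div1r exprVn. Qed.

(* The exponential gains more between the heights z and y than y^(3/2) loses. *)
Let ratio (c : R) : 2 <= c ->
  y * Num.sqrt y * expR (- (pi * y * c)) <= 3 / 5 * (z * Num.sqrt z * expR (- (pi * z * c))).
Proof.
move=> c2; set d := y - z.
have d1 : 12 / 100 <= d by rewrite /d /z; move: yf; lra.
have yE : y = z + d by rewrite /d; ring.
set r := 1 + d * (10 / 11).
have r1 : 1 <= r by rewrite /r; lra.
have yr : y = z * r by rewrite /r /z yE /z; field.
have sq : Num.sqrt y <= Num.sqrt z * r.
  rewrite yr (sqrtrM r (ltW z0)) ler_wpM2l ?sqrtr_ge0//.
  rewrite -[leRHS]ger0_norm ?(le_trans ler01)// -sqrtr_sqr ler_wsqrtr// expr2 ler_peMr//.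
  by apply: le_trans r1.
have E : expR (- (pi * y * c)) <= expR (- (pi * z * c)) * expR (- (62 / 10 * d)).
  rewrite -expRD ler_expR yE; have h := pi_gt31 R.
  have : 31 / 10 * 2 * d <= pi * c * d.
    rewrite ler_pM2r; last by lra.
    by apply: ler_pM => //; exact: ltW.
  by move: (pi : R) => q; lra.
have x0 : 0 <= 62 / 10 * d by lra.
have F := expR_ge_cubic x0.
have K : r ^+ 2 * expR (- (62 / 10 * d)) <= 3 / 5.
  rewrite expRN ler_pdivrMr ?expR_gt0//; apply: (@le_trans _ _ (3 / 5 *
    (1 + 62 / 10 * d + (62 / 10 * d) ^+ 2 / 2 + (62 / 10 * d) ^+ 3 / 6))); last first.
    by rewrite ler_wpM2l.
  exact: ratio_poly.
apply: (@le_trans _ _ ((z * r) * (Num.sqrt z * r) *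
    (expR (- (pi * z * c)) * expR (- (62 / 10 * d))))).
  apply: ler_pM => //; rewrite ?mulr_ge0 ?sqrtr_ge0 ?expR_ge0 ?(ltW y0)//.
  by rewrite -yr ler_wpM2l// ltW.
have -> : (z * r) * (Num.sqrt z * r) * (expR (- (pi * z * c)) * expR (- (62 / 10 * d))) =
  (r ^+ 2 * expR (- (62 / 10 * d))) * (z * Num.sqrt z * expR (- (pi * z * c))) by ring.
by rewrite ler_wpM2r// !mulr_ge0 ?sqrtr_ge0 ?expR_ge0// ltW.
Qed.

Let der_scaled w (g : R -> R) (dg : R -> R) t : der g t (dg t) ->
  der (fun t => Num.sqrt w * g t) t (Num.sqrt w * dg t).
Proof.
by move=> dgt; apply: (deriv_eq (deriv_mul (deriv_cst _ _) dgt)); rewrite mul0r add0r.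
Qed.

Let del_ratio : Num.sqrt y * del y <= 3 / 5 * (Num.sqrt z * del z).
Proof.
pose f t := Num.sqrt y * - elead y t; pose g t := 3 / 5 * (Num.sqrt z * - elead z t).
have pos t : s <= t <= s' -> 0 < t by case/andP => st _; exact: lt_le_trans st.
have : f s' - f s <= g s' - g s.
  apply: (@deriv_le_incr R f g
    (fun t => Num.sqrt y * (pi * y / t * klead (pi * y) t))
    (fun t => 3 / 5 * (Num.sqrt z * (pi * z / t * klead (pi * z) t))) s s' ss) => t tI;
    have t0 := pos t tI.
  - apply: (@der_scaled y (fun t => - elead y t) (fun t => pi * y / t * klead (pi * y) t)).
    by apply: (deriv_eq (deriv_opp (der_elead y t0))); rewrite opprK.
  - have h : der (fun t => Num.sqrt z * - elead z t) t (Num.sqrt z * (pi * z / t * klead (pi * z) t)).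
      apply: (@der_scaled z (fun t => - elead z t) (fun t => pi * z / t * klead (pi * z) t)).
      by apply: (deriv_eq (deriv_opp (der_elead z t0))); rewrite opprK.
    by apply: (deriv_eq (deriv_mul (deriv_cst _ _) h)); rewrite mul0r add0r.
  - have [t1 t2] := inI tI.
    have c2 : 2 <= t + t^-1.
      rewrite -subr_ge0 (_ : _ - 2 = (t - 1) ^+ 2 / t); last by field; rewrite gt_eqF.
      by rewrite divr_ge0 ?sqr_ge0// ltW.
    have K0 : 0 <= pi / t * (t - t^-1).
      rewrite mulr_ge0 ?divr_ge0 ?pi_ge0 ?(ltW t0)// subr_ge0.
      by rewrite (le_trans _ t1)// invf_le1.
    have := ler_wpM2l K0 (ratio c2); rewrite /klead.
    move: (expR _) (expR _) => e1 e2 h.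
    by apply: le_trans (le_trans h _); rewrite le_eqVlt; apply/orP; left; apply/eqP; ring.
by rewrite /f /g /del; lra.
Qed.

Let D_up (m k : nat) : (0 < m)%N -> (0 < k)%N -> (2 <= m * k)%N ->
  D y m k <= 2 / 3 * (1 / 2) ^+ (m + k) * del y.
Proof.
wlog mk : m k / (m <= k)%N => [H m0 k0 mk2|m0 k0 mk2].
  have [mk|/ltnW km] := leqP m k; first exact: H.
  have := H k m km k0 m0; rewrite mulnC => /(_ mk2).
  by rewrite /D epairC [epair y s _ _]epairC addnC.
have k2 : (2 <= k)%N.
  by rewrite ltnNge; apply/negP => k1; have := leq_mul (leq_trans mk k1) k1; rewrite leqNgt mk2.
have := @epair_incr R y s s' (m%:R ^+ 2) (k%:R ^+ 2) (2 / 3 * (2 ^+ (m + k))^-1) 1 y0 s0 ss.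
rewrite half_pow => h; rewrite -[D y m k]mul1r; apply: h => t /inI[t1 t2].
rewrite mul1r -half_pow.
have L0 : 0 <= klead (pi * y) t.
  by rewrite mulr_ge0 ?expR_ge0// subr_ge0 (le_trans _ t1)// invf_le1 ?(lt_le_trans _ t1).
have v3 : 378 / 100 <= pi * y.
  apply: (@le_trans _ _ (31 / 10 * (61 / 50))); first by lra.
  by apply: ler_pM => //; exact/ltW/pi_gt31.
have v2 : 217 / 100 <= pi * y by apply: le_trans v3; lra.
have w0 : 0 <= (2 ^+ (m + k))^-1 :> R by rewrite invr_ge0 exprn_ge0.
have n4 : 4 <= m%:R ^+ 2 * k%:R ^+ 2 :> R.
  have k4 : 2 <= k%:R :> R by rewrite ler_nat.
  have m1 : 1 <= m%:R :> R by rewrite ler1n.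
  by rewrite -exprMn; have : 2 <= m%:R * k%:R :> R; [rewrite -natrM ler_nat|nra].
have [k3|k3] := leqP 3 k.
  have K := norm_kpair_weight m0 mk k2 v2 t1 t2 k3.
  have N := ler_norm (kpair (pi * y) t (m%:R ^+ 2) (k%:R ^+ 2)).
  apply: (le_trans N); set n := `|_| in K N *.
  have n0 : 0 <= n by exact: normr_ge0.
  have h4 : 4 * n <= m%:R ^+ 2 * k%:R ^+ 2 * n by rewrite ler_wpM2r.
  by have := le_trans h4 K; lra.
have kE : k = 2%N by apply/eqP; rewrite eqn_leq k2 -ltnS k3.
have [mE|mn] := eqVneq m 2%N.
  apply: (@le_trans _ _ 0); last by rewrite mulr_ge0// mulr_ge0.
  rewrite kE mE /kpair -mulrDl mulr_le0_ge0 ?expR_ge0//.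
  have t0 : 0 < t by exact: lt_le_trans t1.
  rewrite (_ : _ + _ = - (8 * (t - t^-1))); last by ring.
  by rewrite oppr_le0 mulr_ge0// subr_ge0 (le_trans _ t1)// invf_le1.
have m2 : (m < 2)%N by rewrite ltn_neqAle mn -kE.
have mE : m = 1%N by apply/eqP; rewrite eqn_leq m0 andbT -ltnS.
have := kpair14_le v3 t1 t2; rewrite kE mE expr1n.
rewrite (_ : 2%:R ^+ 2 = 4); last by ring.
by rewrite (_ : 2 / 3 * _ = 1 / 12)//; field.
Qed.

Let dpg w p := pgauss s' w p - pgauss s w p.

Let dpg_pair w p : dpg w p + dpg w (swap_pair p) = D w (absz p.1) (absz p.2).
Proof. by rewrite /dpg /D -!pgauss_pair; ring. Qed.

Let axis (k : nat) : Num.sqrt y * D y 0 k <= Num.sqrt z * D z 0 k.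
Proof.
case: k => [|k].
  rewrite /D /epair expr0n !mulr0 !mul0r !addr0 !mulr0 oppr0.
  by rewrite subrr !mulr0.
set b : R := k.+1%:R ^+ 2; have b1 : 1 <= b by rewrite exprn_ege1// ler1n.
pose f w t := Num.sqrt w * epair w t 0 b.
have pos t : s <= t <= s' -> 0 < t by case/andP => st _; exact: lt_le_trans st.
have : f y s' - f y s <= f z s' - f z s.
  apply: (@deriv_le_incr R (f y) (f z)
    (fun t => Num.sqrt y * (pi * y / t * kpair (pi * y) t 0 b))
    (fun t => Num.sqrt z * (pi * z / t * kpair (pi * z) t 0 b)) s s' ss) => t tI;
    have t0 := pos t tI.
  - exact: (@der_scaled y (fun t => epair y t 0 b)
      (fun t => pi * y / t * kpair (pi * y) t 0 b) t (der_epair y 0 b t0)).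
  - exact: (@der_scaled z (fun t => epair z t 0 b)
      (fun t => pi * z / t * kpair (pi * z) t 0 b) t (der_epair z 0 b t0)).
  - have [t1 t2] := inI tI.
    have h := kpair_axis_dec t1 t2 b1 (lexx z) zy.
    have p0 : 0 <= pi / t by rewrite divr_ge0 ?pi_ge0 ?(ltW t0).
    have := ler_wpM2l p0 h; move: (kpair _ _ _ _) (kpair _ _ _ _) => k1 k2 {}h.
    by apply: le_trans (le_trans h _); rewrite le_eqVlt; apply/orP; left; apply/eqP; ring.
by rewrite /f /D expr0n /= -!mulrBr.
Qed.

Let c0 p : R := cos (2 * pi * (p.1 * p.2)%:~R * (1 / 2)).

Let c0E p : c0 p = (-1) ^+ (absz p.1 * absz p.2).
Proof.
rewrite /c0 cos_intr -cos_pi_mulrn; congr cos.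
by rewrite div1r [2 * pi]mulrC -!mulrA; congr (_ * _); rewrite mulrCA divff ?mulr1.
Qed.

(** The decrease [2 / 5] of the leading pair pays for the other pairs with
    [m k != 0], in proportion to the same weights; the axis pairs decrease by
    [kpair_axis_dec]. *)
Lemma far_pair_le p :
  (Num.sqrt y * D y (absz p.1) (absz p.2) - Num.sqrt z * D z (absz p.1) (absz p.2)) * c0 p <=
  16 / 15 * (Num.sqrt z * del z) * pairw R p.
Proof.
rewrite c0E.
have gE (j : int) : (0 < absz j)%N -> geow R j = (1 / 2) ^+ absz j.
  by rewrite /geow absz_gt0 => /negbTE ->.
have [pz|] := eqVneq (absz p.1 * absz p.2)%N 0%N.
  have -> : pairw R p = 0.
    move/eqP: pz; rewrite muln_eq0 !absz_eq0 /pairw /geow /unitw.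
    by case/orP => /eqP ->; rewrite ?mul0r ?mulr0 subr0.
  rewrite pz expr0 mulr1 mulr0 subr_le0.
  move/eqP: pz; rewrite muln_eq0 => /orP[] /eqP ->; first exact: axis.
  by have := axis (absz p.1); rewrite /D ![epair _ _ (0%:R ^+ 2) _]epairC.
rewrite -lt0n => mk0.
have /andP[m0 k0] : (0 < absz p.1)%N && (0 < absz p.2)%N by rewrite -muln_gt0.
have [pu|pn1] := eqVneq (absz p.1 * absz p.2)%N 1%N.
  have [m1 k1] : absz p.1 = 1%N /\ absz p.2 = 1%N.
    by move/eqP: pu; rewrite muln_eq1 => /andP[/eqP -> /eqP ->].
  rewrite pu /pairw /unitw !gE// m1 k1 eqxx.
  have D1 w : D w 1 1 = - 2 * del w.
    by rewrite /D /del /epair /elead !expr1n !mulr1 !div1r; ring.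
  rewrite !D1; have := del_ratio; move: (Num.sqrt y) (Num.sqrt z) (del y) (del z).
  by move=> *; lra.
have mk2 : (2 <= absz p.1 * absz p.2)%N by rewrite ltn_neqAle eq_sym pn1.
have pw : pairw R p = (1 / 2) ^+ (absz p.1 + absz p.2).
  rewrite /pairw !gE// exprD /unitw; case: eqP => [m1|_]; last by rewrite mul0r subr0.
  case: eqP => [k1|_]; last by rewrite mulr0 subr0.
  by move: pn1; rewrite m1 k1.
set m := absz p.1 in m0 mk2 pw *; set k := absz p.2 in k0 mk2 pw *.
set P := pairw R p in pw *.
have P0 : 0 <= P by rewrite pw exprn_ge0.
have n4 : 4 <= m%:R ^+ 2 * k%:R ^+ 2 :> R.
  by rewrite -exprMn; have : 2 <= m%:R * k%:R :> R; [rewrite -natrM ler_nat|nra].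
have dely0 : 0 <= del y by exact: elead_incr_ge0.
have div4 (e d : R) : 0 <= d -> m%:R ^+ 2 * k%:R ^+ 2 * e <= 8 / 3 * P * d ->
    e <= 2 / 3 * P * d.
  move=> d0; move: n4; move: (m%:R ^+ 2 * _) => n n4.
  have Pd : 0 <= P * d by rewrite mulr_ge0.
  have [e0|e0] := leP 0 e; first by nra.
  by move=> _; apply: le_trans (ltW e0) _; lra.
have lowz : - D z m k <= 2 / 3 * P * del z.
  by apply: div4; [exact: elead_incr_ge0|rewrite pw; exact: epair_incr_ge].
have lowy : - D y m k <= 2 / 3 * P * del y.
  by apply: div4 => //; rewrite pw; exact: epair_incr_ge.
have upy : D y m k <= 2 / 3 * P * del y by rewrite pw; exact: D_up.
have qy := sqrtr_ge0 y; have qz := sqrtr_ge0 z.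
have R1 : Num.sqrt y * (2 / 3 * P * del y) <= 2 / 5 * P * (Num.sqrt z * del z).
  rewrite (_ : Num.sqrt y * _ = 2 / 3 * P * (Num.sqrt y * del y)); last by ring.
  rewrite (_ : 2 / 5 * _ * _ = 2 / 3 * P * (3 / 5 * (Num.sqrt z * del z))); last by field.
  by rewrite ler_wpM2l ?del_ratio// mulr_ge0.
have L1 := ler_wpM2l qz lowz; have L2 := ler_wpM2l qy lowy; have L3 := ler_wpM2l qy upy.
case: (boolP (odd (m * k))) => [oddp|evenp].
  have upz : D z m k <= 2 / 3 * P * del z.
    by apply: div4; [exact: elead_incr_ge0|rewrite pw; exact: epair_incr_le].
  have L4 := ler_wpM2l qz upz.
  rewrite -signr_odd oddp expr1; move: R1 L2 L4.
  by move: (Num.sqrt y) (Num.sqrt z) (D y m k) (D z m k) (del y) (del z) => *; lra.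
rewrite -signr_odd (negbTE evenp) expr0; move: R1 L1 L3.
by move: (Num.sqrt y) (Num.sqrt z) (D y m k) (D z m k) (del y) (del z) => *; lra.
Qed.

(** Both heights are compared on [x = 1/2], where the cosines are signs. *)
Lemma ntheta_incr_far :
  ntheta s' (1 / 2) y - ntheta s (1 / 2) y <= ntheta s' (1 / 2) z - ntheta s (1 / 2) z.
Proof.
have s'0 : 0 < s' by exact: lt_le_trans ss.
have ac t w : 0 < t -> 0 < w -> asum (fun p => pgauss t w p * c0 p).
  by move=> t0 w0; apply: (@asum_pgauss_mul _ _ _ _ 1) => // p; exact: cos_max.
have ad w : 0 < w -> asum (fun p => Num.sqrt w * (dpg w p * c0 p)).
  move=> w0; apply: asumZ.
  apply: (@eq_asum _ _ (fun p => pgauss s' w p * c0 p - pgauss s w p * c0 p)).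
    by move=> p; rewrite /dpg; ring.
  by apply: asumB; exact: ac.
have E w : 0 < w -> ntheta s' (1 / 2) w - ntheta s (1 / 2) w =
    isum (fun p => Num.sqrt w * (dpg w p * c0 p)).
  move=> w0; rewrite !ntheta_poisson// -mulrBr -isumB; try exact: ac.
  rewrite -isumZ; last by apply: asumB; exact: ac.
  by apply: eq_isum => p; rewrite /dpg -/(c0 p); ring.
rewrite !E// -subr_le0 -isumB; [|exact: ad|exact: ad].
set f := fun p => _; have af : asum f by apply: asumB; exact: ad.
have afs := reindex_asum (swap_pair_bij) af.
suff : isum (fun p => f p + f (swap_pair p)) <= 0.
  by rewrite isumD// (reindex_isum _ (swap_pair_bij)); lra.
have aw := asumZ (16 / 15 * (Num.sqrt z * del z)) (asum_pairw R).
apply: (@le_trans _ _ (isum (fun p => 16 / 15 * (Num.sqrt z * del z) * pairw R p))).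
  apply: le_isum => //; first exact: asumD.
  move=> p; apply: le_trans (far_pair_le p).
  have -> : c0 p = c0 (swap_pair p) by rewrite /c0 /= [p.2 * p.1]mulrC.
  rewrite -!dpg_pair /f (_ : c0 p = c0 (swap_pair p)); last by rewrite /c0 /= [p.2 * p.1]mulrC.
  by rewrite le_eqVlt; apply/orP; left; apply/eqP; ring.
rewrite isumZ; last exact: asum_pairw.
by rewrite mulr_ge0_le0 ?isum_pairw// mulr_ge0.
Qed.

End FarIncr.
End Far.

(** ** Convergence to the corner *)

Section Corner.
Variable R : realType.
Implicit Types (x y s : R).

Definition hexy : R := Num.sqrt 3 / 2.

Lemma hexy_sqr : hexy ^+ 2 = 3 / 4.
Proof. by rewrite /hexy expr_div_n sqr_sqrtr//; field. Qed.

Lemma hexy_gt : 86 / 100 < hexy.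
Proof.
have h : 0 <= hexy by rewrite divr_ge0 ?sqrtr_ge0.
have := hexy_sqr; rewrite expr2 => h2.
rewrite ltNge; apply/negP => h3.
have : hexy * hexy <= 86 / 100 * (86 / 100) by apply: ler_pM.
by rewrite h2; lra.
Qed.

Lemma hexy_lt : hexy < 87 / 100.
Proof.
have h := hexy_gt; have := hexy_sqr; rewrite expr2 => h2.
rewrite ltNge; apply/negP => h3.
have : 87 / 100 * (87 / 100) <= hexy * hexy by apply: ler_pM => //; lra.
by rewrite h2; lra.
Qed.

(** Imaginary part of [- 1 / z] for [z = 1/2 + i y]. *)
Definition fold_im y : R := y / (y ^+ 2 + 1 / 4).

Lemma ntheta_fold s y : 0 < y ->
  ntheta s (1 / 2) y = ntheta s (1 / 2 / (y ^+ 2 + 1 / 4)) (fold_im y).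
Proof.
move=> y0; rewrite -(ntheta_swap s (1 / 2) y0) /fold_im.
by rewrite (_ : (1 / 2) ^+ 2 + y ^+ 2 = y ^+ 2 + 1 / 4)//; field.
Qed.

Lemma fold_im_range y : 7 / 10 <= y <= 61 / 50 -> 7 / 10 <= fold_im y <= 61 / 50.
Proof.
case/andP => y1 y2; have d0 : 0 < y ^+ 2 + 1 / 4 by have := sqr_ge0 y; lra.
have h : 0 <= (y - 7 / 10) * (61 / 50 - y) by rewrite mulr_ge0// subr_ge0.
have {}h : 0 <= 48 / 25 * y - y ^+ 2 - 427 / 500 by move: h; rewrite expr2; lra.
have h' : 0 <= y ^+ 2 - y + 1 / 4.
  by rewrite (_ : _ - _ + _ = (y - 1 / 2) ^+ 2) ?sqr_ge0//; field.
rewrite /fold_im; move: (y ^+ 2) d0 h h' => q d0 h h'; apply/andP; split.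
  by rewrite ler_pdivlMr//; lra.
by rewrite ler_pdivrMr//; lra.
Qed.

Lemma fold_im_contract y : 7 / 10 <= y ->
  `|fold_im y - hexy| <= 1 / 2 * `|y - hexy|.
Proof.
move=> y1; have d0 : 0 < y ^+ 2 + 1 / 4 by have := sqr_ge0 y; lra.
have hg := hexy_gt; have h2 := hexy_sqr.
have -> : fold_im y - hexy = (1 / 4 - y * hexy) / (y ^+ 2 + 1 / 4) * (y - hexy).
  have e : (1 / 4 - y * hexy) * (y - hexy) = y - hexy * (y ^+ 2 + 1 / 4).
    rewrite (_ : (1 / 4 - y * hexy) * (y - hexy) =
      1 / 4 * y - y ^+ 2 * hexy - 1 / 4 * hexy + y * hexy ^+ 2); last by ring.
    by rewrite h2; field.
  by rewrite mulrAC e mulrBl mulfK// gt_eqF.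
rewrite normrM ler_wpM2r// normrM [X in _ * X]gtr0_norm ?invr_gt0//.
rewrite ler_pdivrMr// ler_norml; apply/andP; split; last by nra.
have : 0 <= (y - hexy) ^+ 2 by exact: sqr_ge0.
rewrite (_ : (y - hexy) ^+ 2 = y ^+ 2 - 2 * (y * hexy) + hexy ^+ 2); last by ring.
by rewrite h2; move: (y * hexy) => q; lra.
Qed.

Lemma cvg_ntheta_im (u : nat -> R) (l s : R) : 0 < s -> u n @[n --> \oo] --> l ->
  (forall n, 7 / 10 <= u n <= 61 / 50) -> 7 / 10 <= l <= 61 / 50 ->
  ntheta s (1 / 2) (u n) @[n --> \oo] --> ntheta s (1 / 2) l.
Proof.
move=> s0 ul ub lb; apply: cvgM; first exact: cvg_cst.
have c0 : 0 < pi * s * (1 / 4) by rewrite !mulr_gt0 ?pi_gt0//; lra.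
have dom y (p : int * int) : 7 / 10 <= y <= 61 / 50 -> `|expR (- (pi * s * latq (1 / 2) y p))| <=
    expR (- (pi * s * (1 / 4) * p.1%:~R ^+ 2)) * expR (- (pi * s * (1 / 4) * p.2%:~R ^+ 2)).
  move=> /andP[y1 y2]; have y0 : 0 < y by lra.
  rewrite ger0_norm ?expR_ge0// -expRD ler_expR -opprD lerN2 -mulrDr.
  rewrite -[leLHS]mulrA ler_pM2l ?mulr_gt0 ?pi_gt0//.
  apply: le_trans (latq_lower _ _ y0); rewrite ler_wpM2r ?addr_ge0 ?sqr_ge0//.
  have T0 : 0 < (1 / 2) ^+ 2 + y ^+ 2 + 1 by have := sqr_ge0 y; lra.
  by rewrite ler_pdivlMr//; nra.
apply: (@tannery _ _ _ _ _ (fun n p => expR (- (pi * s * latq (1 / 2) (u n) p))) _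
  (fun p : int * int => expR (- (pi * s * (1 / 4) * p.1%:~R ^+ 2)) *
    expR (- (pi * s * (1 / 4) * p.2%:~R ^+ 2)))).
- exact: asum_gauss2.
- by apply: nearW => n p; exact: dom.
- by move=> p; exact: dom.
- move=> p; apply: continuous_cvg; first exact: continuous_expR.
  apply: cvgN; apply: cvgM; first exact: cvg_cst.
  have l0 : l != 0 by case/andP: lb => l1 _; rewrite gt_eqF//; lra.
  apply: cvgM; last by apply: cvgV.
  apply: cvgD; first exact: cvg_cst.
  have cl : p.1%:~R * u n @[n --> \oo] --> p.1%:~R * l.
    by apply: cvgM; [exact: cvg_cst|].
  under eq_fun do rewrite expr2; rewrite expr2; exact: cvgM.
Qed.

Section Increments.
Variables s s' : R.
Hypotheses (s1 : 1 <= s) (ss : s <= s') (s2 : s' <= 2).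

Let D x y := ntheta s' x y - ntheta s x y.

(** Inverting and then moving to [x = 1/2] maps [1/2 + i y] to
    [1/2 + i y / (y^2 + 1/4)] without decreasing the increment, and the
    orbit under this contraction converges to the corner. *)
Lemma ntheta_incr_corner y : 7 / 10 <= y <= 61 / 50 -> D (1 / 2) y <= D (1 / 2) hexy.
Proof.
move=> yI; pose u n := iter n fold_im y.
have uI n : 7 / 10 <= u n <= 61 / 50.
  by elim: n => //= n IH; exact: fold_im_range.
have hI : 7 / 10 <= hexy <= 61 / 50.
  by have h1 := hexy_gt; have h2 := hexy_lt; apply/andP; split; lra.
have udist n : `|u n - hexy| <= (1 / 2) ^+ n * `|y - hexy|.
  elim: n => [|n IH]; first by rewrite expr0 mul1r.
  have /andP[un _] := uI n.
  by apply: (le_trans (fold_im_contract un)); rewrite exprS -[leRHS]mulrA ler_wpM2l.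
have cu : u n @[n --> \oo] --> hexy.
  apply/cvgrPdist_le => e e0.
  have g : geometric `|y - hexy| (1 / 2) n @[n --> \oo] --> (0 : R).
    by apply: cvg_geometric; rewrite ger0_norm//; lra.
  near=> n; rewrite distrC; apply: le_trans (udist n) _.
  rewrite mulrC; near: n.
  have /cvgrPdist_le /(_ _ e0) := g; apply: filterS => n /=.
  by rewrite sub0r normrN ger0_norm// mulr_ge0// exprn_ge0.
have mono n : D (1 / 2) y <= D (1 / 2) (u n).
  elim: n => // n IH; apply: (le_trans IH).
  have /andP[un1 un2] := uI n; have un0 : 0 < u n by lra.
  have /andP[un3 _] := uI n.+1.
  rewrite /D !(ntheta_fold _ un0); exact: ntheta_incr_half.
have s0 : 0 < s by exact: lt_le_trans s1.
have s'0 : 0 < s' by exact: lt_le_trans ss.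
have cD : D (1 / 2) (u n) @[n --> \oo] --> D (1 / 2) hexy.
  by apply: cvgB; apply: cvg_ntheta_im.
apply: (ler_cvg_to (cvg_cst (D (1 / 2) y)) cD).
by apply: nearW.
Unshelve. all: by end_near. Qed.

(** Go to [x = 1/2], then down to a height at most [61/50], then into the
    corner. *)
Lemma ntheta_incr_small x y : hexy <= y -> D x y <= D (1 / 2) hexy.
Proof.
move=> yh; have h := hexy_gt; have y7 : 7 / 10 <= y by lra.
apply: (le_trans (ntheta_incr_half y7 s1 ss s2 x)).
have [yf|/ltW yf] := leP y (61 / 50); first by apply: ntheta_incr_corner; rewrite y7.
apply: (le_trans (ntheta_incr_far yf s1 ss s2)).
by apply: ntheta_incr_corner; apply/andP; split; lra.
Qed.

End Increments.
End Corner.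

(** * Termwise differentiation *)

Section Termwise.
Variables (R : realType) (T : choiceType).

Lemma deriv_lipschitz (f df : R -> R) (c a b : R) : a <= b ->
  (forall t, a <= t <= b -> der f t (df t)) ->
  (forall t, a <= t <= b -> `|df t| <= c) -> `|f b - f a| <= c * (b - a).
Proof.
move=> ab fd dfc.
have cd (e : R) t : der (fun u => e * u) t e by derive_tac; ring.
have up : f b - f a <= c * b - c * a.
  apply: (deriv_le_incr ab fd (fun t _ => cd c t)) => t /dfc; apply: le_trans.
  exact: ler_norm.
have lo : - c * b - - c * a <= f b - f a.
  apply: (deriv_le_incr ab (fun t _ => cd (- c) t) fd) => t /dfc.
  by rewrite ler_norml => /andP[].
rewrite ler_norml; apply/andP; split; last by apply: (le_trans up); rewrite mulrBr.
by apply: le_trans lo; rewrite mulrBr !mulNr opprB addrC opprK.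
Qed.

(** Domination of the derivatives dominates the difference quotients, by the
    mean value theorem. *)
Lemma der_isum (g dg : R -> T -> R) (G : T -> R) (a b x : R) : a < x < b -> asum G ->
  (forall t, a < t < b -> asum (g t)) ->
  (forall t i, a < t < b -> der (g^~ i) t (dg t i)) ->
  (forall t i, a < t < b -> `|dg t i| <= G i) ->
  der (fun t => isum (g t)) x (isum (dg x)).
Proof.
move=> /andP[ax xb] aG ag gd dgG.
have near_ab : \forall h \near (0 : R)^', a < h + x < b.
  have : \forall h \near (0 : R), a < h + x < b.
    exists (Num.min (x - a) (b - x)); first by rewrite /= lt_min !subr_gt0 ax.
    move=> h /=; rewrite sub0r normrN lt_min => /andP[].
    rewrite !ltr_norml => /andP[h1 _] /andP[_ h2]; apply/andP; split; lra.
  by apply: filterS => h ? _.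
have key : (fun h : R => h^-1 *: (isum (g (h *: 1 + x)) - isum (g x))) @ (0 : R)^'
    --> isum (dg x).
  suff : (fun h : R => isum (fun i => h^-1 * (g (h + x) i - g x i))) @ (0 : R)^'
      --> isum (dg x).
    apply: cvg_trans; apply: near_eq_cvg; near=> h.
    have hab : a < h + x < b by near: h.
    rewrite [h *: 1]mulr1 -isumB; [|exact: ag|by apply: ag; rewrite ax].
    by rewrite -[RHS]isumZ//; apply: asumB; apply: ag => //; rewrite ax.
  apply: (@tannery _ _ _ _ _ (fun h i => h^-1 * (g (h + x) i - g x i)) _ G) => //.
  - near=> h => i.
    have hab : a < h + x < b by near: h.
    have h0 : h != 0 by near: h; exact: nbhs_dnbhs_neq.
    have lip : `|g (h + x) i - g x i| <= G i * `|h|.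
      have sub t c d : a < c -> d < b -> c <= t <= d -> a < t < b.
        by move=> ac db /andP[? ?]; rewrite (lt_le_trans ac) ?(le_lt_trans _ db).
      have /andP[ah hb] := hab.
      have [hn|hp] := ltP h 0.
        rewrite distrC (ltr0_norm hn).
        have := @deriv_lipschitz (g^~ i) (dg^~ i) (G i) (h + x) x.
        rewrite (_ : x - (h + x) = - h); [apply|by ring].
        - by lra.
        - by move=> t /(sub _ _ _ ah xb) tab; exact: gd.
        - by move=> t /(sub _ _ _ ah xb) tab; exact: dgG.
      rewrite (ger0_norm hp).
      have := @deriv_lipschitz (g^~ i) (dg^~ i) (G i) x (h + x).
      rewrite addrK; apply.
      - by lra.
      - by move=> t /(sub _ _ _ ax hb) tab; exact: gd.
      - by move=> t /(sub _ _ _ ax hb) tab; exact: dgG.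
    by rewrite normrM normfV mulrC ler_pdivrMr ?normr_gt0.
  - by move=> i; apply: dgG; rewrite ax.
  - move=> i; have xab : a < x < b by rewrite ax.
    have [cv dv] := gd x i xab.
    have : (fun h : R => h^-1 *: (g (h *: 1 + x) i - g x i)) @ (0 : R)^' --> dg x i.
      by rewrite -dv; exact: cv.
    apply: cvg_trans; apply: near_eq_cvg; near=> h.
    by rewrite [h *: 1]mulr1.
split; first by apply/cvg_ex; exists (isum (dg x)).
exact: cvg_lim key.
Unshelve. all: by end_near. Qed.

End Termwise.

(** * The scale derivative *)

Section Scale.
Variable R : realType.
Implicit Types (s t x y c : R).

(** Up to the factor [- 1 / (2 sqrt s)], the derivative in [s] of
    [sqrt s * expR (- s * q)], as a function of [t = s * q]. *)
Definition scalew t : R := (2 * t - 1) * expR (- t).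

Lemma le_expR_half t : 0 <= t -> t * expR (- t) <= expR (- (t / 2)).
Proof.
move=> t0; have -> : - t = - (t / 2) + - (t / 2) by lra.
rewrite expRD mulrA ler_piMl ?expR_ge0// expRN ler_pdivrMr ?expR_gt0// mul1r.
have t2 : 0 <= t / 2 by lra.
apply: le_trans (expR_ge_quad t2).
have := sqr_ge0 (t / 2 - 1); rewrite !expr2; lra.
Qed.

Lemma norm_scalew_le t : 0 <= t -> `|scalew t| <= 3 * expR (- (t / 2)).
Proof.
move=> t0; have h := le_expR_half t0.
have h1 : expR (- t) <= expR (- (t / 2)) by rewrite ler_expR; lra.
have h2 := expR_ge0 (- t); rewrite /scalew mulrBl mul1r -mulrA ler_norml.
have h3 : 0 <= t * expR (- t) by rewrite mulr_ge0.
by move: (t * expR (- t)) (expR (- t)) (expR _) h h1 h2 h3 => *; apply/andP; split; lra.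
Qed.

Lemma asum_scalew c x y : 0 < c -> 0 < y ->
  asum (fun p => scalew (c * latq x y p)).
Proof.
move=> c0 y0; have c2 : 0 < c / (2 * pi) by rewrite divr_gt0 ?mulr_gt0 ?pi_gt0.
apply: asum_le (asumZ 3 (asum_lat x c2 y0)) => p.
apply: (le_trans (norm_scalew_le _)); first by rewrite mulr_ge0 ?latq_ge0 ?(ltW c0).
rewrite ler_wpM2l// ler_expR lerN2 le_eqVlt; apply/orP; left; apply/eqP.
have := pi_gt0 R; move: (pi : R) (latq _ _ _) => q l q0; field.
by rewrite gt_eqF.
Qed.

(** The derivative of [s] is dominated on [(1, oo)] by a Gaussian sum, since
    [u * expR (- u) <= expR (- u / 2)]. *)
Lemma der_ntheta s x y : 1 < s -> 0 < y ->
  der (fun t => ntheta t x y) s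
    (- (2 * Num.sqrt s)^-1 * isum (fun p => scalew (pi * s * latq x y p))).
Proof.
move=> s1 y0; have s0 : 0 < s by lra.
have half0 : 0 < 1 / 2 :> R by lra.
pose dE v (p : int * int) := expR (- (pi * v * latq x y p)) * - (pi * latq x y p).
have dEG t p : 1 < t < s + 1 -> `|dE t p| <= expR (- (pi * (1 / 2) * latq x y p)).
  move=> /andP[t1 _]; have t0 : 0 < t by lra.
  have q0 : 0 <= pi * latq x y p by rewrite mulr_ge0 ?pi_ge0 ?latq_ge0.
  rewrite /dE mulrN normrN (ger0_norm (mulr_ge0 (expR_ge0 _) q0)).
  move: (latq x y p) q0 => l.
  rewrite (_ : pi * t * l = t * (pi * l)); last by rewrite mulrA (mulrC t).
  rewrite (_ : pi * (1 / 2) * l = pi * l / 2); last by rewrite mulrAC mul1r.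
  move: (pi * l) => q q0.
  rewrite mulrC; apply: le_trans (le_expR_half q0).
  by rewrite ler_wpM2l// ler_expR lerN2 ler_peMl//; exact: ltW.
have aE u : 0 < u -> asum (fun p => expR (- (pi * u * latq x y p))).
  by move=> u0; exact: asum_lat.
have dI : der (fun t => isum (fun p => expR (- (pi * t * latq x y p)))) s (isum (dE s)).
  apply: (@der_isum _ _ (fun v p => expR (- (pi * v * latq x y p))) dE _ 1 (s + 1)
    s _ (asum_lat x half0 y0)).
  - by apply/andP; split; lra.
  - by move=> u /andP[u1 _]; apply: aE; lra.
  - by move=> u j _; rewrite /dE; derive_tac; ring.
  - exact: dEG.
have adE : asum (dE s).
  by apply: asum_le (aE _ half0) => p; apply: dEG; apply/andP; split; lra.
apply: (deriv_eq (deriv_mul (deriv_sqrt s0 (deriv_id s)) dI)).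
have q0 : 0 < Num.sqrt s by rewrite sqrtr_gt0.
have c0 : 0 < pi * s by rewrite mulr_gt0 ?pi_gt0.
have as1 := asum_scalew x c0 y0; have as2 := aE s s0.
rewrite -!isumZ// -isumD; [|exact: asumZ|exact: asumZ].
apply: eq_isum => p; rewrite /scalew /dE mulr1.
rewrite -[in X in 2 * (pi * X * _)](sqr_sqrtr (ltW s0)).
move: (pi : R) (latq _ _ _) (Num.sqrt s) (expR _) q0 => p' l q e q0.
by field; rewrite gt_eqF.
Qed.

(** The bound [62/10] is below [2 pi]. *)
Lemma ntheta_incr_of_scalew x y : 0 < y ->
  (forall c, 62 / 10 <= c ->
    isum (fun p => scalew (c * latq (1 / 2) (hexy R) p)) <=
    isum (fun p => scalew (c * latq x y p))) ->
  forall s s', 2 <= s -> s <= s' ->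
    ntheta s' x y - ntheta s x y <= ntheta s' (1 / 2) (hexy R) - ntheta s (1 / 2) (hexy R).
Proof.
move=> y0 H s s' s2 ss; have h0 : 0 < hexy R by have := hexy_gt R; lra.
pose F a b t := - (2 * Num.sqrt t)^-1 * isum (fun p => scalew (pi * t * latq a b p)).
apply: (@deriv_le_incr R (fun t => ntheta t x y) (fun t => ntheta t (1 / 2) (hexy R))
  (F x y) (F (1 / 2) (hexy R)) s s' ss) => t /andP[st _].
- by apply: der_ntheta => //; lra.
- by apply: der_ntheta => //; lra.
- rewrite /F !mulNr lerN2 ler_wpM2l ?invr_ge0 ?mulr_ge0 ?sqrtr_ge0//.
  apply: H; have p31 := pi_gt31 R.
  have : 31 / 10 * 2 <= pi * t by apply: ler_pM; lra.
  lra.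
Qed.

End Scale.

(** * The hexagonal lattice: its first shell and its tail *)

Section Hexagonal.
Variable R : realType.
Implicit Types (p : int * int).

(** Twice the form [m^2 + m n + n^2], written symmetrically. *)
Definition hexn p : R := p.1%:~R ^+ 2 + p.2%:~R ^+ 2 + (p.1 + p.2)%:~R ^+ 2.

Lemma latq_hex p : latq (1 / 2) (hexy R) p = hexn p / (2 * hexy R).
Proof.
have h0 : hexy R != 0 by have := hexy_gt R => h; rewrite gt_eqF//; lra.
apply: (mulIf h0); rewrite /latq /hexn divfK// intrD.
move: (p.1%:~R : R) (p.2%:~R : R) => m n.
by rewrite exprMn hexy_sqr; move: (hexy R) h0 => h h0; field.
Qed.

Definition first_shell : seq (int * int) :=
  [:: (1, 0); (0, -1); (-1, 1); (-1, 0); (0, 1); (1, -1)].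

(** The form [m^2 + m n + n^2] does not take the value [2]. *)
Lemma hexn_cases p : [\/ p = (0, 0), p \in first_shell | 6 <= hexn p].
Proof.
case: p => m n; rewrite /hexn /=.
have [h|h] := boolP (6 <= m ^+ 2 + n ^+ 2 + (m + n) ^+ 2); first by
  constructor 3; rewrite -!rmorphXn -!rmorphD /= (ler_int R 6).
have nb : -1 <= n <= 1 by nia.
have mb : -1 <= m <= 1 by nia.
have small (k : int) : -1 <= k <= 1 -> [\/ k = -1, k = 0 | k = 1].
  by move=> kb; have [?|?|->] := ltgtP k 0;
    [constructor 1; lia|constructor 3; lia|constructor 2].
by case: (small m mb) h => ->; case: (small n nb) => -> // _;
  first [by constructor 1|by constructor 2].
Qed.

Lemma first_shell_hexn p : p \in first_shell -> hexn p = 2.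
Proof.
by rewrite !inE => /orP[|/orP[|/orP[|/orP[|/orP[]]]]] /eqP ->;
  rewrite /hexn /=; ring.
Qed.

Lemma absz_le_sqr (m : int) : (absz m)%:R <= m%:~R ^+ 2 :> R.
Proof.
rewrite natr_absz -[m in leRHS]/(m) -rmorphXn /= ler_int; nia.
Qed.

Definition geo p : R := (1 / 2) ^+ absz p.1 * (1 / 2) ^+ absz p.2.

Let half01 : 0 <= (1 / 2 : R) < 1. Proof. by apply/andP; split; lra. Qed.

Lemma geo_ge0 p : 0 <= geo p.
Proof. by rewrite mulr_ge0 ?exprn_ge0. Qed.

Lemma asum_geo : asum geo.
Proof. exact: asum_mul (asum_geometric_int half01) (asum_geometric_int half01). Qed.

Lemma isum_geo : isum geo <= 9.
Proof.
have ag := asum_geometric_int half01.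
have S : isum (fun j : int => (1 / 2) ^+ absz j) <= 3 :> R.
  rewrite isum_int//=; under [X in _ + X]eq_isum do rewrite exprS.
  rewrite isumZ; last exact: asum_geometric.
  have h2 : (1 - 1 / 2)^-1 = 2 :> R by field.
  set u := isum (GRing.exp _); have u2 : u <= 2 by rewrite -h2; exact: isum_geometric_le.
  by suff : u + 1 / 2 * u <= 3; [|lra].
rewrite (isum_mul ag ag); apply: (@le_trans _ _ (3 * 3)); last by lra.
by apply: ler_pM => //; apply: isum_ge0 => // j; rewrite exprn_ge0.
Qed.

Definition shellw p : R := (p \in first_shell)%:R.

Let shell_supp p : p \notin [fset x in first_shell]%fset -> shellw p = 0.
Proof.
move=> pX; rewrite /shellw (_ : (p \in first_shell) = false)//; apply/negbTE.
by apply: contra pX => ps; rewrite !inE orbF in ps *.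
Qed.

Lemma asum_shellw : asum shellw.
Proof. exact: asum_fsupp shell_supp. Qed.

Lemma isum_shellw : isum shellw = 6.
Proof.
rewrite (isum_fsupp shell_supp) (perm_big first_shell); last first.
  by apply: uniq_perm (fset_uniq _) _ _ => // p; rewrite !inE orbF.
rewrite big_seq (eq_bigr (fun=> 1)) => [|p ps]; last by rewrite /shellw ps.
rewrite -big_seq.
by rewrite !big_cons big_nil /=; lra.
Qed.

(** With [t > 7] and [hexn p >= 6], the ratio of the exponentials beats both
    [hexn p ^+ 2] and a power of two. *)
Lemma hex_tail_le (t : R) p : 71 / 10 <= t -> 6 <= hexn p ->
  hexn p ^+ 2 * expR (- (t * (hexn p / 2))) <= 1 / 7 * expR (- t) * geo p.
Proof.
move=> t7 N6; set N := hexn p in N6 *.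
have pn : ((absz p.1 + absz p.2)%:R : R) <= N.
  by rewrite natrD /N /hexn -[leLHS]addr0 !lerD ?absz_le_sqr ?sqr_ge0.
have g : expR (- N) <= geo p.
  apply: (le_trans (expRN_le pn)); rewrite /geo -exprD lerXn2r ?nnegrE//; lra.
have N2 : N ^+ 2 <= expR N.
  apply: (@le_trans _ _ (1 + N + N ^+ 2 / 2 + N ^+ 3 / 6)); last by apply: expR_ge_cubic; lra.
  by have : 6 * N ^+ 2 <= N * N ^+ 2 by [rewrite ler_wpM2r ?sqr_ge0]; rewrite (exprS N 2);
    move: (N ^+ 2) (sqr_ge0 N) => q q0; lra.
have e2 : expR (- 2) <= 1 / 7 :> R.
  by have := @expRN_le R 2 2 (lexx _); rewrite expr2; lra.
apply: (@le_trans _ _ (expR N * expR (- (t * (N / 2))))).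
  by rewrite ler_wpM2r ?expR_ge0.
apply: (@le_trans _ _ (expR (- 2) * expR (- t) * expR (- N))); last first.
  by rewrite ler_pM ?mulr_ge0 ?expR_ge0// ler_wpM2r ?expR_ge0.
by rewrite -!expRD ler_expR; nra.
Qed.

Lemma scalew_ge0 (t : R) : 1 / 2 <= t -> 0 <= scalew t.
Proof. by move=> t2; rewrite mulr_ge0 ?expR_ge0//; lra. Qed.

(** [-1] is the term at [0]; the six shortest vectors have argument
    [c / hexy R], and all others add less than a quarter of one of them. *)
Lemma hex_sum_le (c : R) : 71 / 10 <= c / hexy R ->
  isum (fun p => scalew (c * latq (1 / 2) (hexy R) p)) <=
  - 1 + 25 / 4 * scalew (c / hexy R).
Proof.
set t := c / hexy R => t7; have h0 : 0 < hexy R by have := hexy_gt R; lra.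
have c0 : 0 < c by rewrite -(divfK (lt0r_neq0 h0) c) mulr_gt0// -/t; lra.
have st0 : 0 <= scalew t by apply: scalew_ge0; lra.
have ad := asum_delta R ((0, 0) : int * int); have a1 := asumN ad.
have a2 := asumZ (scalew t) asum_shellw; have a3 := asumZ (scalew t / 42) asum_geo.
apply: (@le_trans _ _ (isum (fun p => - (p == (0, 0))%:R + (scalew t * shellw p +
   scalew t / 42 * geo p)))).
  apply: le_isum; [exact: asum_scalew|by apply: asumD => //; exact: asumD|] => p.
  have -> : c * latq (1 / 2) (hexy R) p = t * (hexn p / 2).
    by rewrite latq_hex /t; move: (hexy R) h0 (hexn p) => h h0 N; field; rewrite gt_eqF.
  have g0 : 0 <= scalew t / 42 * geo p by rewrite mulr_ge0 ?geo_ge0//; lra.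
  have [->|ps|N6] := hexn_cases p.
  - have -> : hexn (0, 0) = 0 by rewrite /hexn /=; ring.
    rewrite mul0r mulr0 {1}/scalew oppr0 expR0 eqxx /shellw /= !mulr0.
    have -> : geo (0, 0) = 1 by rewrite /geo /= mulr1.
    by move: st0 {g0 a2 a3}; lra.
  - rewrite first_shell_hexn// divff// mulr1 /shellw ps.
    have -> : (p == (0, 0)) = false.
      by apply/eqP => pE; move: ps; rewrite pE !inE.
    by rewrite oppr0 add0r mulr1 lerDl.
  - have -> : (p == (0, 0)) = false.
      by apply/eqP => pE; move: N6; rewrite pE /hexn /=; lra.
    have sw : 0 <= shellw p by rewrite /shellw.
    have tail := hex_tail_le t7 N6; set N := hexn p in N6 tail *.
    move: (geo p) (geo_ge0 p) g0 tail => g g0 _ tail.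
    apply: (@le_trans _ _ (scalew t / 42 * g)); last first.
      by rewrite oppr0 add0r lerDr mulr_ge0.
    set E := expR (- (t * (N / 2))) in tail *.
    have E0 : 0 <= E by exact: expR_ge0.
    apply: (@le_trans _ _ (t / 6 * (N ^+ 2 * E))).
      rewrite /scalew -/E [leRHS]mulrA ler_wpM2r//.
      have : t * (6 * N) <= t * (N * N) by rewrite ler_wpM2l ?ler_wpM2r//; lra.
      by rewrite (expr2 N) => h; lra.
    apply: (@le_trans _ _ (t / 6 * (1 / 7 * expR (- t) * g))).
      by rewrite ler_wpM2l//; lra.
    rewrite [leLHS]mulrA ler_wpM2r// /scalew.
    have e0 : 0 <= (t - 1) * expR (- t) by rewrite mulr_ge0 ?expR_ge0//; lra.
    by move: (expR (- t)) e0 => e e0; lra.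
rewrite isumD ?isumD ?isumN ?isum_delta ?isumZ ?isum_shellw//;
  [|exact: asum_geo|exact: asum_shellw|exact: asumD].
have g9 := ler_wpM2l st0 isum_geo.
by move: (isum geo) g9 => g g9; lra.
Qed.

End Hexagonal.

(** * The first shell near the hexagonal lattice *)

Section FirstShell.
Variable R : realType.
Implicit Types (a b c d t u x y z : R).

(** Both tangent-line bounds below are instances: the difference with the
    tangent decreases up to the point of contact and increases after it. *)
Lemma deriv_min (f df : R -> R) a b : a <= b -> (forall x, a <= x -> der f x (df x)) ->
  (forall x, a <= x <= b -> df x <= 0) -> (forall x, b <= x -> 0 <= df x) ->
  forall x, a <= x -> f b <= f x.
Proof.
move=> ab fd dn dp x ax; have [xb|/ltW bx] := leP x b.
  rewrite -lerN2; apply: (@deriv_ge0_le R (fun u => - f u) (fun u => - df u)) => // u /andP[xu ub].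
    by apply: deriv_opp; apply: fd; exact: le_trans xu.
  by rewrite oppr_ge0 dn// ub (le_trans ax).
apply: (@deriv_ge0_le R f df) => // u /andP[bu _]; last exact: dp.
by apply: fd; exact: le_trans bu.
Qed.

Lemma der_scalew t : der (@scalew R) t (- ((2 * t - 3) * expR (- t))).
Proof. by rewrite /scalew; derive_tac; ring. Qed.

Lemma der_scalew_dec a b : 5 / 2 <= a -> a <= b ->
  (2 * b - 3) * expR (- b) <= (2 * a - 3) * expR (- a).
Proof.
move=> a5 ab; rewrite -lerN2.
apply: (@deriv_ge0_le R (fun t => - ((2 * t - 3) * expR (- t)))
  (fun t => (2 * t - 5) * expR (- t))) => // t /andP[at_ _].
  by derive_tac; ring.
by rewrite mulr_ge0 ?expR_ge0//; lra.
Qed.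

(** [scalew] is convex on [[5/2, +oo)]. *)
Lemma scalew_tangent t u : 5 / 2 <= t -> 5 / 2 <= u ->
  scalew t - (2 * t - 3) * expR (- t) * (u - t) <= scalew u.
Proof.
move=> t5 u5; set k := (2 * t - 3) * expR (- t).
have : scalew t + k * t <= scalew u + k * u.
  apply: (@deriv_min (fun x => scalew x + k * x)
    (fun x => - ((2 * x - 3) * expR (- x)) + k) (5 / 2) t); [exact: t5| | | |exact: u5].
  - move=> x _; apply: deriv_add; first exact: der_scalew.
    by derive_tac; ring.
  - by move=> x /andP[x5 xt]; have := der_scalew_dec x5 xt; rewrite -/k => h; lra.
  - by move=> x tx; have := der_scalew_dec t5 tx; rewrite -/k => h; lra.
by move=> h; lra.
Qed.

Lemma quartic_dec a b : 27 / 5 <= a -> a <= b ->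
  b ^+ 4 * (2 * b - 3) * expR (- b) <= a ^+ 4 * (2 * a - 3) * expR (- a).
Proof.
move=> a5 ab; rewrite -lerN2.
apply: (@deriv_ge0_le R (fun t => - (t ^+ 4 * (2 * t - 3) * expR (- t)))
  (fun t => t ^+ 3 * (2 * t ^+ 2 - 13 * t + 12) * expR (- t))) => // t /andP[at_ _].
  by derive_tac; rewrite /=; ring.
rewrite mulr_ge0 ?expR_ge0// mulr_ge0 ?exprn_ge0//; first by lra.
by rewrite expr2; nra.
Qed.

(** Beyond [27/5], [scalew] is also convex as a function of [t^-3]: inverse
    cubes turn the comparison of first shells into an algebraic inequality. *)
Lemma scalew_tangent_cube t u : 27 / 5 <= t -> 27 / 5 <= u ->
  scalew t + (2 * t - 3) * t * expR (- t) / 3 * ((t / u) ^+ 3 - 1) <= scalew u.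
Proof.
move=> t5 u5; set k := (2 * t - 3) * t * expR (- t) / 3.
have t0 : 0 < t by lra.
pose dF x := - ((2 * x - 3) * expR (- x)) + k * t ^+ 3 * 3 / x ^+ 4.
have dFE x : 0 < x -> dF x =
    (t ^+ 4 * (2 * t - 3) * expR (- t) - x ^+ 4 * (2 * x - 3) * expR (- x)) / x ^+ 4.
  by move=> x0; rewrite /dF /k; field; rewrite gt_eqF.
have : scalew t - k * t ^+ 3 * t^-1 ^+ 3 <= scalew u - k * t ^+ 3 * u^-1 ^+ 3.
  apply: (@deriv_min (fun x => scalew x - k * t ^+ 3 * x^-1 ^+ 3) dF (27 / 5) t); [exact: t5| | | |exact: u5].
  - move=> x x5; have x0 : x != 0 by rewrite gt_eqF//; lra.
    apply: deriv_add; first exact: der_scalew.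
    apply: (deriv_eq (deriv_opp (deriv_mul (deriv_cst x (k * t ^+ 3))
      (deriv_pow 3 (deriv_inv x0 (deriv_id x)))))).
    by rewrite /=; field.
  - move=> x /andP[x5 xt]; have x0 : 0 < x by lra.
    rewrite dFE// pmulr_lle0 ?invr_gt0 ?exprn_gt0// subr_le0; exact: quartic_dec.
  - move=> x tx; have x0 : 0 < x by lra.
    rewrite dFE// pmulr_lge0 ?invr_gt0 ?exprn_gt0// subr_ge0; exact: quartic_dec.
have -> : k * t ^+ 3 * t^-1 ^+ 3 = k by field; rewrite gt_eqF.
rewrite -mulrA -exprMn => h; apply: le_trans (_ : _ <= scalew t - k + k * (t / u) ^+ 3) _; lra.
Qed.

(** Schur's inequality of degree one. *)
Lemma schur a b c : 0 <= a -> 0 <= b -> 0 <= c ->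
  0 <= (a + b + c) ^+ 3 - 4 * (a + b + c) * (a * b + b * c + c * a) + 9 * (a * b * c).
Proof.
have ord x y z : 0 <= x -> x <= y -> y <= z ->
    0 <= (x + y + z) ^+ 3 - 4 * (x + y + z) * (x * y + y * z + z * x) + 9 * (x * y * z).
  move=> x0 xy yz; have -> : (x + y + z) ^+ 3 - 4 * (x + y + z) * (x * y + y * z + z * x) +
      9 * (x * y * z) = (z - y) ^+ 2 * (z + y - x) + x * ((y - x) * (z - x)) by ring.
  have y0 : 0 <= y := le_trans x0 xy.
  by rewrite addr_ge0// mulr_ge0 ?sqr_ge0 ?mulr_ge0//; lra.
have sym x y z : (x + y + z) ^+ 3 - 4 * (x + y + z) * (x * y + y * z + z * x) +
    9 * (x * y * z) = (a + b + c) ^+ 3 - 4 * (a + b + c) * (a * b + b * c + c * a) +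
    9 * (a * b * c) -> 0 <= x -> x <= y -> y <= z ->
    0 <= (a + b + c) ^+ 3 - 4 * (a + b + c) * (a * b + b * c + c * a) + 9 * (a * b * c).
  by move=> <-; exact: ord.
have [ab|/ltW ab] := leP a b; have [bc|/ltW bc] := leP b c; have [ac|/ltW ac] := leP a c;
  move=> a0 b0 c0.
- by apply: (sym a b c).
- by apply: (sym a b c).
- by apply: (sym a c b) => //; ring.
- by apply: (sym c a b) => //; ring.
- by apply: (sym b a c) => //; ring.
- by apply: (sym b c a) => //; ring.
- by apply: (sym c b a) => //; ring.
- by apply: (sym c b a) => //; ring.
Qed.

Lemma shell_cubic_dec (g e m t : R) : 0 <= g -> 0 <= t -> t <= m -> 2 * m <= g * e ->
  (2 + g) * m ^+ 3 <= e ^+ 3 - 9 * g * e * m + 3 * m ^+ 2 ->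
  (2 + g) * t ^+ 3 <= e ^+ 3 - 9 * g * e * t + 3 * t ^+ 2.
Proof.
move=> g0 t0 tm me H; rewrite -subr_ge0 in H; rewrite -subr_ge0; apply: (le_trans H).
rewrite -subr_ge0 (_ : _ - _ = (m - t) *
  (9 * (g * e) - 3 * (m + t) + (2 + g) * (m ^+ 2 + m * t + t ^+ 2))); last by ring.
have m0 : 0 <= m := le_trans t0 tm.
have h : 0 <= (2 + g) * (m ^+ 2 + m * t + t ^+ 2).
  by rewrite mulr_ge0 ?addr_ge0 ?sqr_ge0 ?mulr_ge0//; lra.
by move: (g * e) ((2 + g) * _) me h => ge q me h; rewrite mulr_ge0//; lra.
Qed.

(** With [g = 2/3 (a + b + c)] and [t = (b + c) (c + a) (a + b)] in
    [inv_cube_sum], the two upper bounds for [t] come from Schur's inequality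
    and from [0 <= a b c]; they agree at [g^2 = 4/3]. As [g^3 (2 + g)] is at
    most [g^2 + 2 g^4], both cases are polynomial inequalities in [g^2]. *)
Lemma shell_poly (g t : R) : 1 <= g -> 0 <= t -> t <= g * (5 + 3 * g ^+ 2) / 8 ->
  t <= 9 / 8 * g ->
  (2 + g) * t ^+ 3 <= (3 / 4 * (1 + 3 * g ^+ 2)) ^+ 3 -
    9 * g * (3 / 4 * (1 + 3 * g ^+ 2)) * t + 3 * t ^+ 2.
Proof.
move=> g1 t0 t1 t2; have g0 : 0 <= g by lra.
have d1 : 1 <= g ^+ 2 by rewrite expr_ge1.
have amgm : (2 + g) * g ^+ 3 <= g ^+ 2 + 2 * (g ^+ 2) ^+ 2.
  have : 0 <= g ^+ 2 * (g - 1) ^+ 2 by rewrite mulr_ge0 ?sqr_ge0.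
  rewrite (_ : g ^+ 2 * (g - 1) ^+ 2 =
    g ^+ 2 + 2 * (g ^+ 2) ^+ 2 - (2 + g) * g ^+ 3); last by ring.
  by rewrite subr_ge0.
have [d2|/ltW d2] := leP (g ^+ 2) (4 / 3).
  apply: (shell_cubic_dec g0 t0 t1).
    have : g * (5 + 3 * g ^+ 2) <= g * 9 by rewrite ler_wpM2l//; lra.
    have : g * 4 <= g * (1 + 3 * g ^+ 2) by rewrite ler_wpM2l//; lra.
    by move: (g ^+ 2) => d h1 h2; lra.
  rewrite (_ : (2 + g) * (g * (5 + 3 * g ^+ 2) / 8) ^+ 3 =
    (2 + g) * g ^+ 3 * ((5 + 3 * g ^+ 2) / 8) ^+ 3); last by ring.
  apply: (le_trans (ler_wpM2r _ amgm)); first by rewrite exprn_ge0//; lra.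
  have -> : 9 * g * (3 / 4 * (1 + 3 * g ^+ 2)) * (g * (5 + 3 * g ^+ 2) / 8) =
    27 / 4 * g ^+ 2 * (1 + 3 * g ^+ 2) * ((5 + 3 * g ^+ 2) / 8) by field.
  rewrite (_ : (g * (5 + 3 * g ^+ 2) / 8) ^+ 2 =
    g ^+ 2 * ((5 + 3 * g ^+ 2) / 8) ^+ 2); last by ring.
  move: (g ^+ 2) d1 d2 => d d1 d2.
  have [e eE] : exists e, d = 1 + e by exists (d - 1); ring.
  have e0 : 0 <= e by lra. have e3 : e <= 1 / 3 by lra.
  rewrite eE -subr_ge0 (_ : _ - _ =
    e * (128 + 704 * e - 153 * e ^+ 2 - 567 * e ^+ 3 - 54 * e ^+ 4) / 512); last by lra.
  apply: divr_ge0; last by lra.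
  apply: mulr_ge0; first exact: e0.
  have e2 : e ^+ 2 <= 1 by rewrite exprn_ile1//; lra.
  have e3' : e ^+ 3 <= 1 / 3 * (1 / 3).
    rewrite exprS (le_trans (ler_wpM2l e0 (_ : e ^+ 2 <= 1 / 3)))//; last by lra.
    by rewrite expr2; nra.
  have e4 : e ^+ 4 <= 1 by rewrite exprn_ile1//; lra.
  have e2' : e ^+ 2 <= 1 / 3 * e by rewrite expr2; nra.
  by lra.
apply: (shell_cubic_dec g0 t0 t2).
  have : g * 5 <= g * (1 + 3 * g ^+ 2) by rewrite ler_wpM2l//; lra.
  by move: (g ^+ 2) => d h1; lra.
rewrite (_ : (2 + g) * (9 / 8 * g) ^+ 3 = (2 + g) * g ^+ 3 * (9 / 8) ^+ 3); last by ring.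
apply: (le_trans (ler_wpM2r _ amgm)); first by rewrite exprn_ge0//; lra.
have -> : 9 * g * (3 / 4 * (1 + 3 * g ^+ 2)) * (9 / 8 * g) =
    243 / 32 * g ^+ 2 * (1 + 3 * g ^+ 2) by field.
rewrite (_ : (9 / 8 * g) ^+ 2 = 81 / 64 * g ^+ 2); last by field.
move: (g ^+ 2) d1 d2 => d d1 d2.
have [e eE] : exists e, d = 4 / 3 + e by exists (d - 4 / 3); ring.
have e0 : 0 <= e by lra.
rewrite eE -subr_ge0 (_ : _ - _ =
  27 / 512 * (4 + 405 * e + 594 * e ^+ 2 + 216 * e ^+ 3)); last by lra.
have e2 : 0 <= e ^+ 2 by exact: exprn_ge0.
have e3 : 0 <= e ^+ 3 by exact: exprn_ge0.
by lra.
Qed.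

Lemma trace_ge a b c : a * b + b * c + c * a = 3 / 4 -> 0 <= a + b + c ->
  3 / 2 <= a + b + c.
Proof.
move=> e2 S0; have S2 : 9 / 4 <= (a + b + c) ^+ 2.
  have := sqr_ge0 (a - b); have := sqr_ge0 (b - c); have := sqr_ge0 (c - a).
  rewrite (_ : (a + b + c) ^+ 2 = a ^+ 2 + b ^+ 2 + c ^+ 2 + 2 * (a * b + b * c + c * a));
    last by ring.
  by rewrite e2 !sqrrB; move: e2; lra.
rewrite leNgt; apply/negP => S3.
have : (a + b + c) * (a + b + c) < 3 / 2 * (3 / 2) by apply: ltr_pM.
by rewrite -expr2; lra.
Qed.

(** In terms of the elementary symmetric functions, the sum of the cubes of
    [1/x], [1/y], [1/z] is [(e2^3 - 3 e1 e2 e3 + 3 e3^2) / e3^3]; at fixed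
    [e1] and [e2] it decreases with [e3], which Schur's inequality bounds. *)
Lemma inv_cube_sum a b c : 0 <= a -> 0 <= b -> 0 <= c ->
  a * b + b * c + c * a = 3 / 4 ->
  2 + 2 / 3 * (a + b + c) <= (b + c)^-1 ^+ 3 + (c + a)^-1 ^+ 3 + (a + b)^-1 ^+ 3.
Proof.
move=> a0 b0 c0 e2; set S := a + b + c.
have Sg : 3 / 2 <= S by apply: trace_ge => //; rewrite !addr_ge0.
have Sa : 3 / 4 <= S * (b + c) by rewrite -e2 /S -subr_ge0 (_ : _ - _ = (b + c) ^+ 2 - b * c); [nra|ring].
have Sb : 3 / 4 <= S * (c + a) by rewrite -e2 /S -subr_ge0 (_ : _ - _ = (c + a) ^+ 2 - c * a); [nra|ring].
have Sc : 3 / 4 <= S * (a + b) by rewrite -e2 /S -subr_ge0 (_ : _ - _ = (a + b) ^+ 2 - a * b); [nra|ring].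
have S0 : 0 < S by lra.
have pos u : 3 / 4 <= S * u -> 0 < u by move=> h; rewrite -(pmulr_rgt0 _ S0); lra.
have x0 := pos _ Sa; have y0 := pos _ Sb; have z0 := pos _ Sc.
set t := (b + c) * (c + a) * (a + b).
have t0 : 0 < t by rewrite !mulr_gt0.
have tE : t = 3 / 4 * S - a * b * c by rewrite -e2 /t /S; ring.
have abc0 : 0 <= a * b * c by rewrite !mulr_ge0.
have sch := schur a0 b0 c0; rewrite -/S e2 in sch.
have g1 : 1 <= 2 / 3 * S by lra.
have P := @shell_poly (2 / 3 * S) t g1 (ltW t0).
have -> : (b + c)^-1 ^+ 3 + (c + a)^-1 ^+ 3 + (a + b)^-1 ^+ 3 =
    (((c + a) * (a + b)) ^+ 3 + ((b + c) * (a + b)) ^+ 3 + ((b + c) * (c + a)) ^+ 3) / t ^+ 3.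
  by rewrite /t; field; rewrite !gt_eqF.
rewrite ler_pdivlMr ?exprn_gt0//.
have -> : ((c + a) * (a + b)) ^+ 3 + ((b + c) * (a + b)) ^+ 3 + ((b + c) * (c + a)) ^+ 3 =
    (S ^+ 2 + (a * b + b * c + c * a)) ^+ 3 -
    6 * S * (S ^+ 2 + (a * b + b * c + c * a)) * t + 3 * t ^+ 2 by rewrite /S /t; ring.
rewrite e2.
have eE : S ^+ 2 + 3 / 4 = 3 / 4 * (1 + 3 * (2 / 3 * S) ^+ 2) by field.
rewrite eE (_ : 6 * S = 9 * (2 / 3 * S)); last by field.
apply: P; rewrite tE; last by lra.
rewrite (_ : 2 / 3 * S * (5 + 3 * (2 / 3 * S) ^+ 2) / 8 = 5 / 12 * S + S ^+ 3 / 9);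
  last by field.
by move: (S ^+ 3) (a * b * c) sch => S3 abc sch; lra.
Qed.

End FirstShell.

(** * Elongated lattices *)

Section Line.
Variable R : realType.
Implicit Types (r t : R).

Lemma isum_geometric_int_le r : 0 <= r < 1 ->
  isum (fun j : int => r ^+ absz j) <= (1 + r) / (1 - r).
Proof.
move=> r01; have /andP[r0 r1] := r01.
rewrite isum_int; last exact: asum_geometric_int.
rewrite /=; under [X in _ + X]eq_isum do rewrite exprS.
rewrite isumZ; last exact: asum_geometric.
set u := isum (GRing.exp _).
have u2 : u <= (1 - r)^-1 by exact: isum_geometric_le.
suff : u + r * u <= (1 + r) / (1 - r) by [].
rewrite (_ : u + r * u = (1 + r) * u); last by ring.
by rewrite ler_wpM2l// addr_ge0.
Qed.

Lemma asum_scalew_int t : 0 < t -> asum (fun j : int => scalew (pi * t * j%:~R ^+ 2)).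
Proof.
move=> t0; have c0 : 0 < pi * t / 2 by rewrite !mulr_gt0 ?pi_gt0.
apply: asum_le (asumZ 3 (asum_gauss 0 c0)) => j.
apply: (le_trans (norm_scalew_le _)).
  by rewrite mulr_ge0 ?sqr_ge0// mulr_ge0 ?pi_ge0 ?ltW.
by rewrite add0r ler_wpM2l// mulrAC.
Qed.

(** The two sides of Poisson's formula at [x = 0] are differentiated; both
    derivatives are dominated on [(t / 2, 2 t)] by Gaussian sums. *)
Lemma der_line_direct t : 0 < t ->
  der (fun u => Num.sqrt u * isum (fun j : int => expR (- (pi * u * j%:~R ^+ 2)))) t
    (- (2 * Num.sqrt t)^-1 * isum (fun j : int => scalew (pi * t * j%:~R ^+ 2))).
Proof.
move=> t0; pose dE v (j : int) := expR (- (pi * v * j%:~R ^+ 2)) * - (pi * j%:~R ^+ 2 : R).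
have h0 : 0 < pi * t / 4 by rewrite !mulr_gt0 ?pi_gt0.
have aE (u : R) : 0 < u -> asum (fun j : int => expR (- (pi * u * j%:~R ^+ 2))).
  move=> u0; have p0 : 0 < pi * u by rewrite mulr_gt0 ?pi_gt0.
  by apply: eq_asum (asum_gauss 0 p0) => j; rewrite add0r.
have dEG u j : t / 2 < u < 2 * t ->
    `|dE u j| <= 2 / t * expR (- (pi * t / 4 * (0 + j%:~R) ^+ 2)).
  move=> /andP[tu _]; have u0 : 0 < u by lra.
  have q0 : 0 <= pi * j%:~R ^+ 2 :> R by rewrite mulr_ge0 ?pi_ge0 ?sqr_ge0.
  rewrite /dE add0r mulrN normrN (ger0_norm (mulr_ge0 (expR_ge0 _) q0)).
  move: (j%:~R ^+ 2) q0 => l.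
  rewrite (_ : pi * u * l = u * (pi * l)); last by rewrite mulrA (mulrC u).
  rewrite (_ : pi * t / 4 * l = t * (pi * l) / 4); last by rewrite mulrAC (mulrC pi) -!mulrA.
  move: (pi * l) => q q0; have uq : 0 <= u * q by rewrite mulr_ge0// ltW.
  have h := le_expR_half uq.
  have h1 : expR (- (u * q / 2)) <= expR (- (t * q / 4)).
    rewrite ler_expR lerN2; have : t / 2 * q <= u * q by rewrite ler_wpM2r// ltW.
    by lra.
  have e0 := expR_ge0 (- (u * q)).
  rewrite mulrC mulrAC ler_pdivlMr//; apply: (@le_trans _ _ (2 * (u * q * expR (- (u * q))))).
    have : t * (q * expR (- (u * q))) <= 2 * u * (q * expR (- (u * q))).
      by rewrite ler_wpM2r ?mulr_ge0//; lra.
    by move: (expR _) => e; lra.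
  by rewrite ler_wpM2l// (le_trans h).
have adG := asumZ (2 / t) (asum_gauss 0 h0).
have tt : t / 2 < t < 2 * t by apply/andP; split; lra.
have dI : der (fun u => isum (fun j : int => expR (- (pi * u * j%:~R ^+ 2)))) t (isum (dE t)).
  apply: (@der_isum _ _ (fun v (j : int) => expR (- (pi * v * j%:~R ^+ 2))) dE _ (t / 2)
    (2 * t) t tt adG).
  - by move=> u /andP[u1 _]; apply: aE; lra.
  - by move=> u j _; rewrite /dE; derive_tac; ring.
  - exact: dEG.
have adE : asum (dE t) by apply: asum_le adG => j; exact: dEG.
apply: (deriv_eq (deriv_mul (deriv_sqrt t0 (deriv_id t)) dI)).
have as1 := asum_scalew_int t0; have as2 := aE t t0.
have q0 : 0 < Num.sqrt t by rewrite sqrtr_gt0.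
rewrite -!isumZ// -isumD; [|exact: asumZ|exact: asumZ].
apply: eq_isum => j; rewrite /scalew /dE mulr1.
rewrite -[in X in 2 * (pi * X * _)](sqr_sqrtr (ltW t0)).
move: (pi : R) (j%:~R ^+ 2) (Num.sqrt t) (expR _) q0 => p' l q e q0.
by field; rewrite gt_eqF.
Qed.

Let dual v (k : int) : R := pi * k%:~R ^+ 2 / v ^+ 2 * expR (- (pi / v * k%:~R ^+ 2)).

Lemma der_line_dual t : 0 < t ->
  asum (dual t) /\
  der (fun u => isum (fun k : int => expR (- (pi / u * k%:~R ^+ 2)))) t (isum (dual t)).
Proof.
move=> t0; have h0 : 0 < pi / (4 * t) by rewrite divr_gt0 ?pi_gt0 ?mulr_gt0.
have aE (u : R) : 0 < u -> asum (fun j : int => expR (- (pi / u * j%:~R ^+ 2))).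
  move=> u0; have p0 : 0 < pi / u by rewrite divr_gt0 ?pi_gt0.
  by apply: eq_asum (asum_gauss 0 p0) => j; rewrite add0r.
have dG u k : t / 2 < u < 2 * t ->
    `|dual u k| <= 2 / t * expR (- (pi / (4 * t) * (0 + k%:~R) ^+ 2)).
  move=> /andP[tu ut]; have u0 : 0 < u by lra.
  have q0 : 0 <= pi * k%:~R ^+ 2 :> R by rewrite mulr_ge0 ?pi_ge0 ?sqr_ge0.
  rewrite /dual add0r.
  move: (k%:~R ^+ 2) q0 => l.
  rewrite (_ : pi / u * l = pi * l / u); last by rewrite mulrAC.
  rewrite (_ : pi / (4 * t) * l = pi * l / (4 * t)); last by rewrite mulrAC.
  move: (pi * l) => q q0; have uq : 0 <= q / u by rewrite divr_ge0// ltW.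
  rewrite ger0_norm; last by rewrite mulr_ge0 ?expR_ge0// divr_ge0 ?sqr_ge0.
  have h := le_expR_half uq.
  have h1 : expR (- (q / u / 2)) <= expR (- (q / (4 * t))).
    rewrite ler_expR lerN2 -mulrA -invfM ler_wpM2l// lef_pV2 ?posrE//; lra.
  rewrite (_ : q / u ^+ 2 * _ = u^-1 * (q / u * expR (- (q / u)))); last by field; rewrite gt_eqF.
  apply: ler_pM.
  - by rewrite invr_ge0 ltW.
  - by rewrite mulr_ge0 ?expR_ge0.
  - by rewrite -[leRHS]invf_div lef_pV2 ?posrE ?divr_gt0// ltW.
  - exact: le_trans h h1.
have adG := asumZ (2 / t) (asum_gauss 0 h0).
have tt : t / 2 < t < 2 * t by apply/andP; split; lra.
split; first by apply: asum_le adG => j; exact: dG.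
apply: (@der_isum _ _ (fun v (j : int) => expR (- (pi / v * j%:~R ^+ 2))) dual _ (t / 2)
    (2 * t) t tt adG).
- by move=> u /andP[u1 _]; apply: aE; lra.
- move=> u j /andP[u1 _]; rewrite /dual; derive_tac; first by rewrite gt_eqF//; lra.
  have u0 : u != 0 by rewrite gt_eqF//; lra.
  move: (pi : R) (j%:~R ^+ 2) (expR _) => p' l e; by field.
- exact: dG.
Qed.


(** By Poisson summation, the sum is the scale derivative of the dual Gaussian
    sum, whose terms other than the constant one are small. *)
Lemma line_sum_ge (tau : R) : 0 < tau <= 1 ->
  - (7 / 10) <= isum (fun j : int => scalew (tau * j%:~R ^+ 2)).
Proof.
move=> /andP[tau0 tau1]; have p31 := pi_gt31 R; have p0 := pi_gt0 R.
pose t : R := tau / pi; have t0 : 0 < t by rewrite divr_gt0.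
have ptE : pi * t = tau by rewrite /t mulrC divfK// gt_eqF.
have [adual dd] := der_line_dual t0; have dl := der_line_direct t0.
have near_pos : \forall u \near t, 0 < u by exact: lt_nbhsr.
have eq_near : \forall u \near t,
    isum (fun k : int => expR (- (pi / u * k%:~R ^+ 2))) =
    Num.sqrt u * isum (fun j : int => expR (- (pi * u * j%:~R ^+ 2))).
  apply: filterS near_pos => u u0; have := poisson_gauss 0 u0.
  under eq_isum do rewrite add0r; move=> ->.
  rewrite mulrA divff ?mul1r ?gt_eqF ?sqrtr_gt0//.
  by apply: eq_isum => k; rewrite mulr0 cos0 mulr1.
have [_ e1] := near_eq_is_derive eq_near dd.
have [_ e2] := dl; move: e1; rewrite e2.
have q0 : 0 < Num.sqrt t by rewrite sqrtr_gt0.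
under eq_isum do rewrite ptE.
set s1 := isum _; set s2 := isum _ => e.
have -> : s1 = - (2 * Num.sqrt t * s2).
  by rewrite -e; move: (Num.sqrt t) q0 => q q0; field; rewrite gt_eqF.
rewrite lerN2 /s2 -isumZ//.
pose r : R := (10 / 27) ^+ 4; have r01 : 0 <= r < 1.
  by rewrite exprn_ge0//= exprn_ilt1//; lra.
have ar := asum_geometric_int r01.
have adel := asum_delta R (0 : int).
apply: (@le_trans _ _ (isum (fun j : int => 16 * (r ^+ absz j - (j == 0)%:R)))).
  apply: le_isum; [exact: asumZ|by apply: asumZ; exact: asumB|] => k.
  have [->|kn0] := eqVneq k 0; first by rewrite /dual expr0n/= mulr0 !mul0r mulr0 subrr mulr0.
  rewrite subr0 /dual; set u := pi / t * k%:~R ^+ 2.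
  have k1 : 1 <= k%:~R ^+ 2 :> R.
    by rewrite -rmorphXn (ler_int R 1); move: kn0; nia.
  have tp : t <= 1 / pi by rewrite /t ler_wpM2r ?invr_ge0 ?pi_ge0.
  have it : pi <= t^-1 by rewrite -[pi]invrK lef_pV2 ?posrE ?invr_gt0// -[leRHS]mul1r.
  have u1 : t^-1 <= u.
    rewrite /u -[leLHS]mulr1 (mulrC pi) -mulrA ler_pM2l ?invr_gt0//.
    by apply: (@le_trans _ _ (pi * 1)); [lra|rewrite ler_pM2l].
  have u9 : 8 * (absz k)%:R <= u.
    have kk : (absz k)%:R <= k%:~R ^+ 2 :> R by exact: absz_le_sqr.
    have pt : 9 <= pi / t.
      by apply: (@le_trans _ _ (3 * 3)); [lra|apply: ler_pM; lra].
    rewrite /u; apply: (@le_trans _ _ (9 * k%:~R ^+ 2)); first by lra.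
    by rewrite ler_wpM2r ?sqr_ge0.
  have u0 : 0 <= u by apply: le_trans u1; rewrite invr_ge0 ltW.
  have qt : Num.sqrt t / t <= u.
    apply: le_trans u1; rewrite ler_piMl ?invr_ge0 ?(ltW t0)//.
    rewrite -sqrtr1 ler_sqrt//; apply: (le_trans tp).
    by rewrite ler_pdivrMr// mul1r; lra.
  rewrite (_ : 2 * Num.sqrt t * _ = 2 * (Num.sqrt t / t) * (u * expR (- u))); last first.
    by rewrite /u; move: (pi : R) (Num.sqrt t) (expR _) => p q e'; field; rewrite gt_eqF.
  apply: (@le_trans _ _ (2 * u * (u * expR (- u)))).
    by apply: ler_wpM2r; [rewrite mulr_ge0 ?expR_ge0|apply: ler_wpM2l].
  have u2 : 0 <= u / 2 by lra.
  have eh := expR_ge_quad u2.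
  apply: (@le_trans _ _ (16 * expR (- (u / 2)))).
    rewrite (_ : - u = - (u / 2) + - (u / 2)); last by lra.
    rewrite expRD; have ee : expR (u / 2) * expR (- (u / 2)) = 1.
      by rewrite -expRD subrr expR0.
    have e0 := expR_ge0 (- (u / 2)).
    apply: (@le_trans _ _ (16 * (expR (u / 2) * expR (- (u / 2))) * expR (- (u / 2)))).
      rewrite (_ : 2 * u * (u * _) = 2 * u ^+ 2 * expR (- (u / 2)) * expR (- (u / 2))); last by ring.
      rewrite ler_wpM2r// mulrA ler_wpM2r//.
      by move: eh; rewrite expr_div_n; move: (expR _) (u ^+ 2) => e' q; lra.
    by rewrite ee mulr1.
  rewrite ler_wpM2l// -exprM; apply: expRN_le; rewrite natrM; lra.
rewrite isumZ ?isumB//; last exact: asumB.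
rewrite isum_delta.
have := isum_geometric_int_le r01; move: (isum _) => g g1.
have r2 : r <= 1 / 52 by rewrite /r !exprS expr0; lra.
have : (1 + r) / (1 - r) <= 53 / 51 by rewrite ler_pdivrMr; lra.
by move=> /(le_trans g1) {}g1; lra.
Qed.

End Line.

(** * Large scales *)

Section LargeScale.
Variable R : realType.
Implicit Types (p : int * int).

Definition rot p : int * int := (p.2, - (p.1 + p.2)).

Lemma rot_bij : bijective rot.
Proof.
exists (fun p => (- (p.1 + p.2), p.1)) => -[m n]; rewrite /rot /=.
  by congr pair; ring.
by congr pair; ring.
Qed.

Lemma hexn_rot p : hexn R (rot p) = hexn R p.
Proof. by rewrite /hexn /rot /= !(intrD, rmorphN); ring. Qed.

Lemma isum_orbit (g : int * int -> R) : asum g ->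
  isum (fun p => g p + g (rot p) + g (rot (rot p))) = 3 * isum g.
Proof.
move=> ag; have a1 := reindex_asum rot_bij ag; have a2 := reindex_asum rot_bij a1.
rewrite isumD ?isumD//; last exact: asumD.
rewrite (reindex_isum (fun p => g (rot p)) rot_bij) (reindex_isum g rot_bij).
by move: (isum _) => u; ring.
Qed.

Lemma scalew_dec (a b : R) : 3 / 2 <= a -> a <= b -> scalew b <= scalew a.
Proof.
move=> a3 ab; rewrite -lerN2.
apply: (@deriv_ge0_le R (fun t => - scalew t) (fun t => (2 * t - 3) * expR (- t))) => // t /andP[at_ _].
  by apply: (deriv_eq (deriv_opp (der_scalew t))); ring.
by rewrite mulr_ge0 ?expR_ge0//; lra.
Qed.

Lemma scalew_inc (a b : R) : a <= b -> b <= 3 / 2 -> scalew a <= scalew b.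
Proof.
move=> ab b3.
apply: (@deriv_ge0_le R (fun t => scalew t) (fun t => (3 - 2 * t) * expR (- t))) => // t /andP[_ tb].
  by apply: (deriv_eq (der_scalew t)); ring.
by rewrite mulr_ge0 ?expR_ge0//; lra.
Qed.

(** The first shell gains linearly in [eta = 2 / 3 * (a + b + c) - 1], the
    relative excess of the trace of the form over its hexagonal minimum. *)
Lemma shell_sum_ge (t a b c : R) : 0 <= a -> 0 <= b -> 0 <= c ->
  a * b + b * c + c * a = 3 / 4 -> 27 / 5 <= t ->
  27 / 5 <= t * (b + c) -> 27 / 5 <= t * (c + a) -> 27 / 5 <= t * (a + b) ->
  3 * scalew t + (2 * t - 3) * t * expR (- t) / 3 * (2 / 3 * (a + b + c) - 1) <=
  scalew (t * (b + c)) + scalew (t * (c + a)) + scalew (t * (a + b)).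
Proof.
move=> a0 b0 c0 e2 t5 ta tb tc; have t0 : 0 < t by lra.
have E (u : R) : t / (t * u) = u^-1 by rewrite invfM mulrA divff ?mul1r// gt_eqF.
have := scalew_tangent_cube t5 ta; have := scalew_tangent_cube t5 tb.
have := scalew_tangent_cube t5 tc; rewrite !E.
have k0 : 0 <= (2 * t - 3) * t * expR (- t) / 3.
  by rewrite divr_ge0// mulr_ge0 ?expR_ge0// mulr_ge0//; lra.
have := ler_wpM2l k0 (inv_cube_sum a0 b0 c0 e2).
move: ((2 * t - 3) * t * expR (- t) / 3) ((b + c)^-1 ^+ 3) ((c + a)^-1 ^+ 3) ((a + b)^-1 ^+ 3).
by move=> k u v w h1 h2 h3 h4; lra.
Qed.

Lemma tail_sum_ge (t0 u v w e : R) : 5 / 2 <= t0 -> 5 / 2 <= u -> 5 / 2 <= v ->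
  5 / 2 <= w -> u + v + w = 3 * t0 * (1 + e) ->
  3 * scalew t0 - 3 * (2 * t0 - 3) * t0 * expR (- t0) * e <=
  scalew u + scalew v + scalew w.
Proof.
move=> t5 u5 v5 w5 S.
have := scalew_tangent t5 u5; have := scalew_tangent t5 v5; have := scalew_tangent t5 w5.
set k := (2 * t0 - 3) * expR (- t0) => h1 h2 h3.
have -> : 3 * (2 * t0 - 3) * t0 * expR (- t0) * e = k * (u + v + w - 3 * t0).
  by rewrite S /k; ring.
by lra.
Qed.

Lemma tail_loss_le (t N e E g : R) : 0 <= t -> 0 <= N -> 0 <= e -> 0 <= E ->
  N ^+ 2 * E <= 1 / 7 * expR (- t) * g ->
  3 * (2 * (t * (N / 2)) - 3) * (t * (N / 2)) * E * e <=
  e * expR (- t) * (3 / 14 * t ^+ 2) * g.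
Proof.
move=> t0 N0 e0 E0 h.
apply: (@le_trans _ _ (e * (3 / 2 * t ^+ 2) * (N ^+ 2 * E))).
  rewrite -subr_ge0 (_ : _ - _ = 9 / 2 * (t * N * E * e)); last by field.
  by rewrite !mulr_ge0.
rewrite (_ : e * expR (- t) * _ * g = e * (3 / 2 * t ^+ 2) * (1 / 7 * expR (- t) * g));
  last by field.
by rewrite ler_wpM2l// mulr_ge0// mulr_ge0// sqr_ge0.
Qed.

(** The six vectors of the first shell gain more than all others can lose. *)
Lemma shell_gain_ge (t g : R) : 71 / 10 <= t -> g <= 9 ->
  0 <= (2 * t - 3) * t / 3 * 6 - 3 / 14 * t ^+ 2 * g.
Proof.
move=> t7 g9; have t0 : 0 <= t by lra.
rewrite (_ : _ - _ = t * (4 * t - 6 - 3 / 14 * (t * g))); last by field.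
have : t * g <= t * 9 by rewrite ler_wpM2l.
by move: (t * g) => u tg; rewrite mulr_ge0//; lra.
Qed.

Section Reduced.
Variables x y c : R.

(** The fundamental domain of [reduction]. *)
Definition reduced : Prop := [/\ 0 <= x, x <= 1 / 2, 1 <= x ^+ 2 + y ^+ 2 & 0 < y].

Lemma reduced_im_ge : reduced -> hexy R <= y.
Proof.
case=> x0 x2 xy1 y0.
have h2 := hexy_sqr R; have h0 : 0 <= hexy R by rewrite divr_ge0 ?sqrtr_ge0.
rewrite -(ler_sqr h0 (ltW y0)) h2.
have xx : x ^+ 2 <= 1 / 2 * (1 / 2) by rewrite expr2; apply: ler_pM.
by move: (x ^+ 2) (y ^+ 2) xx xy1 => u v; lra.
Qed.

(** [y] times the form, minus [(1 - 2 x) (m^2 + n^2) + 2 x (m^2 + m n + n^2)],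
    is a nonnegative multiple of [m^2]. *)
Lemma latq_reduced_ge p : reduced -> p != (0, 0) -> y^-1 <= latq x y p.
Proof.
case=> x0 x2 xy1 y0 pn0; rewrite /latq -[leLHS]mul1r ler_wpM2r ?invr_ge0 ?(ltW y0)//.
have n1 : 1 <= p.1%:~R ^+ 2 + p.2%:~R ^+ 2 :> R.
  rewrite -!rmorphXn -rmorphD (ler_int R 1) /=.
  by case: p pn0 => m n; rewrite -pair_eqE /= negb_and => /orP[] ?; nia.
have n2 : 2 <= hexn R p.
  have [p0|/(first_shell_hexn R) ->//|] := hexn_cases R p; last by lra.
  by rewrite p0 eqxx in pn0.
move: n1 n2; rewrite /hexn intrD; move: (p.1%:~R : R) (p.2%:~R : R) => m n n1 n2.
have h1 : 0 <= (1 - 2 * x) * (m ^+ 2 + n ^+ 2 - 1) by rewrite mulr_ge0//; lra.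
have h2 : 0 <= x * (m ^+ 2 + n ^+ 2 + (m + n) ^+ 2 - 2) by rewrite mulr_ge0//; lra.
have h3 : 0 <= m ^+ 2 * (x ^+ 2 + y ^+ 2 - 1) by rewrite mulr_ge0 ?sqr_ge0//; lra.
rewrite -subr_ge0 (_ : _ - _ = m ^+ 2 * (x ^+ 2 + y ^+ 2 - 1) +
  (1 - 2 * x) * (m ^+ 2 + n ^+ 2 - 1) + x * (m ^+ 2 + n ^+ 2 + (m + n) ^+ 2 - 2)); last by ring.
by rewrite !addr_ge0.
Qed.

Hypothesis c6 : 62 / 10 <= c.

Lemma hex_scale_ge : 71 / 10 <= c / hexy R.
Proof.
have hg := hexy_gt R; have hl := hexy_lt R; have c6' := c6.
by rewrite ler_pdivlMr; lra.
Qed.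

Let asz : 0 < y -> asum (fun p => scalew (c * latq x y p)).
Proof. by move=> y0; apply: asum_scalew => //; apply: lt_le_trans c6; lra. Qed.

(** The two vectors [+-1], of squared length [1 / y], outweigh all nonzero vectors of
    the hexagonal lattice. *)
Lemma scalew_sum_mid : reduced -> 1 <= c / y -> c / y <= 27 / 5 ->
  isum (fun p => scalew (c * latq (1 / 2) (hexy R) p)) <=
  isum (fun p => scalew (c * latq x y p)).
Proof.
move=> red cy1 cy5; have y0 : 0 < y by case: red.
have t7 := hex_scale_ge; apply: (le_trans (hex_sum_le t7)).
have c0 : 0 < c by apply: lt_le_trans c6; lra.
have small : 25 / 4 * scalew (c / hexy R) <= 2 * scalew (c / y).
  have e17 : expR (- (17 / 10)) <= 21 / 100 :> R.
    have t0 : 0 <= 17 / 10 :> R by lra.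
    rewrite expRN -[leRHS]invrK lef_pV2 ?posrE ?expR_gt0//.
    apply: le_trans (expR_ge_cubic t0); rewrite !exprS expr0.
    by rewrite invf_div; lra.
  have s7 : scalew (c / hexy R) <= 132 / 10 * expR (- (71 / 10)).
    have -> : 132 / 10 * expR (- (71 / 10)) = scalew (71 / 10) :> R by rewrite /scalew; congr (_ * _); lra.
    by apply: scalew_dec => //; lra.
  have [t3|/ltW t3] := leP (c / y) (3 / 2).
    have : scalew 1 <= scalew (c / y) by apply: scalew_inc.
    have -> : scalew 1 = expR (- 1) :> R by rewrite /scalew; lra.
    move: s7; rewrite (_ : - (71 / 10) = - 1 + - (61 / 10)); last by lra.
    rewrite expRD; have e6 : expR (- (61 / 10)) <= 1 / 100 :> R.
      have : (6%:R : R) <= 61 / 10 by lra.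
      move=> /expRN_le /le_trans; apply; rewrite !exprS expr0; lra.
    have e1 := expR_gt0 (- 1 : R).
    have : expR (- 1) * expR (- (61 / 10)) <= expR (- 1) * (1 / 100) :> R by rewrite ler_wpM2l// ltW.
    by move: (expR _ * _) => q; lra.
  have : scalew (27 / 5) <= scalew (c / y) by apply: scalew_dec.
  have -> : scalew (27 / 5) = 98 / 10 * expR (- (27 / 5)) :> R by rewrite /scalew; congr (_ * _); lra.
  move: s7; rewrite (_ : - (71 / 10) = - (27 / 5) + - (17 / 10)); last by lra.
  rewrite expRD; have e1 := expR_gt0 (- (27 / 5) : R).
  have : expR (- (27 / 5)) * expR (- (17 / 10)) <= expR (- (27 / 5)) * (21 / 100) :> R.
    by rewrite ler_wpM2l// ltW.
  by move: (expR _ * expR _) => q; lra.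
pose w p : R := if p == (0, 0) then - 1 else if p \in [:: (0, 1); (0, -1)] then scalew (c / y) else 0.
have wsupp p : p \notin [fset (0, 0); (0, 1); (0, -1) : int * int]%fset -> w p = 0.
  by rewrite !inE !negb_or -andbA /w => /and3P[/negbTE -> /negbTE h1 /negbTE h2]; rewrite !inE h1 h2.
apply: (@le_trans _ _ (isum w)).
  rewrite (isum_fsupp wsupp) fsetUC big_fsetU1 ?inE//= fsetUC big_fsetU1 ?inE//= big_seq_fset1.
  by rewrite /w /=; lra.
apply: le_isum; [exact: asum_fsupp wsupp|exact: asz|].
move=> p; rewrite /w; case: eqP => [->|/eqP pn0].
  by rewrite /latq /= !mul0r addr0 expr0n /= addr0 mul0r mulr0 /scalew mulr0 oppr0 expR0; lra.
case: ifP => [|_].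
  rewrite !inE => /orP[] /eqP ->; rewrite /latq /= !mul0r add0r ?rmorphN ?sqrrN expr1n expr0n /= addr0;
  by rewrite mul1r.
apply: scalew_ge0; apply: (@le_trans _ _ (c / y)); first by lra.
by rewrite ler_wpM2l ?(ltW c0)// latq_reduced_ge.
Qed.

(** For flat lattices, the row through [0] already has a sum close to [0], while
    the sum over the hexagonal lattice is close to [-1]. *)
Lemma scalew_sum_far : reduced -> c / y <= 1 ->
  isum (fun p => scalew (c * latq (1 / 2) (hexy R) p)) <=
  isum (fun p => scalew (c * latq x y p)).
Proof.
move=> red cy1; have y0 : 0 < y by case: red.
have t7 := hex_scale_ge; apply: (le_trans (hex_sum_le t7)).
have c0 : 0 < c by apply: lt_le_trans c6; lra.
have cy : 0 < c / y <= 1 by rewrite divr_gt0.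
have small : scalew (c / hexy R) <= 1 / 50.
  apply: (@le_trans _ _ (scalew 7)); first by apply: scalew_dec; lra.
  have := @expRN_le R 7 7 (lexx _); rewrite /scalew !exprS expr0.
  by move: (expR _) => e; lra.
apply: (@le_trans _ _ (- (7 / 10))); first by lra.
apply: (le_trans (line_sum_ge cy)).
pose w p : R := if p.1 == 0 then scalew (c * latq x y p) else 0.
have -> : isum (fun j : int => scalew (c / y * j%:~R ^+ 2)) = isum w.
  rewrite (@isum_inj R _ _ (fun n : int => (0 : int, n)) w).
  - apply: eq_isum => n; rewrite /w /=; congr scalew.
    by rewrite /latq /= !mul0r add0r expr0n /= addr0 [RHS]mulrA mulrAC.
  - by move=> m n [].
  - by move=> [m n] H; rewrite /w /=; case: eqP => // m0; case: (H n); rewrite m0.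
apply: le_isum; [|exact: asz|].
  apply: asum_le (asum_norm (asz y0)) => p; rewrite /w; case: ifP => // _.
  by rewrite normr0.
move=> p; rewrite /w; case: ifPn => // pn0; apply: scalew_ge0.
apply: (@le_trans _ _ (c * y)).
  have yh := reduced_im_ge red; have c6' := c6; have hg := hexy_gt R.
  have h : 62 / 10 * (86 / 100) <= c * y by apply: ler_pM; lra.
  by lra.
rewrite ler_wpM2l ?(ltW c0)// /latq ler_pdivlMr// exprMn.
have n1 : 1 <= p.1%:~R ^+ 2 :> R by rewrite -rmorphXn (ler_int R 1) /=; nia.
apply: (@le_trans _ _ (p.1%:~R ^+ 2 * y ^+ 2)).
  by rewrite -expr2 ler_peMl ?sqr_ge0.
by rewrite lerDr sqr_ge0.
Qed.


(** Averaging over the rotation of order [3] fixes the hexagonal form; the gain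
    of the first shell exceeds the loss of the others, both linear in [eta]. *)
Lemma scalew_sum_near : reduced -> 27 / 5 <= c / y ->
  isum (fun p => scalew (c * latq (1 / 2) (hexy R) p)) <=
  isum (fun p => scalew (c * latq x y p)).
Proof.
move=> red cy5; have [x0 x2 xy1 y0] := red; have t7 := hex_scale_ge.
have c0 : 0 < c by apply: lt_le_trans c6; lra.
have h0 : 0 < hexy R by have hg := hexy_gt R; lra.
set t := c / hexy R in t7.
pose a := hexy R * ((x ^+ 2 + y ^+ 2 - x) / y); pose b := hexy R * ((1 - x) / y).
pose d := hexy R * (x / y).
have a0 : 0 <= a by rewrite mulr_ge0 ?(ltW h0)// divr_ge0 ?(ltW y0)//; lra.
have b0 : 0 <= b by rewrite mulr_ge0 ?(ltW h0)// divr_ge0 ?(ltW y0)//; lra.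
have d0 : 0 <= d by rewrite mulr_ge0 ?(ltW h0)// divr_ge0 ?(ltW y0).
have e2 : a * b + b * d + d * a = 3 / 4.
  rewrite -(hexy_sqr R) /a /b /d; move: (hexy R) => h; field; by rewrite gt_eqF.
pose q (p : int * int) : R := a * p.1%:~R ^+ 2 + b * p.2%:~R ^+ 2 + d * (p.1 + p.2)%:~R ^+ 2.
have qE p : c * latq x y p = t * q p.
  rewrite /latq /t /q /a /b /d intrD; move: (p.1%:~R : R) (p.2%:~R : R) (hexy R) h0 => m n h h0.
  by field; rewrite !gt_eqF.
have hE p : c * latq (1 / 2) (hexy R) p = t * (hexn R p / 2).
  by rewrite latq_hex /t; move: (hexy R) h0 (hexn R p) => h h0 N; field; rewrite gt_eqF.
have q5 p : p != (0, 0) -> 27 / 5 <= t * q p.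
  by move=> pn0; rewrite -qE; apply: (le_trans cy5); rewrite ler_wpM2l ?(ltW c0)// latq_reduced_ge.
have qb : q (0, 1) = b + d by rewrite /q /=; ring.
have qa : q (1, 0) = d + a by rewrite /q /=; ring.
have qd : q (1, -1) = a + b by rewrite /q /=; ring.
have tb : 27 / 5 <= t * (b + d) by rewrite -qb q5.
have ta : 27 / 5 <= t * (d + a) by rewrite -qa q5.
have td : 27 / 5 <= t * (a + b) by rewrite -qd q5.
have t5 : 27 / 5 <= t by lra.
have shell := shell_sum_ge a0 b0 d0 e2 t5 tb ta td.
pose eta := 2 / 3 * (a + b + d) - 1; rewrite -/eta in shell.
have eta0 : 0 <= eta.
  by have := trace_ge e2 (addr_ge0 (addr_ge0 a0 b0) d0); rewrite /eta; lra.
pose G p := scalew (c * latq x y p) - scalew (c * latq (1 / 2) (hexy R) p).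
have ah : asum (fun p => scalew (c * latq (1 / 2) (hexy R) p)) by exact: asum_scalew.
have aG : asum G by apply: asumB => //; exact: asz.
rewrite -subr_ge0 -isumB//; last exact: asz.
suff : 0 <= 3 * isum G by rewrite pmulr_rge0.
rewrite -isum_orbit//.
pose k1 := eta * expR (- t) * ((2 * t - 3) * t / 3).
pose k2 := eta * expR (- t) * (3 / 14 * t ^+ 2).
have as1 := asumZ k1 (asum_shellw R); have as2 := asumZ k2 (asum_geo R).
have ee : 0 <= eta * expR (- t) by rewrite mulr_ge0 ?expR_ge0.
apply: (@le_trans _ _ (isum (fun p => k1 * shellw R p - k2 * geo R p))).
  rewrite isumB// !isumZ ?isum_shellw//; [|exact: asum_geo|exact: asum_shellw].
  have g9 := isum_geo R; move: (isum (geo R)) g9 => g g9.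
  rewrite /k1 /k2 -!(mulrA (eta * _)) -mulrBr mulr_ge0//.
  exact: shell_gain_ge.
have aG1 := reindex_asum rot_bij aG; have aG2 := reindex_asum rot_bij aG1.
apply: le_isum; [exact: asumB|by apply: asumD => //; exact: asumD|] => p.
rewrite /G !hE !hexn_rot !qE.
have k20 : 0 <= k2 * geo R p by rewrite mulr_ge0 ?geo_ge0// mulr_ge0// mulr_ge0// sqr_ge0.
have [p0|ps|N6] := hexn_cases R p.
- have q00 : q (0, 0) = 0 by rewrite /q /=; ring.
  have h00 : hexn R (0, 0) = 0 by rewrite /hexn /=; ring.
  have r0 : rot (0, 0) = (0, 0) by [].
  rewrite p0 !r0 q00 h00 mul0r !mulr0 !subrr !addr0 sub0r oppr_le0 -p0.
  exact: k20.
- have -> : shellw R p = 1 by rewrite /shellw ps.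
  rewrite first_shell_hexn// divff// mulr1 mulr1.
  have -> : scalew (t * q p) - scalew t + (scalew (t * q (rot p)) - scalew t) +
      (scalew (t * q (rot (rot p))) - scalew t) =
      scalew (t * q (1, 0)) + scalew (t * q (0, 1)) + scalew (t * q (1, -1)) - 3 * scalew t.
    have qo (m n : int) : q (- m, - n) = q (m, n).
      by rewrite /q /= -opprD !rmorphN !sqrrN.
    have q1 : q (-1, 1) = q (1, -1) by rewrite -(qo 1 (-1)).
    have q2 : q (-1, 0) = q (1, 0) by rewrite -(qo 1 0).
    have q3 : q (0, -1) = q (0, 1) by rewrite -(qo 0 1).
    move: ps; rewrite !inE => /orP[|/orP[|/orP[|/orP[|/orP[]]]]] /eqP ->;
      rewrite /rot /= ?q1 ?q2 ?q3; ring.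
  rewrite qa qb qd.
  have -> : k1 = (2 * t - 3) * t * expR (- t) / 3 * eta by rewrite /k1; ring.
  by lra.
- have sw : shellw R p = 0.
    rewrite /shellw; case: (boolP (p \in first_shell)) => // /(first_shell_hexn R) hp.
    by move: N6; rewrite hp; lra.
  have pn0 : p != (0, 0) by apply/eqP => pE; move: N6; rewrite pE /hexn /=; lra.
  have rn0 p' : p' != (0, 0) -> rot p' != (0, 0).
    move=> h; apply: contra h => /eqP rE; apply/eqP; apply: (bij_inj rot_bij); exact: rE.
  have tail := hex_tail_le t7 N6.
  set N := hexn R p in N6 tail *.
  have u5 := q5 _ pn0; have v5 := q5 _ (rn0 _ pn0); have w5 := q5 _ (rn0 _ (rn0 _ pn0)).
  have S : t * q p + t * q (rot p) + t * q (rot (rot p)) = 3 * (t * (N / 2)) * (1 + eta).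
    by rewrite /q /rot /N /hexn /eta /= !(intrD, rmorphN); field.
  have tN : t <= t * (N / 2).
    by rewrite ler_peMr ?(le_trans _ t5)// ler_pdivlMr// mul1r (le_trans _ N6)// ler_nat.
  have T := @tail_sum_ge (t * (N / 2)) _ _ _ eta _ _ _ _ S.
  have {}T : 3 * scalew (t * (N / 2)) - 3 * (2 * (t * (N / 2)) - 3) * (t * (N / 2)) *
     expR (- (t * (N / 2))) * eta <=
     scalew (t * q p) + scalew (t * q (rot p)) + scalew (t * q (rot (rot p))).
    have half5 (u : R) : 27 / 5 <= u -> 5 / 2 <= u by apply: le_trans; lra.
    by apply: T; [apply: half5; exact: le_trans (le_trans _ tN)|exact: half5..].
  rewrite sw mulr0 sub0r.
  have N0 : 0 <= N by apply: le_trans N6.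
  have t0 : 0 <= t by apply: le_trans t5; exact: divr_ge0.
  have key := tail_loss_le t0 N0 eta0 (expR_ge0 _) tail.
  move: T key; rewrite -/k2; move: (_ * eta) (k2 * _) => u v T key.
  by move: T key; clear; lra.
Qed.

End Reduced.
End LargeScale.

(** * The hexagonal lattice has the largest increments *)

Section HexagonalIncrements.
Variable R : realType.
Implicit Types (s x y : R).

Lemma ntheta_incr_large x y s s' : reduced x y -> 2 <= s -> s <= s' ->
  ntheta s' x y - ntheta s x y <= ntheta s' (1 / 2) (hexy R) - ntheta s (1 / 2) (hexy R).
Proof.
move=> red; have y0 : 0 < y by case: red.
apply: ntheta_incr_of_scalew => // c c6.
have [c1|/ltW c1] := leP (c / y) 1; first exact: scalew_sum_far.
have [c5|/ltW c5] := leP (c / y) (27 / 5); first exact: scalew_sum_mid.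
exact: scalew_sum_near.
Qed.

(** Reduce [z] and split the scales at [2]: the Fourier side handles the small
    ones, the lattice side the large ones. *)
Lemma ntheta_incr_hex x y s s' : 0 < y -> 1 <= s -> s <= s' ->
  ntheta s' x y - ntheta s x y <= ntheta s' (1 / 2) (hexy R) - ntheta s (1 / 2) (hexy R).
Proof.
move=> y0 s1 ss; have [u [v [v0 /andP[u0 u2] uv1 E]]] := reduction x y0.
rewrite -!E; have red : reduced u v by split.
have vh := reduced_im_ge red.
have [s'2|/ltW s'2] := leP s' 2; first exact: ntheta_incr_small.
have [s2|/ltW s2] := leP 2 s; first exact: ntheta_incr_large.
have h1 := ntheta_incr_small s1 s2 (lexx 2) u vh.
have h2 := ntheta_incr_large red (lexx 2) s'2.
by lra.
Qed.

Lemma ntheta_ge_sqrt s x y : 0 < s -> 0 < y -> Num.sqrt s <= ntheta s x y.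
Proof.
move=> s0 y0; rewrite /ntheta -[leLHS]mulr1 ler_wpM2l ?sqrtr_ge0//.
rewrite -[leLHS](isum_delta R ((0, 0) : int * int)).
apply: le_isum; [exact: asum_delta|exact: asum_lat|] => p.
case: eqP => [->|_]; last exact: expR_ge0.
by rewrite /latq /= !mul0r addr0 expr0n /= addr0 mul0r mulr0 oppr0 expR0.
Qed.

Lemma ntheta_hex_le_sqrt : exists C, forall s, 1 <= s ->
  ntheta s (1 / 2) (hexy R) <= Num.sqrt s + C / s.
Proof.
have hg := hexy_gt R; have hl := hexy_lt R; have p31 := pi_gt31 R.
have h0 : 0 < hexy R by lra.
have ip0 : 0 < pi^-1 :> R by rewrite invr_gt0 pi_gt0.
have ae := asum_lat (1 / 2) ip0 h0.
exists (2 * isum (fun p => expR (- (pi * pi^-1 * latq (1 / 2) (hexy R) p)))) => s s1.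
have s0 : 0 < s by lra.
have ad := asum_delta R ((0, 0) : int * int).
have -> : Num.sqrt s = isum (fun p : int * int => Num.sqrt s * (p == (0, 0))%:R).
  by rewrite isumZ// isum_delta mulr1.
rewrite mulrAC -isumZ// -isumD; [|exact: asumZ|exact: asumZ].
rewrite /ntheta -isumZ; last exact: asum_lat.
apply: le_isum; [by apply: asumZ; exact: asum_lat|by apply: asumD; exact: asumZ|] => p.
have e0 := expR_ge0 (- (pi * pi^-1 * latq (1 / 2) (hexy R) p)).
have s2 : 0 <= 2 / s by rewrite divr_ge0// ltW.
case: eqP => [->|/eqP pn0].
  have E1 : expR (- (pi * s * latq (1 / 2) (hexy R) (0, 0))) <= 1.
    by rewrite expR_le1 oppr_le0; apply: mulr_ge0 (latq_ge0 _ _ h0); rewrite mulr_ge0 ?pi_ge0// ltW.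
  rewrite mulr1; apply: (le_trans (ler_piMr (sqrtr_ge0 s) E1)).
  by rewrite lerDl; apply: mulr_ge0 => //; exact: expR_ge0.
rewrite mulr0 add0r divff ?gt_eqF ?pi_gt0// (mul1r (latq _ _ _)).
have q1 : 1 <= latq (1 / 2) (hexy R) p.
  rewrite latq_hex ler_pdivlMr; last by lra.
  have [p0|/(first_shell_hexn R) ->|] := hexn_cases R p; [|by lra|by lra].
  by rewrite p0 eqxx in pn0.
move: (latq _ _ _) q1 => q q1.
apply: (@le_trans _ _ (s * (expR (- s) * expR (- s) * expR (- q)))).
  apply: ler_pM; rewrite ?sqrtr_ge0 ?expR_ge0//.
    have sE : Num.sqrt (s ^+ 2) = s by rewrite sqrtr_sqr gtr0_norm.
    rewrite -[leRHS]sE ler_sqrt ?sqr_ge0//.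
    by rewrite expr2 ler_peMl// ltW.
  rewrite -!expRD ler_expR -!opprD lerN2.
  have h1 : s * 1 <= s * q by rewrite ler_wpM2l// ltW.
  have h2 : 1 * q <= s * q by rewrite ler_wpM2r//; lra.
  have h3 : 3 * (s * q) <= pi * (s * q) by rewrite ler_wpM2r ?mulr_ge0//; lra.
  rewrite -[in leRHS]mulrA; move: (pi * (s * q)) h3 => u h3.
  by move: (s * q) h1 h2 h3 => v; rewrite mulr1 mul1r => h1 h2 h3; lra.
rewrite mulrA ler_wpM2r ?expR_ge0// ler_pdivlMr//.
have es := expR_ge_quad (ltW s0); have e1 : expR (- s) <= 1 by rewrite expR_le1; lra.
have ee : expR s * expR (- s) = 1 by rewrite -expRD subrr expR0.
have en := expR_ge0 (- s).
apply: (@le_trans _ _ (2 * (expR s * expR (- s)) * expR (- s))).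
  rewrite (_ : s * (expR (- s) * expR (- s)) * s = s ^+ 2 * expR (- s) * expR (- s)); last by ring.
  rewrite ler_wpM2r// mulrA ler_wpM2r//.
  by move: (s ^+ 2) es => q2; lra.
by rewrite ee; lra.
Qed.

(** Increments compare up to scale [+oo], where both sides approach
    [sqrt s]. *)
Lemma ntheta_hex_min s x y : 0 < y -> 1 <= s ->
  ntheta s (1 / 2) (hexy R) <= ntheta s x y.
Proof.
move=> y0 s1; have [C HC] := ntheta_hex_le_sqrt.
rewrite leNgt; apply/negP => lt.
pose e := ntheta s (1 / 2) (hexy R) - ntheta s x y.
have e0 : 0 < e by rewrite subr_gt0.
pose s' := s + (`|C| + 1) / e.
have d0 : 0 < (`|C| + 1) / e by rewrite divr_gt0// ltr_wpDl.
have ss : s <= s' by rewrite lerDl ltW.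
have s'1 : 1 <= s' by lra.
have h1 := ntheta_incr_hex x y0 s1 ss; have h2 := HC _ s'1.
have s'0 : 0 < s' by lra.
have h3 := ntheta_ge_sqrt x s'0 y0.
have : C / s' < e.
  rewrite ltr_pdivrMr// (le_lt_trans (ler_norm C))// /s' mulrDr mulrCA divff ?mulr1 ?gt_eqF//.
  have es : 0 < e * s by rewrite mulr_gt0//; lra.
  by lra.
by move: h1 h2 h3; rewrite /e; lra.
Qed.

End HexagonalIncrements.

(** * Theta functions of lattices *)

Section Theta.
Variable R : realType.
Implicit Types (s x y : R) (z : R[i]).

Lemma theta_isum s x y : 0 < s -> 0 < y ->
  theta s (x +i* y) = isum (fun p : int * int => expR (- (pi * s * latq x y p))).
Proof.
move=> s0 y0; rewrite isum_ge0E; [|by move=> p; exact: expR_ge0|exact: asum_lat].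
rewrite /theta /nsum; congr fine; apply: eq_esum => p _; congr (EFin (expR (- _))).
have re (m : int) (r : R) : r = m%:~R -> (m%:~R : R[i]) = r +i* 0.
  by move=> ->; rewrite -(rmorph_int (real_complex R)).
rewrite (re p.1 _ erefl) (re p.2 _ erefl) /=.
rewrite sqr_sqrtr ?addr_ge0 ?sqr_ge0// /latq !mul0r subr0 !addr0.
by move: (pi : R) => q; field; rewrite gt_eqF.
Qed.

Lemma theta_ntheta s x y : 0 < s -> 0 < y ->
  ntheta s x y = Num.sqrt s * theta s (x +i* y).
Proof. by move=> s0 y0; rewrite theta_isum. Qed.

(** [c = cos (pi / 3)] satisfies [2 c^2 - 1 = cos (2 pi / 3) = - c]. *)
Lemma cos_pi3 : cos (pi / 3) = 1 / 2 :> R.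
Proof.
have p0 := pi_gt0 R.
set c := cos (pi / 3).
have c0 : 0 < c.
  by apply: cos_gt0_pihalf; apply/andP; split; lra.
have : cos (pi / 3 + pi / 3) = - c :> R.
  rewrite -[in RHS]/c (_ : pi / 3 + pi / 3 = pi - pi / 3); last by field.
  by rewrite addrC cosDpi cosN.
rewrite -mulr2n cos_mulr2n -/c => h.
have : (2 * c - 1) * (c + 1) = 0.
  by rewrite (_ : _ * _ = c ^+ 2 *+ 2 - 1 + c); [rewrite h; ring|ring].
move/eqP; rewrite mulf_eq0 => /orP[/eqP|/eqP]; lra.
Qed.

Lemma sin_pi3 : sin (pi / 3) = hexy R.
Proof.
have p0 := pi_gt0 R; have h := hexy_gt R.
have s0 : 0 < sin (pi / 3 : R) by apply: sin_gt0_pi; apply/andP; split; lra.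
have E : sin (pi / 3) ^+ 2 = hexy R ^+ 2.
  have := cos2Dsin2 (pi / 3 : R); rewrite cos_pi3 hexy_sqr.
  by move: (sin _ ^+ 2) => u; lra.
by apply/eqP; rewrite -(eqrXn2 (n := 2))// ?ltW// ?E//; lra.
Qed.

Lemma pgauss_ge0 s y (p : int * int) : 0 <= pgauss s y p.
Proof. exact: expR_ge0. Qed.

Lemma ntheta_axis s y : 0 < s -> 0 < y -> ntheta s 0 y = Num.sqrt y * isum (pgauss s y).
Proof.
move=> s0 y0; rewrite ntheta_poisson//; congr (_ * _); apply: eq_isum => p.
by rewrite mulr0 cos0 mulr1.
Qed.

(** Along the imaginary axis [ntheta s 0 y] grows like [sqrt y] at every scale:
    [ntheta_axis_ge] and [ntheta_axis_le] isolate the constant Fourier term. *)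
Lemma ntheta_axis_ge s y : 0 < s -> 0 < y -> Num.sqrt y <= ntheta s 0 y.
Proof.
move=> s0 y0; rewrite ntheta_axis// -[leLHS]mulr1 ler_wpM2l ?sqrtr_ge0//.
rewrite -[leLHS](isum_delta R ((0, 0) : int * int)).
apply: le_isum; [exact: asum_delta|exact: asum_pgauss|] => p.
case: eqP => [->|_]; last exact: expR_ge0.
by rewrite /pgauss /= expr0n /= mulr0 mul0r addr0 mulr0 oppr0 expR0.
Qed.

Lemma ntheta_axis_le s : 1 <= s -> exists2 C, 0 <= C & forall y, 1 <= y ->
  ntheta s 0 y <= Num.sqrt y * (1 + C / y).
Proof.
move=> s1; have s0 : 0 < s by lra.
have h0 : 0 < 1 / 2 :> R by lra.
have ag := asum_pgauss s0 h0.
exists (2 * s * isum (pgauss s (1 / 2))) => [|y y1].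
  apply: mulr_ge0; first by lra.
  by apply: isum_ge0 => // p; exact: pgauss_ge0.
have y0 : 0 < y by lra.
have ad := asum_delta R ((0, 0) : int * int).
rewrite ntheta_axis// ler_wpM2l ?sqrtr_ge0//.
rewrite -[X in X + _](isum_delta R ((0, 0) : int * int)) [X in _ + X]mulrAC -isumZ// -isumD; [|exact: ad|exact: asumZ].
apply: le_isum; [exact: asum_pgauss|by apply: asumD => //; exact: asumZ|] => p.
have c0 : 0 <= 2 * s / y by rewrite divr_ge0 ?mulr_ge0//; lra.
have g0 := pgauss_ge0 s (1 / 2) p.
case: eqP => [->|/eqP pn0].
  rewrite {1}/pgauss /= expr0n /= mulr0 mul0r addr0 mulr0 oppr0 expR0.
  by rewrite lerDl mulr_ge0 ?pgauss_ge0.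
rewrite add0r /pgauss.
have w1 : s^-1 <= s * p.1%:~R ^+ 2 + p.2%:~R ^+ 2 / s.
  have n1 : 1 <= p.1%:~R ^+ 2 + p.2%:~R ^+ 2 :> R.
    rewrite -!rmorphXn -rmorphD (ler_int R 1) /=.
    by case: p pn0 {g0} => m n; rewrite -pair_eqE /= negb_and => /orP[] ?; nia.
  have is1 : s^-1 <= s by rewrite (le_trans _ s1)// invf_le1.
  apply: (@le_trans _ _ (s^-1 * (p.1%:~R ^+ 2 + p.2%:~R ^+ 2))).
    by rewrite ler_peMr// invr_ge0 ltW.
  rewrite mulrDr; apply: lerD; first by apply: ler_wpM2r; [exact: sqr_ge0|exact: is1].
  by rewrite mulrC.
move: (s * _ + _) w1 => w w1.
have p1 : 1 <= pi :> R by have := pi_gt31 R; lra.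
have is0 : 0 < s^-1 by rewrite invr_gt0.
have w0 : 0 < w by lra.
have pw : w <= pi * w by rewrite ler_peMl// ltW.
have -> : pi * y * w = y * (pi * w) by rewrite mulrA (mulrC pi).
have -> : pi * (1 / 2) * w = pi * w / 2 by rewrite mulrAC mul1r.
move: (pi * w) pw => v pw.
have v0 : 0 <= v by lra.
have yv0 : 0 < y * v by rewrite mulr_gt0//; lra.
have h := le_expR_half (ltW yv0).
have iv : 1 <= s * v.
  by rewrite -(ler_pdivrMl _ _ s0) mulr1; lra.
apply: (@le_trans _ _ (s * v * expR (- (y * v)))); first by rewrite ler_peMl ?expR_ge0.
rewrite -(ler_pM2r y0) (_ : 2 * s / y * _ * y = 2 * s * expR (- (v / 2))); last first.
  by rewrite mulrAC divfK// gt_eqF.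
rewrite (_ : s * v * _ * y = s * (y * v * expR (- (y * v)))); last by ring.
rewrite -[leRHS]mulrA [leRHS]mulrCA ler_wpM2l ?(ltW s0)//.
apply: (le_trans h); apply: (@le_trans _ _ (expR (- (v / 2)))).
  by rewrite ler_expR lerN2 ler_wpM2r// ler_peMl.
by have := expR_ge0 (- (v / 2)); move: (expR _) => e; lra.
Qed.

End Theta.

(** * The minimization problem *)

Section Minimization.
Variable R : realType.
Implicit Types (alpha a b : R).

(** Only the ratio [b / sqrt a] matters. *)
Lemma ntheta_combination alpha a b x y : 0 < alpha -> 0 < a -> 0 < y ->
  Num.sqrt alpha * (theta alpha (x +i* y) - b * theta (a * alpha) (x +i* y)) =
  ntheta alpha x y - b / Num.sqrt a * ntheta (a * alpha) x y.
Proof.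
move=> al0 a0 y0; rewrite !theta_ntheta ?mulr_gt0// sqrtrM ?(ltW a0)//.
have sa : Num.sqrt a != 0 by rewrite gt_eqF ?sqrtr_gt0.
by move: (theta _ _) (theta _ _) (Num.sqrt a) (Num.sqrt alpha) sa => u v p q sa; field.
Qed.

End Minimization.

Theorem theorem1p2 (R : realType) (alpha a b : R)
    (halpha : 1 <= alpha) (ha : 1 < a) :
  (b <= Num.sqrt a ->
     minimizer_on (@upper_half_plane R)
       (fun z : R[i] => theta alpha z - b * theta (a * alpha) z)
       (expi (pi / 3))) /\
  (Num.sqrt a < b ->
     ~ exists z : R[i],
       minimizer_on (@upper_half_plane R)
         (fun w : R[i] => theta alpha w - b * theta (a * alpha) w) z).
Proof.
have al0 : 0 < alpha by lra.
have a0 : 0 < a by lra.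
have h0 : 0 < hexy R by have := hexy_gt R; lra.
have aal : alpha <= a * alpha by rewrite ler_peMl// ltW.
have aal1 : 1 <= a * alpha by lra.
have sa0 : 0 < Num.sqrt a by rewrite sqrtr_gt0.
have sal0 : 0 < Num.sqrt alpha by rewrite sqrtr_gt0.
have comb := fun x y => @ntheta_combination R alpha a b x y al0 a0.
split=> [ba|ab].
  have rhoE : expi (pi / 3) = (1 / 2) +i* hexy R by rewrite /expi cos_pi3 sin_pi3.
  rewrite rhoE; split; first by [].
  move=> [x y] y0; rewrite /upper_half_plane /= in y0.
  rewrite -(ler_pM2l sal0) !comb//.
  have b1 : b / Num.sqrt a <= 1 by rewrite ler_pdivrMr// mul1r.
  have h1 := ntheta_incr_hex x y0 halpha aal.
  have h2 := ntheta_hex_min x y0 aal1.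
  have h3 : 0 <= (1 - b / Num.sqrt a) *
      (ntheta (a * alpha) x y - ntheta (a * alpha) (1 / 2) (hexy R)).
    by rewrite mulr_ge0// subr_ge0.
  by move: h1 h2 h3; move: (b / Num.sqrt a) (ntheta _ _ _) (ntheta _ _ _) (ntheta _ _ _)
    (ntheta _ _ _) => c A B C D h1 h2 h3; lra.
move=> [[x y] [y0 zmin]]; rewrite /upper_half_plane /= in y0.
pose V := Num.sqrt alpha * (theta alpha (x +i* y) - b * theta (a * alpha) (x +i* y)).
pose beta := b / Num.sqrt a; have b1 : 1 < beta by rewrite ltr_pdivlMr// mul1r.
have [C C0 HC] := ntheta_axis_le halpha.
(* At z = i Y^2 the function times sqrt alpha is at most
   Y + C - beta Y, which is below V for this Y. *)
pose Y := (C + `|V| + 1) / (beta - 1) + 1.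
have bb : 0 < beta - 1 by rewrite subr_gt0.
have Y1 : 1 <= Y by rewrite lerDr divr_ge0 ?(ltW bb)// !addr_ge0.
have Y0 : 0 < Y by lra.
have YY1 : 1 <= Y ^+ 2 by rewrite expr_ge1// ltW.
have YY0 : 0 < Y ^+ 2 by lra.
have := zmin (0 +i* (Y ^+ 2)); rewrite /upper_half_plane /= => /(_ YY0).
rewrite -(ler_pM2l sal0) -/V comb// -/beta => VY.
have h1 := HC _ YY1; have aal0 : 0 < a * alpha by rewrite mulr_gt0.
have h2 := ntheta_axis_ge aal0 YY0.
rewrite sqrtr_sqr (ger0_norm (ltW Y0)) in h1 h2.
have h3 : Y * (1 + C / Y ^+ 2) <= Y + C.
  rewrite mulrDr mulr1 lerD2l (_ : Y * (C / Y ^+ 2) = C / Y); last by field; rewrite gt_eqF.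
  by rewrite ler_pdivrMr// ler_peMr.
have h4 : beta * Y <= beta * ntheta (a * alpha) 0 (Y ^+ 2) by rewrite ler_wpM2l//; lra.
have h5 : (beta - 1) * Y = C + `|V| + 1 + (beta - 1).
  by rewrite /Y mulrDr mulr1 mulrC divfK// gt_eqF.
have h6 := ler_norm (- V); rewrite normrN in h6.
by lra.
Qed.
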